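(* Let $\varphi_1,\dots,\varphi_K$ be toll functions, for some $K\ge1$, let $\Phi_k(T)=\sum_{v\in T}\varphi_k(T^v)$ be the corresponding additive functionals on tries, and assume that for some $r>2$ and each $k=1,\dots,K$, as $\lambda\to\infty$, $$\operatorname{Var}\Phi_k(\widetilde{\mathcal T}_\lambda)=O(\lambda),\qquad\operatorname{Var}\varphi_k(\widetilde{\mathcal T}_\lambda)=o(\lambda),\qquad\mathbb E\bigl|\varphi_k(\widetilde{\mathcal T}_\lambda)-\mathbb E\varphi_k(\widetilde{\mathcal T}_\lambda)\bigr|^r=O(\lambda^{r/2}).$$ Then, as $\lambda\to\infty$, $$\Bigl(\frac{\Phi_k(\widetilde{\mathcal T}_\lambda)-\mathbb E\,\Phi_k(\widetilde{\mathcal T}_\lambda)}{\sqrt\lambda}\Bigr)_{k=1}^K\overset{d}{\approx}N\bigl(0,\Sigma(\lambda)\bigr),$$ where the covariance matrix $\Sigma(\lambda)=(\sigma_{k\ell}(\lambda))_{k,\ell=1}^K$ is given by $$\sigma_{k\ell}(\lambda):=\frac{\operatorname{Cov}\bigl(\Phi_k(\widetilde{\mathcal T}_\lambda),\Phi_\ell(\widetilde{\mathcal T}_\lambda)\bigr)}{\lambda}.$$ Furthermore, this approximation holds with all moments and absolute moments of order $s<r$.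
   Context: Strings. $\mathcal A$ is a fixed finite alphabet with $|\mathcal A|\ge2$; $\mathbf p=(p_\alpha)_{\alpha\in\mathcal A}$ is a probability distribution with all $p_\alpha>0$. $\mathcal A^*=\bigcup_{m\ge0}\mathcal A^m$ is the set of finite strings, with empty string $\epsilon$. $\Xi^{(1)},\Xi^{(2)},\dots$ are i.i.d. random infinite strings, each with i.i.d. letters having distribution $\mathbf p$. Tries. Given a set of $n$ distinct infinite strings, let $\nu_{\boldsymbol\alpha}$ be the number of them having prefix $\boldsymbol\alpha\in\mathcal A^*$. The trie they generate is the empty tree $\emptyset$ if $n=0$; otherwise it is the finite rooted tree (root $\epsilon$, the children of $\boldsymbol\alpha$ being the nodes $\boldsymbol\alpha\gamma$, $\gamma\in\mathcal A$) whose nodes are all $\boldsymbol\alpha\in\mathcal A^*$ with either $\nu_{\boldsymbol\alpha}\ge2$ (internal nodes), or $\nu_{\boldsymbol\alpha}=1$ and $\boldsymbol\alpha=\epsilon$ or the parent of $\boldsymbol\alpha$ is an internal node (external nodes = leaves). A trie is any tree arising in this way. For a trie $T$ and $v\in\mathcal A^*$, the fringe tree is $T^v:=\{\boldsymbol\beta\in\mathcal A^*:v\boldsymbol\beta\in T\}$, again a trie. For $\lambda>0$, $N_\lambda\sim\mathrm{Po}(\lambda)$ is independent of the strings and $\widetilde{\mathcal T}_\lambda$ is the random trie generated by $\Xi^{(1)},\dots,\Xi^{(N_\lambda)}$. A toll function is a real-valued function $\varphi$ on the set of tries with $\varphi(\emptyset)=0$; its additive functional is $\Phi(T)=\sum_{v\in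 T}\varphi(T^v)$. Approximation in distribution. For random vectors in $\mathbb R^K$, $X_\lambda\overset{d}{\approx}Y_\lambda$ means $\mathbb E f(X_\lambda)=\mathbb E f(Y_\lambda)+o(1)$ for every bounded continuous $f:\mathbb R^K\to\mathbb R$; it holds with absolute moments of order $s>0$ if moreover $\mathbb E|X_\lambda|^s=\mathbb E|Y_\lambda|^s+o(1)$ (Euclidean norm, both sides finite), and with moments of order $s\in\mathbb N$ if moreover $\mathbb EX_\lambda^{\mathbf m}=\mathbb EY_\lambda^{\mathbf m}+o(1)$ (both sides finite) for every multi-index $\mathbf m$ with $|\mathbf m|=s$. ''All moments and absolute moments of order $s<r$'': absolute moments for all real $0<s<r$, ordinary moments for all integers $1\le s<r$. $N(0,\Sigma)$ stands for a (possibly degenerate) Gaussian vector with that law. *)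

(* Defs.v *)
From HB Require Import structures.
From mathcomp Require Export all_boot all_order all_algebra finmap.
From mathcomp Require Export all_classical all_reals all_analysis.
Export Order.TTheory GRing.Theory Num.Theory numFieldNormedType.Exports.
Set Implicit Arguments.
Unset Strict Implicit.
Unset Printing Implicit Defensive.
Local Open Scope classical_set_scope.
Local Open Scope ring_scope.

(* Letters are elements of [A], finite strings are [seq A], infinite strings
   are [nat -> A], and finite sets of nodes are [{fset (seq A)}]. *)
Section Tries.
Variable A : finType.

Definition has_prefix (x : nat -> A) (a : seq A) : bool :=
  a == mkseq x (size a).

Definition prefix_count n (x : 'I_n -> nat -> A) (a : seq A) : nat :=
  #|[set i | has_prefix (x i) a]%SET|.

Definition parent (a : seq A) : seq A := take (size a).-1 a.

(* Empty when n = 0, since then every prefix count vanishes. *)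
Definition trie_nodes n (x : 'I_n -> nat -> A) : set (seq A) :=
  [set a | (2 <= prefix_count x a)%N \/
           prefix_count x a = 1%N /\
           (a = [::] \/ (2 <= prefix_count x (parent a))%N)].

(* [trie_nodes x] is finite as soon as the strings are pairwise distinct; if it
   is infinite, [fset_set] returns the empty set. For i.i.d. random strings
   this happens with probability 0. *)
Definition trie n (x : 'I_n -> nat -> A) : {fset (seq A)} :=
  fset_set (trie_nodes x).

Definition fringe (T : {fset (seq A)}) (v : seq A) : {fset (seq A)} :=
  [fset drop (size v) w | w in T & prefix v w]%fset.

(* Toll functions are total on finite sets of strings; only their values on
   tries matter, because the fringe trees of a trie are tries. *)
Definition toll_function (R : realType) (phi : {fset (seq A)} -> R) : Prop :=
  phi fset0 = 0.

Definition additive_functional (R : realType) (phi : {fset (seq A)} -> R)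
    (T : {fset (seq A)}) : R :=
  \sum_(v <- T) phi (fringe T v).

End Tries.

Section Model.
Variables (d : measure_display) (Omega : measurableType d) (R : realType).
Variable P : probability Omega R.
Variable A : finType.

Definition mutually_independent (I : choiceType)
    (F : I -> set_system Omega) : Prop :=
  forall (J : {fset I}) (E : I -> set Omega),
    (forall i, i \in J -> F i (E i)) ->
    P (\bigcap_(i in [set` J]) E i) = (\prod_(i <- J) P (E i))%E.

(* [Xi i w j] is letter j of the infinite string number i. *)
Variable Xi : nat -> Omega -> nat -> A.

Definition letter_sigma (i j : nat) : set_system Omega :=
  preimage_set_system setT (fun w => Xi i w j) [set: set A].

Definition string_sigma (i : nat) : set_system Omega :=
  <<s \bigcup_j letter_sigma i j >>.

Definition strings_sigma : set_system Omega :=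
  <<s \bigcup_i string_sigma i >>.

Record trie_model (p : A -> R) (N : R -> {RV P >-> nat}) : Prop := {
  letter_measurable : forall i j, letter_sigma i j `<=` measurable;
  letter_law : forall i j a, P [set w | Xi i w j = a] = (p a)%:E;
  letters_independent : forall i, mutually_independent (letter_sigma i);
  strings_independent : mutually_independent string_sigma;
  size_law : forall l : R, 0 < l ->
    forall n : nat, P (N l @^-1` [set n]) = (poisson_pmf l n)%:E;
  size_independent : forall l : R, 0 < l ->
    forall (B : set nat) (E : set Omega), strings_sigma E ->
      P (N l @^-1` B `&` E) = (P (N l @^-1` B) * P E)%E }.

Definition random_trie (N : R -> Omega -> nat) (l : R) (w : Omega) :
    {fset (seq A)} :=
  trie (fun i : 'I_(N l w) => Xi i w).

End Model.

(* As l -> +oo. Stated in [\bar R], so that a bound entails eventual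
   finiteness. *)
Definition ebigO (R : realType) (f : R -> \bar R) (g : R -> R) : Prop :=
  exists C : R, \forall l \near +oo, (`|f l| <= (C * g l)%:E)%E.

Definition elittleo (R : realType) (f : R -> \bar R) (g : R -> R) : Prop :=
  forall e : R, 0 < e -> \forall l \near +oo, (`|f l| <= (e * g l)%:E)%E.

Definition asymp_eq (R : realType) (a b : R -> \bar R) : Prop :=
  (\forall l \near +oo, a l \is a fin_num /\ b l \is a fin_num) /\
  (fun l => fine (a l) - fine (b l)) @ +oo --> (0 : R).

Section Vectors.
Variables (R : realType) (K : nat).

Definition euclidean_norm (x : 'rV[R]_K) : R :=
  Num.sqrt (\sum_k x 0 k ^+ 2).

Definition monomial (m : 'I_K -> nat) (x : 'rV[R]_K) : R :=
  \prod_k x 0 k ^+ m k.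

(* The case split is needed because [normal_prob 0 0] is not a Dirac mass. *)
Definition centered_normal (v : R) (B : set R) : \bar R :=
  if v == 0 then \d_(0 : R) B else normal_prob 0 (Num.sqrt v) B.

(* N(0, S), possibly degenerate: every linear combination t of the coordinates
   has the univariate law N(0, t S t^T). *)
Definition gaussian_vector d (Omega : measurableType d)
    (Q : probability Omega R) (Y : Omega -> 'rV[R]_K) (S : 'M[R]_K) : Prop :=
  [/\ forall k, measurable_fun setT (fun w => Y w 0 k : R),
      S^T = S &
      forall t : 'rV[R]_K, let v := (t *m S *m t^T) 0 0 in
        0 <= v /\
        forall B : set R, measurable B ->
          Q [set w | B (\sum_k t 0 k * Y w 0 k)] = centered_normal v B].

Variables (d : measure_display) (Omega : measurableType d).
Variable P : probability Omega R.
Variables (d' : measure_display) (Omega' : measurableType d').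
Variable Q : probability Omega' R.
Variables (X : R -> Omega -> 'rV[R]_K) (Y : R -> Omega' -> 'rV[R]_K).

Definition approx_in_distribution : Prop :=
  forall f : 'rV[R]_K -> R, continuous f ->
    (exists M : R, forall x, `|f x| <= M) ->
    asymp_eq (fun l => 'E_P[(fun w => f (X l w))%R])%E
             (fun l => 'E_Q[(fun w => f (Y l w))%R])%E.

Definition approx_abs_moments (s : R) : Prop :=
  asymp_eq (fun l => 'E_P[(fun w => euclidean_norm (X l w) `^ s)%R])%E
           (fun l => 'E_Q[(fun w => euclidean_norm (Y l w) `^ s)%R])%E.

Definition approx_moments (s : nat) : Prop :=
  forall m : 'I_K -> nat, (\sum_k m k)%N = s ->
    asymp_eq (fun l => 'E_P[(fun w => monomial m (X l w))%R])%E
             (fun l => 'E_Q[(fun w => monomial m (Y l w))%R])%E.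

End Vectors.

(* Main.v *)
(* With a Poisson number of strings, the subtries at the children of the root are
   independent and are again Poissonized tries, with parameters p_a * lambda. An
   additive functional Phi with toll phi therefore satisfies the recursion
   Phi(T_lambda) = phi(T_lambda) + sum_a Phi(T_(p_a lambda)) with independent
   summands, up to a correction of the toll on the one-node trie.

   Moments: for s > 2 the sum of the p_a^(s/2) is less than 1, so the recursion is
   a contraction for lambda^(-s/2) E|Phi - E Phi|^s; this is applied repeatedly,
   doubling s, to reach the exponent r from the assumed variance bound. For
   lambda -> 0 it is started by subtracting a multiple of the number of leaves, so
   that the functional vanishes on tries with at most one string.

   Limit law: at u with u^2 lambda <= 1 the characteristic function of Phi - E Phi
   is within O((u^2 lambda)^(s/2)) of the Gaussian one with the same variance, for
   some s in (2, 3]. Applying the recursion m times and discarding tolls of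
   variance o(lambda) improves the constant by (sum_a p_a^(s/2))^m. For vectors,
   linear combinations of additive functionals are additive functionals. Closeness
   of characteristic functions is transferred to continuous test functions by
   approximating these on large boxes by trigonometric polynomials (Bernstein
   polynomials in the variables sin(omega x_k)), and to moments by truncation. *)

(* A trie is an element of a countable type, so measurability reduces to measurable fibres, and laws
   and independence need only be checked at points. The analytic part therefore rests on an abstract
   record of the splitting property, with coincidences of strings confined to one null set.

   Two obstacles shape the moment bound. The moment of order s is not known to be finite beforehand,
   so the contraction is run on a truncated power that grows only quadratically, with constants
   independent of the truncation. And the recursion visits arbitrarily small intensities, where a
   functional vanishing on at most one string has moments of order lambda^2, which for s > 4 is
   larger than lambda^(s/2). Hence the comparison function is lambda^q + lambda^(s/2) with 1 < q <=
   2; both powers contract because both exponents exceed 1.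

   For the limit law, the range u^2 lambda <= 1 is stable under replacing lambda by p_a lambda, so
   the induction never leaves it. *)
From mathcomp Require Import ring lra measurable_realfun.
Require Import Defs.
Set Implicit Arguments.
Unset Strict Implicit.
Unset Printing Implicit Defensive.
Local Open Scope classical_set_scope.
Local Open Scope ring_scope.

(** * Random variables with countably many values *)

Section Discrete.
Context d (Om : measurableType d) (R : realType) (C : countType).
Implicit Types X : Om -> C.

(** Countability of [C] makes measurable fibres equivalent to measurability for the full power set,
    so every function of [X] is measurable at once. *)
Definition discrete X := forall c, measurable (X @^-1` [set c]).

Lemma discrete_preimage X (B : set C) : discrete X -> measurable (X @^-1` B).
Proof.
move=> dX.
rewrite (_ : X @^-1` B =
   \bigcup_n (if choice.unpickle n is Some c then
                if c \in B then X @^-1` [set c] else set0 else set0)).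
  apply: bigcupT_measurable => n; case: (choice.unpickle n) => // c.
  by case: ifP => // _; exact: dX.
apply/seteqP; split=> [w Bw|w [n _]] /=.
  by exists (choice.pickle (X w)) => //; rewrite choice.pickleK mem_set.
by case: (choice.unpickle n) => // c; case: ifPn => // /set_mem Bc /= ->.
Qed.

Lemma discrete_measurable X d' (T' : sigmaRingType d') (f : C -> T') :
  discrete X -> measurable_fun setT (fun w => f (X w)).
Proof.
move=> dX _ B mB; rewrite setTI.
exact: (discrete_preimage (f @^-1` B) dX).
Qed.

Lemma discrete_measurableR X (f : C -> R) :
  discrete X -> measurable_fun setT (fun w => f (X w)).
Proof. exact: discrete_measurable. Qed.

Lemma discrete_measurableE X (f : C -> \bar R) :
  discrete X -> measurable_fun setT (fun w => f (X w)).
Proof. exact: discrete_measurable. Qed.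

Lemma discrete_pickle X n : discrete X ->
  measurable ((fun w => choice.pickle (X w)) @^-1` [set n]).
Proof. by move=> dX; exact: (discrete_preimage (fun c => choice.pickle c = n) dX). Qed.

Lemma trivIset_pickle X (E : set Om) :
  trivIset setT (fun n => E `&` (fun w => choice.pickle (X w)) @^-1` [set n]).
Proof. by move=> i j _ _ [w [[_ /= <-] [_ /= <-]]]. Qed.

Lemma bigcup_pickle X (E : set Om) :
  \bigcup_n (E `&` (fun w => choice.pickle (X w)) @^-1` [set n]) = E.
Proof.
apply/seteqP; split=> [w [n _ [? _]] //|w Ew].
by exists (choice.pickle (X w)).
Qed.

Lemma measure_discrete (mu : {measure set Om -> \bar R}) X E : discrete X ->
  measurable E ->
  mu E = (\sum_(n <oo) mu (E `&` (fun w => choice.pickle (X w)) @^-1` [set n]))%E.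
Proof.
move=> dX mE; rewrite -[in LHS](bigcup_pickle X E).
rewrite measure_bigcup//.
- by apply: eq_eseriesl => n; rewrite in_setT.
- by move=> n _; apply: measurableI => //; exact: discrete_pickle.
- exact: trivIset_pickle.
Qed.

(** The series runs over codes, and a code of no value contributes 0. Two discrete variables with
    the same fibre probabilities thus have termwise equal integrals. *)
Lemma integral_discrete (mu : {measure set Om -> \bar R}) X (f : C -> \bar R) :
  discrete X -> (forall c, 0 <= f c)%E ->
  (\int[mu]_w f (X w) = \sum_(n <oo) (oapp f 0 (choice.unpickle n) *
    mu ((fun w => choice.pickle (X w)) @^-1` [set n])))%E.
Proof.
move=> dX f0; rewrite -[in LHS](bigcup_pickle X setT).
rewrite ge0_integral_bigcup//.
- apply: eq_eseriesr => n _; rewrite setTI.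
  rewrite (eq_integral (fun=> oapp f 0%E (choice.unpickle n))); last first.
    by move=> w /set_mem /= <-; rewrite choice.pickleK.
  by rewrite integral_cst//; exact: discrete_pickle.
- by move=> n; rewrite setTI; exact: discrete_pickle.
- by rewrite bigcup_pickle; exact: discrete_measurable.
- exact: trivIset_pickle.
Qed.

End Discrete.

Section JointLaw.
Context d (Om : measurableType d) (R : realType) (P : probability Om R).
Context (I : finType) (C : countType) (X Y : I -> Om -> C).
Hypotheses (dX : forall i, discrete (X i)) (dY : forall i, discrete (Y i)).

(** A product formula at points extends to all sets, by splitting one coordinate at a time along its
    countably many values. *)
Lemma joint_law :
  (forall x : I -> C, P (\bigcap_i (X i @^-1` [set x i])) =
     (\prod_i P (Y i @^-1` [set x i]))%E) ->
  forall B : I -> set C, P (\bigcap_i (X i @^-1` B i)) =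
     (\prod_i P (Y i @^-1` B i))%E.
Proof.
move=> H.
have mcap (B : I -> set C) : measurable (\bigcap_i (X i @^-1` B i)).
  by apply: fin_bigcap_measurable => // i _; exact: discrete_preimage.
(* [s] lists the coordinates whose set is still arbitrary; outside it the sets have at most one
   point. *)
suff key (s : seq I) (B : I -> set C) :
    (forall i, i \notin s -> exists c, B i `<=` [set c]) ->
    P (\bigcap_i (X i @^-1` B i)) = (\prod_i P (Y i @^-1` B i))%E.
  by move=> B; apply: (key (enum I)) => i; rewrite mem_enum.
elim: s B => [|i s IH] B sB.
  have /choice[x xB] : forall i, exists c, B i `<=` [set c].
    by move=> i; exact: sB.
  have [[i Bi0]|nB0] := pselect (exists i, B i = set0).
    rewrite (bigD1 i)//= Bi0 preimage_set0 measure0 mul0e.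
    rewrite (_ : \bigcap_i _ = set0) ?measure0//.
    by apply/seteqP; split=> // w /(_ i Logic.I); rewrite Bi0.
  have BE i : B i = [set x i].
    apply/seteqP; split; first exact: xB.
    have /set0P[c Bc] : B i != set0 by apply/eqP => Bi0; apply: nB0; exists i.
    by move=> _ ->; rewrite -(xB i c Bc).
  have := H x; congr (_ = _).
    by congr (P _); apply: eq_bigcapr => i _; rewrite BE.
  by apply: eq_bigr => i _; rewrite BE.
rewrite (measure_discrete P (dX i))//.
rewrite (bigD1 i)//= [in RHS](measure_discrete P (dY i)) //; last exact: discrete_preimage.
have finB : (\prod_(j | j != i) P (Y j @^-1` B j))%E \is a fin_num.
  elim/big_ind : _ => //; first by move=> x y; exact: fin_numM.
  by move=> j _; apply: fin_num_measure; exact: discrete_preimage.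
rewrite muleC -(fineK finB) -nneseriesZl; last by move=> n _; exact: measure_ge0.
rewrite (fineK finB); apply: eq_eseriesr => n _.
pose B' j := if j == i then B i `&` [set c | choice.pickle c = n] else B j.
transitivity (P (\bigcap_j (X j @^-1` B' j))).
  congr (P _); apply/seteqP; split=> w.
    move=> [Bw wn] j _; rewrite /B'; case: eqP => [->|_]; last exact: Bw.
    by split => //; exact: Bw.
  move=> B'w; split => [j _|].
    by have := B'w j Logic.I; rewrite /B'; case: eqP => [->|_] // [].
  by have := B'w i Logic.I; rewrite /B' eqxx => -[].
rewrite (IH B'); last first.
  (* The restricted set is a point or empty. In the empty case the witness is a value of [X i] at
     some sample point, which exists because [P] has total mass 1. *)
  move=> j js; rewrite /B'; case: eqP => [_|/eqP ji].
    have [[c [Bc cn]]|nex] := pselect (exists c, B i c /\ choice.pickle c = n).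
      exists c => c' [_ c'n]; apply: (pcan_inj choice.pickleK).
      by rewrite c'n cn.
    have := nex.
    have [x0] : exists x0 : Om, True.
      have /set0P[x0 _] : [set: Om] != set0.
        apply/eqP => T0; have := probability_setT P; rewrite T0 measure0.
        by move/esym/eqP; rewrite onee_eq0.
      by exists x0.
    by move=> _ _; exists (X i x0) => c [Bc cn]; case: nex; exists c.
  by apply: sB; rewrite inE negb_or ji.
rewrite (bigD1 i)//= muleC; congr (_ * _)%E.
  by apply: eq_bigr => j ji; rewrite /B' (negbTE ji).
by congr (P _); apply/seteqP; split=> w; rewrite /B' eqxx.
Qed.

End JointLaw.

(** * Tries as functions of the prefix counts *)

Section Counts.
Variable A : finType.
Implicit Types (c : seq A -> nat) (v a : seq A) (t : {fset (seq A)}).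

Definition count_nodes c : set (seq A) :=
  [set a | (2 <= c a)%N \/ c a = 1%N /\ (a = [::] \/ (2 <= c (parent a))%N)].

(** Together with [separated], this is what the combinatorics uses of the prefix counts of distinct
    strings; both properties pass to the branches. *)
Definition consistent c := forall v, c v = (\sum_x c (rcons v x))%N.

Definition separated L c := forall v, size v = L -> (c v <= 1)%N.

Definition branch c (x : A) : seq A -> nat := fun v => c (x :: v).

Definition trie_of c : {fset (seq A)} := fset_set (count_nodes c).

Lemma parent_cons x v : v != [::] -> parent (x :: v) = x :: parent v.
Proof. by case: v. Qed.

Lemma consistent_branch c x : consistent c -> consistent (branch c x).
Proof. by move=> cc v; rewrite /branch cc. Qed.

Lemma consistent_cat c v u : consistent c -> (c (v ++ u) <= c v)%N.
Proof.
move=> cc; elim/last_ind: u => [|u x IH]; first by rewrite cats0.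
by apply: leq_trans IH; rewrite -rcons_cat [leqRHS]cc (bigD1 x)//= leq_addr.
Qed.

Lemma consistent_take c n v : consistent c -> (c v <= c (take n v))%N.
Proof. by move=> cc; rewrite -{1}(cat_take_drop n v) consistent_cat. Qed.

Lemma consistent_nil c v : consistent c -> (c v <= c [::])%N.
Proof. exact: (@consistent_cat c [::]). Qed.

(** Counts decrease along extensions, and a node is internal, or the root, or has an internal
    parent; so all its proper prefixes are internal. *)
Lemma count_nodes_take c L v : consistent c -> count_nodes c v ->
  (L < size v)%N -> (2 <= c (take L v))%N.
Proof.
move=> cc [cv|[_ [->|cv]]] Lv //; first exact: leq_trans (consistent_take _ _ cc).
apply: leq_trans cv _.
rewrite (_ : take L v = take L (parent v)); first exact: consistent_take.
by rewrite /parent take_takel// -ltnS prednK// (leq_trans _ Lv).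
Qed.

Lemma separated_size c L v : consistent c -> separated L c -> count_nodes c v ->
  (size v <= L)%N.
Proof.
move=> cc sc nv; rewrite leqNgt; apply/negP => Lv.
have := count_nodes_take cc nv Lv.
by rewrite ltnNge sc// size_takel// ltnW.
Qed.

Lemma finite_size L : finite_set [set v : seq A | (size v <= L)%N].
Proof.
elim: L => [|L IH].
  apply: (@sub_finite_set _ _ [set [::]]) => // v /=.
  by rewrite leqn0 size_eq0 => /eqP.
apply: (@sub_finite_set _ _
  ([set [::]] `|` \bigcup_(x in [set: A]) ((cons x) @` [set v | (size v <= L)%N]))).
  move=> [|x v] /=; first by left.
  by rewrite ltnS => vL; right; exists x => //; exists v.
rewrite finite_setU; split => //.
by apply: bigcup_finite => [|x _]; [exact: finite_finset|exact: finite_image].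
Qed.

Lemma separated_finite c L : consistent c -> separated L c ->
  finite_set (count_nodes c).
Proof.
move=> cc sc; apply: sub_finite_set (finite_size L) => v.
exact: separated_size sc.
Qed.

Lemma separated_branch c L x : separated L.+1 c -> separated L (branch c x).
Proof. by move=> sc v vL; rewrite sc//= vL. Qed.

Lemma separatedS c L : consistent c -> separated L c -> separated L.+1 c.
Proof.
move=> cc sc v vL; apply: leq_trans (consistent_take L v cc) _.
by rewrite sc// size_takel// vL.
Qed.

Lemma in_trie_of c v : finite_set (count_nodes c) ->
  (v \in trie_of c) <-> count_nodes c v.
Proof.
by move=> fc; rewrite /trie_of in_fset_set//; split=> [/set_mem|/mem_set].
Qed.

Lemma count_nodes0 c : consistent c -> c [::] = 0%N -> count_nodes c = set0.
Proof.
move=> cc c0; apply/seteqP; split=> // v.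
have cv w : c w = 0%N.
  by apply/eqP; rewrite -leqn0 -c0; exact: consistent_nil.
by rewrite /count_nodes /= !cv => -[//|[]].
Qed.

Lemma count_nodes1 c : consistent c -> c [::] = 1%N ->
  count_nodes c = [set [::]].
Proof.
move=> cc c0.
have cv w : (c w <= 1)%N by rewrite -c0; exact: consistent_nil.
apply/seteqP; split=> [v|_ -> /=]; last by right; split => //; left.
by move=> [|[_ [//|]]]; rewrite ltnNge cv.
Qed.

Lemma count_nodes_branch c x v : consistent c -> (2 <= c [::])%N ->
  count_nodes c (x :: v) <-> count_nodes (branch c x) v.
Proof.
move=> cc c0; rewrite /count_nodes /branch /=.
have [->|vN0] := eqVneq v [::].
  split=> [[|[]]|[|[]]]; try by left.
    by move=> cx _; right; split => //; left.
  by move=> cx _; right; split => //; right; rewrite /parent.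
rewrite parent_cons//.
by split=> [[|[cx []//]]|[|[cx []]]]; try (by left); try (by right; split => //; right);
  move/eqP; rewrite (negbTE vN0).
Qed.

Definition singleton_trie : {fset (seq A)} := [fset [::]]%fset.

(* [u x] is the trie generated by the suffixes of the strings starting with
   [x]. If there is only one string, [t] does not determine [u]. *)
Definition joined t (u : A -> {fset (seq A)}) : Prop :=
  [\/ t = fset0 /\ (forall x, u x = fset0),
      t = singleton_trie /\
        exists y, forall x, u x = if x == y then singleton_trie else fset0 |
      [/\ t != fset0, t != singleton_trie, [::] \in t &
        forall x v, (x :: v \in t) = (v \in u x)]].

(** The cases are 0, 1 and at least 2 strings. With at least 2, some child of the root has a
    positive count and is itself a node, which rules out the one-node trie. *)
Lemma joined_trie_of c L : consistent c -> separated L c ->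
  joined (trie_of c) (fun x => trie_of (branch c x)).
Proof.
move=> cc sc; have fc := separated_finite cc sc.
have fb x : finite_set (count_nodes (branch c x)).
  apply: (@separated_finite _ L (consistent_branch x cc)).
  by apply: separated_branch; exact: separatedS.
have tr0 c' : consistent c' -> c' [::] = 0%N -> trie_of c' = fset0.
  by move=> cc' c0; rewrite /trie_of count_nodes0// fset_set0.
have tr1 c' : consistent c' -> c' [::] = 1%N -> trie_of c' = singleton_trie.
  by move=> cc' c0; rewrite /trie_of count_nodes1// fset_set1.
case c0 : (c [::]) => [|[|n]].
- constructor 1; split=> [|x]; first exact: tr0.
  apply: tr0; first exact: consistent_branch.
  by apply/eqP; rewrite -leqn0 -c0; exact: consistent_nil.
- constructor 2; split=> [|]; first exact: tr1.
  have := c0; rewrite cc => /= s1.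
  have [y y1] : exists y, c [:: y] != 0%N.
    apply/existsP; apply: contraPT isT => /existsPn/= h.
    by move: s1; rewrite big1// => x _; apply/eqP; have := h x; rewrite negbK.
  exists y => x; move: s1; rewrite (bigD1 y)//=.
  move: y1; case cy : (c [:: y]) => [//|m] _; rewrite addSn => -[] /eqP.
  rewrite addn_eq0 sum_nat_eq0 => /andP[/eqP m0 /forallP/= h].
  case: eqP => [->|/eqP xy].
    by apply: tr1; [exact: consistent_branch|rewrite /branch cy m0].
  apply: tr0; first exact: consistent_branch.
  by apply/eqP; have /implyP := h x; exact.
- have c2 : (2 <= c [::])%N by rewrite c0.
  have te : [::] \in trie_of c by apply/in_trie_of => //; left.
  constructor 3; split => //.
  + by apply: contraTneq te => ->; rewrite inE.
  + have [y y1] : exists y, c [:: y] != 0%N.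
      apply/existsP; apply: contraPT isT => /existsPn/= h.
      move: c2; rewrite cc big1// => x _; apply/eqP; have := h x.
      by rewrite negbK.
    apply/negP => /eqP tE.
    suff : [:: y] \in trie_of c by rewrite tE inE.
    apply/in_trie_of => //; rewrite /count_nodes /=.
    case cy : (c [:: y]) y1 => [//|[|m]] _; last by left.
    by right; split => //; right.
  + move=> x v; apply/idP/idP => /in_trie_of.
      by move=> /(_ fc)/(count_nodes_branch x v cc c2) ?; apply/in_trie_of.
    by move=> /(_ (fb x)) ?; apply/in_trie_of => //; exact/count_nodes_branch.
Qed.

Lemma fringe_nil t : fringe t [::] = t.
Proof.
apply/fsetP => v; apply/imfsetP/idP => /= [[w]|vt].
  by rewrite !inE => /andP[wt _] ->; rewrite drop0.
by exists v; rewrite ?drop0// !inE vt prefix0s.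
Qed.

Lemma in_fringe t v w : (w \in fringe t v) = (v ++ w \in t).
Proof.
apply/imfsetP/idP => /= [[u]|vw].
  by rewrite !inE => /andP[ut /prefixP[u' uE]] ->; rewrite uE drop_size_cat// -uE.
by exists (v ++ w); rewrite ?drop_size_cat// !inE vw prefix_prefix.
Qed.

Section Additive.
Variable R : realType.
Implicit Types f : {fset (seq A)} -> R.

Lemma additive_functional0 f : additive_functional f fset0 = 0.
Proof. by rewrite /additive_functional big_seq_fset0. Qed.

Lemma additive_functional1 f :
  additive_functional f singleton_trie = f singleton_trie.
Proof. by rewrite /additive_functional big_seq_fset1 fringe_nil. Qed.

(* Correcting the toll of the one-node trie makes the recursion exact also in
   the degenerate cases of [joined]. *)
Definition corrected f t : R :=
  f t - f singleton_trie * (t == singleton_trie)%:R.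

Lemma additive_functional_joined f t u : f fset0 = 0 -> joined t u ->
  additive_functional f t = corrected f t + \sum_x additive_functional f (u x).
Proof.
move=> f0 [[-> uE]|[-> [y uE]]|[t0 t1 te uE]].
- rewrite additive_functional0 big1 => [|x _]; last by rewrite uE additive_functional0.
  by rewrite /corrected f0 (_ : (_ == _) = false) ?mulr0 ?subrr ?addr0//; apply/eqP
    => /fsetP/(_ [::]); rewrite !inE.
- rewrite additive_functional1 /corrected eqxx mulr1 subrr add0r.
  rewrite (bigD1 y)//= uE eqxx additive_functional1 big1 ?addr0// => x xy.
  by rewrite uE (negbTE xy) additive_functional0.
- rewrite /corrected (negbTE t1) mulr0 subr0.
  rewrite /additive_functional (big_fsetD1 [::])//= fringe_nil; congr (_ + _).
  have fru x v : fringe t (x :: v) = fringe (u x) v.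
    by apply/fsetP => w; rewrite !in_fringe -uE.
  under [RHS]eq_bigr do under eq_bigr do rewrite -fru.
  (* The nodes other than the root, grouped by first letter. *)
  pose s := flatten [seq [seq x :: v | v <- u x] | x <- enum A].
  rewrite (perm_big s); last first.
    apply: uniq_perm.
    + exact: fset_uniq.
    + apply: allpairs_uniq_dep => [|x _|].
      * exact: enum_uniq.
      * exact: fset_uniq.
      * by move=> [x v] [x' v'] _ _ /= [-> ->].
    + move=> [|x v].
        rewrite !inE/=; apply/esym/negbTE/flattenP => -[_ /mapP[x _ ->]].
        by move/mapP => -[].
      rewrite !inE /= uE; apply/idP/flattenP => [vu|[_ /mapP[x' _ ->]]].
        by exists [seq x :: v | v <- u x]; apply/mapP; [exists x; rewrite ?mem_enum|
          exists v].
      by move=> /mapP[v' vu' [-> ->]].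
  rewrite /s big_flatten/= big_map big_enum/=.
  by apply: eq_bigr => x _; rewrite big_map.
Qed.

Definition leaves : {fset (seq A)} -> R :=
  additive_functional (fun t => (t == singleton_trie)%:R).

(** The corrected toll of the leaf count vanishes, so the count is exactly additive over the
    branches. Subtracting a multiple of it from a functional leaves the toll in the recursion
    unchanged. *)
Lemma leaves_joined t u : joined t u -> leaves t = \sum_x leaves (u x).
Proof.
move=> jtu; rewrite /leaves (additive_functional_joined _ jtu); last first.
  by rewrite (_ : (_ == _) = false)//; apply/eqP => /fsetP/(_ [::]); rewrite !inE.
by rewrite /corrected eqxx mul1r subrr add0r.
Qed.

Lemma leaves_trie_of c L : consistent c -> separated L c ->
  leaves (trie_of c) = (c [::])%:R.
Proof.
elim: L c => [|L IH] c cc sc.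
  have := sc [::] erefl; case c0 : (c [::]) => [|[|//]] _.
    by rewrite /trie_of count_nodes0// fset_set0 /leaves additive_functional0.
  by rewrite /trie_of count_nodes1// fset_set1 /leaves additive_functional1 eqxx.
rewrite (leaves_joined (joined_trie_of cc sc)) [in RHS]cc natr_sum.
by apply: eq_bigr => x _; rewrite (IH _ (consistent_branch x cc) (separated_branch x sc)).
Qed.

End Additive.
End Counts.

(** * Counts on one level of the tree, and the multinomial formula *)

Section Levels.
Variable A : finType.
Implicit Types (c : seq A -> nat) (v a : seq A) (t : {fset (seq A)}).

Definition ext L (k : {ffun L.-tuple A -> nat}) a : nat :=
  (\sum_(v : L.-tuple A | prefix a v) k v)%N.

Definition level L c : {ffun L.-tuple A -> nat} := [ffun v : L.-tuple A => c v].

Lemma ext_level c L a : consistent c -> (size a <= L)%N ->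
  ext (level L c) a = c a.
Proof.
move=> cc; move mE : (L - size a)%N => m.
elim: m a mE => [|m IH] a mE aL.
  have sa : size a == L by rewrite eqn_leq aL -subn_eq0 mE.
  rewrite /ext (big_pred1 (Tuple sa)) ?ffunE// => v /=.
  rewrite prefixE (eqP sa) take_oversize ?size_tuple//.
have aL' : (size a < L)%N by rewrite -subn_gt0 mE.
rewrite cc /ext (partition_big (fun v : L.-tuple A => tnth v (Ordinal aL')) xpredT)//=.
apply: eq_bigr => x _; rewrite -IH ?size_rcons//; last by rewrite subnS mE.
apply: eq_bigl => v; rewrite !prefixE size_rcons.
rewrite (take_nth x) ?size_tuple// eqseq_rcons (tnth_nth x)/=.
by rewrite eq_sym [_ == x]eq_sym; congr (_ && _); rewrite eq_sym.
Qed.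

Definition decides L t (k : {ffun L.-tuple A -> nat}) : Prop :=
  forall a, (size a <= L)%N -> (count_nodes (ext k) a <-> a \in t).

(** The event that the trie is [t] becomes a condition on a single level of counts, whose joint law
    is explicit. A node longer than [L] would have an internal prefix of length [L], hence force a
    node of [t] that is too long. *)
Lemma count_nodes_level c t L : consistent c ->
  (forall a, a \in t -> (size a < L)%N) ->
  count_nodes c = [set` t] <-> decides t (level L c).
Proof.
move=> cc tL.
have extE a : (size a <= L)%N -> count_nodes (ext (level L c)) a <-> count_nodes c a.
  move=> aL; rewrite /count_nodes/= !ext_level//.
  by rewrite (leq_trans _ aL)// /parent size_take; case: ltnP => // _; exact: leq_pred.
split=> [ct a aL|dt].
  by rewrite extE// ct.
apply/seteqP; split=> [a na|a /= at_]; last first.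
  by apply/extE; [exact/ltnW/tL|apply/dt => //; exact/ltnW/tL].
have [aL|La] := leqP (size a) L; first by apply/dt => //; exact/extE.
have tks : size (take L a) = L by rewrite size_takel// ltnW.
have c2 := count_nodes_take cc na La.
have : take L a \in t by apply/dt; rewrite ?tks//; apply/extE; rewrite ?tks//; left.
by move/tL; rewrite tks ltnn.
Qed.

End Levels.

Lemma big_tuple_cons (R : Type) (idx : R) (op : Monoid.com_law idx)
    (V : finType) n (F : n.+1.-tuple V -> R) :
  \big[op/idx]_(a : n.+1.-tuple V) F a =
  \big[op/idx]_(x : V) \big[op/idx]_(a : n.-tuple V) F [tuple of x :: a].
Proof.
rewrite pair_big/= (reindex (fun p : V * n.-tuple V => [tuple of p.1 :: p.2]))//=.
exists (fun a : n.+1.-tuple V => (thead a, [tuple of behead a])) => /=.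
  by move=> [x a] _ /=; congr pair => //; apply/val_inj.
by move=> a _; rewrite -tuple_eta.
Qed.

Section Multinomial.
Variables (R : realFieldType) (V : finType) (q : V -> R).

Lemma sum_tuple_prod n :
  \sum_(a : n.-tuple V) \prod_(x <- a) q x = (\sum_x q x) ^+ n.
Proof.
elim: n => [|n IH].
  rewrite (big_pred1 [tuple]) ?big_nil// => a.
  by apply/esym/eqP; exact: tuple0.
rewrite big_tuple_cons exprS mulr_suml; apply: eq_bigr => x _.
by under eq_bigr do rewrite big_cons; rewrite -mulr_sumr IH.
Qed.

Lemma multinomial_sum n (k : V -> nat) : (\sum_v k v)%N = n ->
  \sum_(a : n.-tuple V | [forall v, count_mem v a == k v]) \prod_(x <- a) q x
  = n`!%:R * \prod_v (q v ^+ k v / (k v)`!%:R).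
Proof.
elim: n k => [|n IH] k kn.
  have k0 v : k v = 0%N.
    by apply/eqP; move/eqP: kn; rewrite sum_nat_eq0 => /forallP/(_ v)/implyP; exact.
  rewrite (big_pred1 [tuple]).
    rewrite big_nil fact0 mul1r big1// => v _; by rewrite k0 expr0 fact0 divr1.
  move=> a; transitivity true; last by apply/esym/eqP; exact: tuple0.
    by apply/forallP => v; rewrite (tuple0 a) k0.
rewrite big_mkcond big_tuple_cons /=.
pose W := \prod_v (q v ^+ k v / (k v)`!%:R).
(* Prescribing the first entry [x] lowers [k x] by one, so its contribution is [k x] times a
   quantity independent of [x]; the factors [k x] sum to [n.+1]. *)
rewrite (eq_bigr (fun x => n`!%:R * W * (k x)%:R)); last first.
  move=> x _; rewrite -big_mkcond/=.
  case kx : (k x) => [|m].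
    rewrite mulr0 big_pred0// => a; apply/negbTE/forallPn; exists x => /=.
    by rewrite eqxx kx add1n.
  pose k' v := if v == x then m else k v.
  have k'n : (\sum_v k' v)%N = n.
    move: kn; rewrite (bigD1 x)//= kx addSn => -[<-].
    rewrite [LHS](bigD1 x)//= /k' eqxx; congr (_ + _)%N.
    by apply: eq_bigr => v /negbTE ->.
  rewrite (eq_big (fun a : n.-tuple V => [forall v, count_mem v a == k' v])
      (fun a : n.-tuple V => q x * \prod_(y <- a) q y)); last 2 first.
  - move=> a; apply: eq_forallb => v; rewrite /k' /=.
    have [->|vx] := eqVneq v x; first by rewrite kx add1n eqSS.
    by rewrite add0n.
  - by move=> a _; rewrite big_cons.
  rewrite -mulr_sumr IH// mulrCA -[in RHS]mulrA; congr (_ * _).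
  rewrite /W (bigD1 x)//= [in RHS](bigD1 x)//= /k' eqxx kx.
  rewrite (eq_bigr (fun v => q v ^+ k v / (k v)`!%:R)); last by move=> v /negbTE ->.
  rewrite exprS factS natrM invfM.
  have m0 : m.+1%:R != 0 :> R by rewrite pnatr_eq0.
  by field; rewrite nat1r m0 pnatr_eq0 -lt0n fact_gt0.
by rewrite -mulr_sumr -natr_sum kn factS natrM -/W mulrAC [n`!%:R * _]mulrC.
Qed.

End Multinomial.

(** * Measurability of tries *)

Section DiscreteCombinators.
Context d (Om : measurableType d).

Lemma discrete_comp (C D : countType) (X : Om -> C) (f : C -> D) :
  discrete X -> discrete (fun w => f (X w)).
Proof. by move=> dX c; exact: (discrete_preimage (f @^-1` [set c]) dX). Qed.

Lemma discrete_ffun (I : finType) (C : countType) (X : I -> Om -> C) :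
  (forall i, discrete (X i)) -> discrete (fun w => [ffun i => X i w]).
Proof.
move=> dX g.
rewrite (_ : _ @^-1` _ = \bigcap_(i in [set: I]) (X i @^-1` [set g i])).
  by apply: fin_bigcap_measurable => // i _; exact: dX.
apply/seteqP; split=> [w <- i _|w /= gw]; first by rewrite /= ffunE.
by apply/ffunP => i; rewrite ffunE; exact: gw.
Qed.

Lemma discrete_diag (C D : countType) (N : Om -> C) (X : C -> Om -> D) :
  discrete N -> (forall n, discrete (X n)) -> discrete (fun w => X (N w) w).
Proof.
move=> dN dX c.
rewrite (_ : _ @^-1` _ = \bigcup_(n in [set: C])
    (N @^-1` [set n] `&` X n @^-1` [set c])).
  apply: countable_bigcupT_measurable; first exact: countableP.
  by move=> n; apply: measurableI; [exact: dN|exact: dX].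
by apply/seteqP; split=> [w wc|w [n _ [<-]]] //=; exists (N w).
Qed.

(** Countably many conditions, one for each string [v], each involving only the counts at [v] and at
    its parent. *)
Lemma discrete_count_nodes (A : finType) (c : Om -> seq A -> nat) :
  (forall v, discrete (c^~ v)) ->
  forall t : {fset (seq A)}, measurable [set w | count_nodes (c w) = [set` t]].
Proof.
move=> dc t.
rewrite (_ : [set w | _] =
    \bigcap_(v in [set: seq A]) [set w | count_nodes (c w) v <-> v \in t]).
  rewrite -[X in measurable X]setCK setC_bigcap; apply: measurableC.
  apply: countable_bigcupT_measurable; first exact: countableP.
  move=> v; apply: measurableC.
  pose f (ab : nat * nat) : Prop :=
    ((2 <= ab.1)%N \/ ab.1 = 1%N /\ (v = [::] \/ (2 <= ab.2)%N)) <-> v \in t.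
  pose g (b : bool) : seq A := if b then v else parent v.
  have dg : discrete (fun w => [ffun b : bool => c w (g b)]).
    by apply: discrete_ffun => b; exact: dc.
  have := discrete_preimage (fun h : {ffun bool -> nat} => f (h true, h false)) dg.
  congr measurable; apply/seteqP.
  by split=> w; rewrite /preimage/= /f/= !ffunE.
apply/seteqP; split=> [w /= cE v _|w /= h]; first by rewrite /= cE.
by apply/seteqP; split=> v; have := h v Logic.I; rewrite /= => -[].
Qed.

Lemma fset_set_infinite (T : choiceType) (B : set T) :
  ~ finite_set B -> fset_set B = fset0.
Proof. by move=> iB; rewrite /fset_set; case: pselect. Qed.

(** [fset_set] sends infinite sets to the empty one, so the fibre over [fset0] also contains the
    event that the node set is infinite. That event is the complement of a countable union. *)
Lemma discrete_trie_of (A : finType) (c : Om -> seq A -> nat) :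
  (forall v, discrete (c^~ v)) -> discrete (fun w => trie_of (c w)).
Proof.
move=> dc t.
rewrite (_ : _ @^-1` _ = [set w | count_nodes (c w) = [set` t]] `|`
   (if t == fset0 then
      ~` \bigcup_(s in [set: {fset (seq A)}]) [set w | count_nodes (c w) = [set` s]]
    else set0)).
  apply: measurableU; first exact: discrete_count_nodes.
  case: ifP => // _; apply: measurableC.
  apply: countable_bigcupT_measurable; first exact: countableP.
  exact: discrete_count_nodes.
apply/seteqP; split=> [w <-|w] /=.
  have [fc|ic] := pselect (finite_set (count_nodes (c w))).
    by left; rewrite /trie_of fset_setK.
  right; rewrite /trie_of fset_set_infinite// eqxx => -[s _ /= sE].
  by apply: ic; rewrite sE; exact: finite_fset.
move=> [cE|]; first by rewrite /trie_of cE set_fsetK.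
case: eqP => // -> ic; rewrite /trie_of fset_set_infinite// => fc.
by apply: ic; exists (trie_of (c w)) => //=; rewrite fset_setK.
Qed.

Lemma discrete_prefix_count (A : finType) (Xi : nat -> Om -> nat -> A) n v :
  (forall i j, discrete (fun w => Xi i w j)) ->
  discrete (fun w => prefix_count (fun i : 'I_n => Xi i w) v).
Proof.
move=> dXi.
pose f (g : {ffun 'I_n -> {ffun 'I_(size v) -> A}}) : nat :=
  #|[set i | [forall j, tnth (in_tuple v) j == g i j]]%SET|.
rewrite (_ : (fun _ => _) = fun w => f [ffun i : 'I_n => [ffun j : 'I_(size v) => Xi i w j]]).
  apply: (discrete_comp f); apply: discrete_ffun => i.
  by apply: discrete_ffun => j; exact: dXi.
apply/funext => w; rewrite /prefix_count /f; congr #|pred_of_set _|.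
apply/setP => i; rewrite !inE /has_prefix !ffunE.
apply/eqP/forallP => [vE j|vE].
  rewrite !ffunE (tnth_nth (Xi i w 0)) /=.
  by have := congr1 (fun s => nth (Xi i w 0) s j) vE; rewrite nth_mkseq// => ->.
apply: (@eq_from_nth _ (Xi i w 0)); rewrite ?size_mkseq// => j jv.
rewrite nth_mkseq//; have := vE (Ordinal jv).
by rewrite !ffunE (tnth_nth (Xi i w 0)) => /eqP.
Qed.

End DiscreteCombinators.

Section PrefixCount.
Variable A : finType.

Lemma prefix_countE n (x : 'I_n -> nat -> A) v :
  prefix_count x v = count_mem v [seq mkseq (x i) (size v) | i <- enum 'I_n].
Proof.
rewrite /prefix_count cardE count_map -size_filter.
rewrite enumT /enum_mem -enumT; congr size.
by apply: eq_filter => i; rewrite /= inE /has_prefix eq_sym.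
Qed.

Lemma consistent_prefix_count n (x : 'I_n -> nat -> A) :
  consistent (prefix_count x).
Proof.
move=> v; rewrite /prefix_count -sum1_card big_mkcond /=.
under [RHS]eq_bigr do rewrite -sum1_card big_mkcond /=.
rewrite exchange_big/=; apply: eq_bigr => i _.
rewrite inE /has_prefix.
under eq_bigr => y _.
  rewrite inE /has_prefix size_rcons mkseqS eqseq_rcons.
  over.
case: (v == _) => /=; last by rewrite big1.
by rewrite -big_mkcond (big_pred1 (x i (size v))).
Qed.

Lemma prefix_count_nil n (x : 'I_n -> nat -> A) : prefix_count x [::] = n.
Proof.
rewrite /prefix_count (_ : [set i | _]%SET = [set: 'I_n]%SET) ?cardsT ?card_ord//.
Qed.

End PrefixCount.

Section Misc.
Context d (Om : measurableType d) (R : realType) (P : probability Om R).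

Lemma measure_finite (C : finType) (X : Om -> C) (b : pred C) :
  discrete X ->
  P (X @^-1` [set c | b c]) = (\sum_(c | b c) P (X @^-1` [set c]))%E.
Proof.
move=> dX; pose D : {fset C} := [fset c in enum b]%fset.
rewrite (_ : X @^-1` _ = \bigcup_(c in [set` D]) (X @^-1` [set c])).
  rewrite bigcup_fset measure_fbigsetU//; last first.
    by move=> i j _ _ [w [/= <- <-]].
  rewrite (perm_big (enum b)) ?big_enum//.
  apply: uniq_perm; [exact: fset_uniq|exact: enum_uniq|].
  by move=> c; rewrite !inE.
apply/seteqP; split=> [w bw|w [c]] /=.
  by exists (X w) => //=; rewrite !inE mem_enum.
by rewrite !inE mem_enum => bc ->.
Qed.

Lemma measure_eq_null (Z B C : set Om) : measurable Z -> measurable B ->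
  measurable C -> P Z = 0%E -> (forall w, ~ Z w -> B w <-> C w) -> P B = P C.
Proof.
move=> mZ mB mC Z0 BC.
have E (D : set Om) : measurable D -> P D = P (D `\` Z).
  move=> mD; rewrite (measureDI P mD mZ) [X in (_ + X)%E](_ : _ = 0%E) ?adde0//.
  by apply: (subset_measure0 _ mZ _ Z0); [exact: measurableI|exact: subIsetr].
rewrite (E _ mB) (E _ mC); congr (P _).
by apply/seteqP; split=> w [Bw nZ]; split => //; apply/BC.
Qed.

Lemma mutually_independent_ord n (F : nat -> set_system Om) (E : nat -> set Om) :
  mutually_independent P F -> (forall i, (i < n)%N -> F i (E i)) ->
  P (\bigcap_(i in `I_n) E i) = (\prod_(i < n) P (E i))%E.
Proof.
move=> indF FE; pose J : {fset nat} := [fset i in iota 0 n]%fset.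
have memJ i : (i \in J) = (i < n)%N by rewrite !inE mem_iota.
have -> : `I_n = [set` J] by apply/seteqP; split=> i /=; rewrite memJ.
rewrite indF; last by move=> i; rewrite memJ; exact: FE.
rewrite (perm_big (index_iota 0 n)) ?big_mkord//.
apply: uniq_perm; [exact: fset_uniq|exact: iota_uniq|].
by move=> c; rewrite memJ mem_index_iota.
Qed.

End Misc.

(** * Laws of the counts and of the random tries *)

Section Model.
Context d (Omega : measurableType d) (R : realType) (P : probability Omega R).
Context (A : finType).
Variables (Xi : nat -> Omega -> nat -> A) (p : A -> R) (N : R -> {RV P >-> nat}).
Hypotheses (hA : (2 <= #|A|)%N) (p_gt0 : forall a, 0 < p a).
Hypotheses (p_sum1 : \sum_a p a = 1) (model : trie_model Xi p N).

Let x0 : A.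
Proof. by move: hA; case: (pickP (@predT A)) => // h; rewrite eq_card0. Qed.

Definition word_prob (v : seq A) : R := \prod_(x <- v) p x.
Local Notation q := word_prob.

Lemma word_prob_gt0 v : 0 < q v.
Proof. by apply: prodr_gt0 => x _. Qed.

Lemma sum_word_prob L : \sum_(v : L.-tuple A) q v = 1.
Proof. by rewrite sum_tuple_prod p_sum1 expr1n. Qed.

Lemma letter_discrete i j : discrete (fun w => Xi i w j).
Proof.
by move=> a; apply: (letter_measurable model (i := i) (j := j)); exists [set a] => //=;
  rewrite setTI.
Qed.

Lemma string_letter_discrete i j :
  discrete (fun w : g_sigma_algebraType (\bigcup_j letter_sigma Xi i j) => Xi i w j).
Proof.
move=> a; apply: sub_sigma_algebra; exists j => //.
by exists [set a] => //=; rewrite setTI.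
Qed.

Lemma strings_letter_discrete i j :
  discrete (fun w : g_sigma_algebraType (\bigcup_i string_sigma Xi i) => Xi i w j).
Proof.
move=> a; apply: sub_sigma_algebra; exists i => //.
exact: string_letter_discrete.
Qed.

Lemma mkseq_discrete d' (Om : measurableType d') (X : Om -> nat -> A) L :
  (forall j, discrete (fun w => X w j)) ->
  discrete (fun w => [tuple of mkseq (X w) L]).
Proof.
move=> dX v.
rewrite (_ : _ @^-1` _ = \bigcap_(j in [set: 'I_L])
    ((fun w => X w j) @^-1` [set tnth v j])).
  by apply: fin_bigcap_measurable => // j _; exact: dX.
apply/seteqP; split=> [w <- j _|w /= h].
  by rewrite /= (tnth_nth (X w 0)) nth_mkseq.
apply: eq_from_tnth => j; rewrite -(h j Logic.I) (tnth_nth (X w 0)) nth_mkseq//.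
Qed.

Lemma prefix_law i L (v : L.-tuple A) :
  P [set w | mkseq (Xi i w) L = v] = (q v)%:E.
Proof.
rewrite (_ : [set w | _] =
    \bigcap_(j in `I_L) [set w | Xi i w j = nth x0 v j]); last first.
  apply/seteqP; split=> [w /= <- j /= jL|w /= h].
    by rewrite nth_mkseq.
  apply: (@eq_from_nth _ x0); rewrite size_mkseq ?size_tuple// => j jL.
  by rewrite nth_mkseq//; exact: h.
rewrite (mutually_independent_ord (letters_independent model (i := i))); last first.
  move=> j _; exists [set nth x0 v j] => //=; rewrite setTI//.
under eq_bigr do rewrite (letter_law model).
by rewrite prodEFin /q big_tuple; congr EFin; apply: eq_bigr => j _; rewrite (tnth_nth x0).
Qed.

Lemma strings_law n L (a : n.-tuple (L.-tuple A)) :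
  P [set w | forall i : 'I_n, mkseq (Xi i w) L = tnth a i] =
  (\prod_(v <- a) q v)%:E.
Proof.
pose v0 : L.-tuple A := [tuple of nseq L x0].
rewrite (_ : [set w | _] =
    \bigcap_(i in `I_n) [set w | mkseq (Xi i w) L = nth v0 a i]); last first.
  apply/seteqP; split=> [w /= h i /= jL|w /= h i].
    by rewrite (h (Ordinal jL)) (tnth_nth v0).
  by rewrite (tnth_nth v0); exact: (h i (ltn_ord i)).
rewrite (mutually_independent_ord (strings_independent model)).
  rewrite (eq_bigr (fun i : 'I_n => (q (nth v0 a i))%:E)); last first.
    by move=> i _; exact: prefix_law.
  rewrite prodEFin big_tuple; congr EFin.
  by apply: eq_bigr => i _; rewrite (tnth_nth v0).
move=> i _; have := mkseq_discrete (L := L) (@string_letter_discrete i) (nth v0 a i).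
rewrite (_ : _ @^-1` _ = [set w | mkseq (Xi i w) L = nth v0 a i]) //.
apply/seteqP; split => w; first by move=> /= <-.
by move=> wE; apply/val_inj.
Qed.

Definition string_count n (w : Omega) : seq A -> nat :=
  prefix_count (fun i : 'I_n => Xi i w).

Definition counts l (w : Omega) : seq A -> nat := string_count (N l w) w.

Lemma string_count_discrete n v : discrete (fun w => string_count n w v).
Proof. exact: (discrete_prefix_count n v (@letter_discrete)). Qed.

Lemma N_discrete l : discrete (N l).
Proof.
by move=> n; rewrite -[_ @^-1` _]setTI; exact: (measurable_funPT (N l)).
Qed.

Lemma counts_discrete l v : discrete (fun w => counts l w v).
Proof.
exact: (discrete_diag (X := fun n w => string_count n w v) (@N_discrete l)
  (string_count_discrete^~ v)).
Qed.

Lemma level_discrete d' (Om : measurableType d') (c : Om -> seq A -> nat) L :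
  (forall v, discrete (fun w => c w v)) -> discrete (fun w => level L (c w)).
Proof. by move=> dc; apply: discrete_ffun => v; exact: dc. Qed.

Lemma consistent_counts l w : consistent (counts l w).
Proof. exact: consistent_prefix_count. Qed.

(** Each assignment of words to the [n] strings has the product probability, and the multinomial
    formula sums over those with occupation numbers [k]. *)
Lemma level_law n L (k : {ffun L.-tuple A -> nat}) : (\sum_v k v)%N = n ->
  P [set w | level L (string_count n w) = k] =
  (n`!%:R * \prod_(v : L.-tuple A) (q v ^+ k v / (k v)`!%:R))%:E.
Proof.
move=> kn.
pose W w : {ffun 'I_n -> L.-tuple A} := [ffun i : 'I_n => [tuple of mkseq (Xi i w) L]].
have dW : discrete W by apply: discrete_ffun => i; apply: mkseq_discrete => j; exact: letter_discrete.
pose good (g : {ffun 'I_n -> L.-tuple A}) :=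
  [forall v, count_mem v [seq g i | i <- enum 'I_n] == k v].
rewrite (_ : [set w | _] = W @^-1` [set g | good g]); last first.
  have cE w (v : L.-tuple A) : level L (string_count n w) v = count_mem v [seq W w i | i <- enum 'I_n].
    rewrite ffunE /string_count prefix_countE !count_map; apply: eq_count => i /=.
    by rewrite ffunE -val_eqE /= size_tuple.
  apply/seteqP; split=> [w /= wk|w /forallP h]; first by apply/forallP => v; rewrite -wk cE.
  by apply/ffunP => v; rewrite cE; exact/eqP.
rewrite measure_finite// -(multinomial_sum (fun v : L.-tuple A => q v) kn) -sumEFin.
rewrite (reindex (fun a : n.-tuple (L.-tuple A) => [ffun i => tnth a i])); last first.
  exists (fun g : {ffun 'I_n -> L.-tuple A} => [tuple g i | i < n]) => /=.
    by move=> a _; apply: eq_from_tnth => i; rewrite tnth_mktuple ffunE.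
  by move=> g _; apply/ffunP => i; rewrite ffunE tnth_mktuple.
apply: eq_big => a.
  rewrite /good; apply: eq_forallb => v; congr (_ == _).
  have -> // : [seq [ffun i0 => tnth a i0] i | i <- enum 'I_n] = a.
  by rewrite -[RHS](map_tnth_enum a); apply: eq_map => i; rewrite ffunE.
move=> _; rewrite -strings_law; congr (P _); apply/seteqP; split => w /=.
  by move=> /ffunP wE i; have := wE i; rewrite !ffunE => /(congr1 val).
by move=> h; apply/ffunP => i; rewrite !ffunE; apply/val_inj => /=; exact: h.
Qed.

(** Poisson thinning: given the number [n] of strings the counts are multinomial, and the factor n!
    cancels against the Poisson weight of [n], leaving a product over words. *)
Lemma counts_law l L (k : {ffun L.-tuple A -> nat}) : 0 < l ->
  P [set w | level L (counts l w) = k] =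
  (\prod_(v : L.-tuple A) poisson_pmf (l * q v) (k v))%:E.
Proof.
move=> l0; set n := (\sum_v k v)%N.
rewrite (_ : [set w | _] =
    N l @^-1` [set n] `&` [set w | level L (string_count n w) = k]); last first.
  apply/seteqP; split=> [w /= wk|w /= [Nn]]; last by rewrite /counts Nn.
  suff Nn : N l w = n by split => //; rewrite -Nn.
  transitivity (counts l w [::]).
    by rewrite /counts /string_count prefix_count_nil.
  rewrite /n -wk.
  rewrite -(@ext_level _ _ L [::] (@consistent_counts l w))// /ext.
  by apply: eq_bigl => v; rewrite prefix0s.
rewrite (size_independent model)//; last first.
  have := level_discrete (L := L)
    (fun v => discrete_prefix_count n v (@strings_letter_discrete)) k.
  exact.
rewrite (size_law model)// level_law// -EFinM; congr EFin.
rewrite /poisson_pmf l0.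
rewrite [RHS](eq_bigr (fun v => l ^+ k v * expR (- l * q v) * (q v ^+ k v / (k v)`!%:R))).
  rewrite !big_split/= -expR_sum -mulr_sumr sum_word_prob mulr1 prodrXr -/n.
  by field; rewrite pnatr_eq0 -lt0n fact_gt0.
by move=> v _; rewrite mulr_gt0// ?word_prob_gt0// exprMn mulNr; ring.
Qed.

End Model.

Section Model.
Context d (Omega : measurableType d) (R : realType) (P : probability Omega R).
Context (A : finType).
Variables (Xi : nat -> Omega -> nat -> A) (p : A -> R) (N : R -> {RV P >-> nat}).
Hypotheses (hA : (2 <= #|A|)%N) (p_gt0 : forall a, 0 < p a).
Hypotheses (p_sum1 : \sum_a p a = 1) (model : trie_model Xi p N).
Local Notation q := (word_prob p).
Local Notation cts := (counts Xi N).

(** The sum is the probability that two independent letters agree; its powers bound the probability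
    that two strings coincide. *)
Lemma sum_sqr_lt1 : 0 <= \sum_a p a ^+ 2 < 1.
Proof.
apply/andP; split; first by apply: sumr_ge0 => a _; exact: sqr_ge0.
have [a [b ab]] : exists a b : A, a != b.
  have /card_gt1P[a [b [_ _ ab]]] : (1 < #|A|)%N by [].
  by exists a, b.
rewrite -p_sum1 -subr_gt0 -sumrB.
have le1 c : 0 <= p c - p c ^+ 2.
  rewrite expr2 -{1}[p c]mulr1 -mulrBr mulr_ge0 ?subr_ge0//; first exact: ltW.
  by rewrite -p_sum1 (bigD1 c)//= lerDl sumr_ge0// => ? _; exact: ltW.
rewrite (bigD1 a)//= ltr_pwDl//; last by apply: sumr_ge0 => c _; exact: le1.
rewrite expr2 -{1}[p a]mulr1 -mulrBr mulr_gt0// subr_gt0 -p_sum1.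
rewrite (bigD1 a)//= ltrDl (bigD1 b)//= 1?eq_sym// ltr_pwDl// sumr_ge0//.
by move=> ? _; exact: ltW.
Qed.

(** Two strings agree for ever. Off this null event every finite set of the strings is separated at
    some level. *)
Definition collision : set Omega := \bigcup_i \bigcup_j
  (if i == j then set0 else \bigcap_L [set w | mkseq (Xi i w) L = mkseq (Xi j w) L]).

Lemma discrete_pair d' (Om : measurableType d') (C D : countType)
  (X : Om -> C) (Y : Om -> D) :
  discrete X -> discrete Y -> discrete (fun w => (X w, Y w)).
Proof.
move=> dX dY [c e].
rewrite (_ : _ @^-1` _ = X @^-1` [set c] `&` Y @^-1` [set e]).
  exact: measurableI.
by apply/seteqP; split=> w /= [-> ->].
Qed.

Let mk i L w : L.-tuple A := [tuple of mkseq (Xi i w) L].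

Let mk_discrete i L : discrete (mk i L).
Proof. by apply: mkseq_discrete => j; exact: (letter_discrete model). Qed.

Let mkE i j L : [set w | mkseq (Xi i w) L = mkseq (Xi j w) L] =
  (fun w => (mk i L w, mk j L w)) @^-1` [set c | c.1 == c.2].
Proof.
apply/seteqP; split=> w /=; first by move=> E; apply/eqP/val_inj.
by move/eqP/(congr1 val).
Qed.

Lemma measurable_collision : measurable collision.
Proof.
apply: bigcupT_measurable => i; apply: bigcupT_measurable => j.
case: ifP => // _; apply: bigcapT_measurable => L; rewrite mkE.
by apply: discrete_preimage; exact: discrete_pair.
Qed.

Lemma agree_law i j L : i != j ->
  P [set w | mkseq (Xi i w) L = mkseq (Xi j w) L] = ((\sum_a p a ^+ 2) ^+ L)%:E.
Proof.
move=> ij; rewrite mkE.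
rewrite (measure_finite P (fun c : L.-tuple A * L.-tuple A => c.1 == c.2)); last first.
  exact: (discrete_pair (@mk_discrete i L) (@mk_discrete j L)).
rewrite -(sum_tuple_prod (fun a => p a ^+ 2)).
pose F (v v' : L.-tuple A) := P ((fun w => (mk i L w, mk j L w)) @^-1` [set (v, v')]).
transitivity (\sum_(c : L.-tuple A * L.-tuple A | true && (c.1 == c.2)) F c.1 c.2)%E.
  by apply: eq_bigr => -[].
rewrite -(pair_big_dep xpredT (fun v v' : L.-tuple A => v == v') F)/= /F.
rewrite -sumEFin; apply: eq_bigr => v _.
rewrite (big_pred1 v); last by move=> v'; rewrite /= eq_sym.
pose E k := [set w | mkseq (Xi k w) L = v].
have := strings_independent model (J := [fset i; j]%fset) (E := E).
rewrite (_ : \bigcap_(i0 in _) E i0 =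
   (fun w => (mk i L w, mk j L w)) @^-1` [set (v, v)]).
  move=> ->; last first.
    move=> k _; have := mkseq_discrete (L := L) (@string_letter_discrete _ _ _ Xi k) v.
    rewrite (_ : _ @^-1` _ = E k) //.
    by apply/seteqP; split => w; [move=> /= vE; rewrite /E /= -vE|move=> wE; apply/val_inj].
  rewrite (perm_big [:: i; j]); first rewrite !big_cons big_nil/= mule1.
    rewrite !(prefix_law hA model) -EFinM; congr EFin.
    rewrite /word_prob -big_split/=.
    by apply: eq_bigr => x _; rewrite expr2.
  apply: uniq_perm; first exact: fset_uniq.
    by rewrite /= inE ij.
  by move=> k; rewrite !inE.
apply/seteqP; split => w /=.
  move=> h; congr pair; apply/val_inj => /=.
    by apply: (h i); rewrite /= !inE eqxx.
  by apply: (h j); rewrite /= !inE eqxx orbT.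
by move=> [iv jv] k; rewrite /= !inE => /orP[] /eqP ->;
  [exact: (congr1 val iv)|exact: (congr1 val jv)].
Qed.

Lemma collision0 : P collision = 0%E.
Proof.
apply/(@negligibleP _ _ _ P); first exact: measurable_collision.
apply: negligible_bigcup => i; apply: negligible_bigcup => j.
case: ifPn => [_|ij]; first exact: negligible_set0.
set B := \bigcap_L _.
have mB : measurable B.
  apply: bigcapT_measurable => L; rewrite mkE.
  by apply: discrete_preimage; exact: discrete_pair.
apply/negligibleP => //; apply/eqP; rewrite eq_le measure_ge0 andbT.
have /andP[r0 r1] := sum_sqr_lt1.
apply/lee_addgt0Pr => e e0; rewrite add0e.
have : (\sum_a p a ^+ 2) ^+ n @[n --> \oo] --> (0 : R).
  by apply: cvg_expr; rewrite ger0_norm.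
move/cvgr0_norm_lt => /(_ e e0)[L _ /(_ L (leqnn _))].
rewrite ger0_norm ?exprn_ge0// => /ltW rL.
apply: (@le_trans _ _ (P [set w | mkseq (Xi i w) L = mkseq (Xi j w) L])); last first.
  by rewrite agree_law// lee_fin.
apply: le_measure; rewrite ?inE//; last by move=> w /(_ L Logic.I).
by rewrite mkE; apply: discrete_preimage; exact: discrete_pair.
Qed.

Lemma separated_counts l w : ~ collision w -> exists L, separated L (cts l w).
Proof.
move=> nc; set n := N l w.
have /choice[f fP] : forall ij : 'I_n * 'I_n, exists L, ij.1 != ij.2 ->
    mkseq (Xi ij.1 w) L <> mkseq (Xi ij.2 w) L.
  move=> [i j] /=; have [->|ij] := eqVneq i j; first by exists 0%N.
  have [[L LP]|nL] := pselect (exists L, mkseq (Xi i w) L <> mkseq (Xi j w) L).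
    by exists L.
  exfalso; apply: nc; exists (val i) => //; exists (val j) => //; rewrite ifN//.
  by move=> L _ /=; apply: contrapT => h; apply: nL; exists L.
exists (\max_ij f ij)%N => v vL.
rewrite /counts /string_count /prefix_count; apply/card_le1_eqP => i j.
rewrite !inE /has_prefix vL => /eqP vi /eqP vj.
apply/eqP/negPn/negP => ij; have := fP (j, i); rewrite /= => /(_ ij); apply.
have mkt k m : (m <= \max_ij f ij)%N ->
    mkseq (Xi k w) m = take m (mkseq (Xi k w) (\max_ij f ij)).
  by move=> ml; rewrite /mkseq -map_take take_iota (minn_idPl ml).
by rewrite [LHS]mkt ?leq_bigmax// [RHS]mkt ?leq_bigmax// -vi -vj.
Qed.

Definition subtrie l (x : A) (w : Omega) : {fset (seq A)} :=
  trie_of (branch (cts l w) x).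

Lemma random_trieE l w : random_trie Xi N l w = trie_of (cts l w).
Proof. by []. Qed.

Lemma random_trie_discrete l : discrete (random_trie Xi N l).
Proof. apply: discrete_trie_of => v; exact: (counts_discrete model). Qed.

Lemma subtrie_discrete l x : discrete (subtrie l x).
Proof. apply: discrete_trie_of => v; exact: (counts_discrete model). Qed.

Lemma random_trie_joined l w : ~ collision w ->
  joined (random_trie Xi N l w) (fun x => subtrie l x w).
Proof.
move=> /(@separated_counts l)[L sL]; apply: joined_trie_of sL.
exact: consistent_counts.
Qed.

Lemma leaves_random_trie l w : ~ collision w ->
  leaves R (random_trie Xi N l w) = (N l w)%:R.
Proof.
move=> /(@separated_counts l)[L sL]; rewrite random_trieE (leaves_trie_of _ _ sL).
  by rewrite /counts /string_count prefix_count_nil.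
exact: consistent_counts.
Qed.

Lemma trie_of_level c L0 (t : {fset (seq A)}) L : consistent c -> separated L0 c ->
  (forall v, v \in t -> (size v < L)%N) ->
  trie_of c = t <-> decides t (level L c).
Proof.
move=> cc sc tL; rewrite -(count_nodes_level cc tL).
by split=> [<-|cE]; rewrite /trie_of ?cE ?set_fsetK// fset_setK//; exact: separated_finite sc.
Qed.

(** Off [collision] both sides are conditions on level counts. The counts at level [L.+1] are
    independent Poisson variables, and those of words with first letter [x] have exactly the law of
    the counts at level [L] for intensity [l * p x]. *)
Lemma subtrie_split l (B : A -> set {fset (seq A)}) : 0 < l ->
  P (\bigcap_x (subtrie l x @^-1` B x)) =
  (\prod_x P (random_trie Xi N (l * p x) @^-1` B x))%E.
Proof.
move=> l0; apply: joint_law => [x|x|t].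
- exact: subtrie_discrete.
- exact: random_trie_discrete.
(* Deeper than every node of every [t x], as [count_nodes_level] requires. *)
pose L := (\max_x \max_(v <- t x) size v).+1%N.
have tL x v : v \in t x -> (size v < L)%N.
  move=> vt; rewrite ltnS; apply: leq_trans (leq_bigmax x).
  by rewrite (big_rem v)//= leq_maxl.
have lp x : 0 < l * p x by rewrite mulr_gt0.
have dX x : discrete (fun w => level L (branch (cts l w) x)).
  by apply: level_discrete => v; exact: (counts_discrete model).
have dY x : discrete (fun w => level L (cts (l * p x) w)).
  by apply: level_discrete => v; exact: (counts_discrete model).
rewrite (@measure_eq_null _ _ _ _ collision _ (\bigcap_x
  ((fun w => level L (branch (cts l w) x)) @^-1` [set k | decides (t x) k]))).
- rewrite (joint_law dX dY).
    apply: eq_bigr => x _; apply: (@measure_eq_null _ _ _ _ collision).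
    + exact: measurable_collision.
    + exact: discrete_preimage.
    + exact: random_trie_discrete.
    + exact: collision0.
    + move=> w /(@separated_counts (l * p x))[L0 sL0].
      rewrite /= random_trieE.
      by rewrite (trie_of_level (@consistent_counts _ _ _ _ _ _ _ _ _) sL0 (tL x)).
  move=> k.
  pose K : {ffun L.+1.-tuple A -> nat} := [ffun v => k (thead v) [tuple of behead v]].
  rewrite (_ : \bigcap_x _ = [set w | level L.+1 (cts l w) = K]); last first.
    apply/seteqP; split => [w h|w /= h x _ /=].
      apply/ffunP => v; rewrite [in RHS]ffunE -(h (thead v) Logic.I) !ffunE /branch.
      by congr cts; rewrite [in LHS](tuple_eta v).
    apply/ffunP => v; have := congr1 (fun g : {ffun L.+1.-tuple A -> nat} => g [tuple of x :: v]) h.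
    rewrite !ffunE theadE /branch /= => ->; congr (k x _).
    exact/val_inj.
  rewrite (counts_law hA p_gt0 p_sum1 model)// big_tuple_cons -prodEFin.
  apply: eq_bigr => x _; rewrite (counts_law hA p_gt0 p_sum1 model)//; congr EFin.
  apply: eq_bigr => v _; rewrite ffunE theadE /word_prob big_cons mulrA.
  by congr (poisson_pmf _ (k x _)); exact/val_inj.
- exact: measurable_collision.
- by apply: fin_bigcap_measurable => // x _; exact: subtrie_discrete.
- by apply: fin_bigcap_measurable => // x _; exact: discrete_preimage.
- exact: collision0.
- move=> w /(@separated_counts l)[L0 sL0].
  have h x : subtrie l x w = t x <-> decides (t x) (level L (branch (cts l w) x)).
    rewrite /subtrie; apply: (trie_of_level (L0 := L0)) => //.
    + by apply: consistent_branch; exact: consistent_counts.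
    + by apply: separated_branch; apply: separatedS => //; exact: consistent_counts.
    + exact: tL.
  by split=> hw x _; apply/h; exact: hw.
Qed.

(** The least number of strings that generate [t], capped at 2. *)
Definition weight (t : {fset (seq A)}) : nat :=
  if t == fset0 then 0 else if t == singleton_trie A then 1 else 2.

Lemma random_trie_sum l (t : {fset (seq A)}) : 0 < l ->
  P (random_trie Xi N l @^-1` [set t]) =
  (\sum_(n <oo) ((poisson_pmf l n)%:E *
     P [set w | trie_of (string_count Xi n w) = t]))%E.
Proof.
move=> l0; rewrite (measure_discrete P (@N_discrete _ _ _ _ N l)); last exact: random_trie_discrete.
apply: eq_eseriesr => n _.
rewrite -(size_law model)// -(size_independent model)//; last first.
  have := discrete_trie_of
    (fun v => discrete_prefix_count n v (@strings_letter_discrete _ _ _ Xi)) t.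
  exact.
congr (P _); apply/seteqP; split=> w /=; rewrite random_trieE /counts.
  by move=> [Tt <-].
by move=> [-> Tt].
Qed.

(** A trie of weight k needs n >= k strings, and for such n the Poisson weight at [l] is at most (l
    / l')^k e^(l') times the one at [l']. *)
Lemma random_trie_dom l l' (t : {fset (seq A)}) : 0 < l -> l <= l' ->
  (P (random_trie Xi N l @^-1` [set t]) <=
  ((l / l') ^+ weight t * expR l')%:E * P (random_trie Xi N l' @^-1` [set t]))%E.
Proof.
move=> l0 ll'; have l'0 : 0 < l' by exact: lt_le_trans ll'.
rewrite !random_trie_sum// -nneseriesZl; last first.
  by move=> n _; rewrite mule_ge0 ?measure_ge0// lee_fin poisson_pmf_ge0.
apply: lee_nneseries => [n _ _|n _].
  by rewrite mule_ge0 ?measure_ge0// lee_fin poisson_pmf_ge0.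
rewrite muleA -EFinM.
have [wn|nw] := leqP (weight t) n.
  apply: lee_wpmul2r; first exact: measure_ge0.
  rewrite lee_fin /poisson_pmf l0 l'0.
  have -> : (l / l') ^+ weight t * expR l' * (l' ^+ n / n`!%:R * expR (- l')) =
      (l / l') ^+ weight t * l' ^+ n / n`!%:R.
    rewrite expRN; field; rewrite pnatr_eq0 -lt0n fact_gt0 andTb.
    by rewrite !gt_eqF// expR_gt0.
  have -> : l ^+ n = (l / l') ^+ n * l' ^+ n by rewrite -exprMn divfK// gt_eqF.
  apply: (@le_trans _ _ ((l / l') ^+ n * l' ^+ n / n`!%:R)).
    rewrite ler_piMr// ?expR_le1 ?oppr_le0 ?ltW//.
    by rewrite divr_gt0 ?mulr_gt0 ?exprn_gt0 ?divr_gt0 ?ltr0n ?fact_gt0.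
  rewrite ler_pM2r ?invr_gt0 ?ltr0n ?fact_gt0// ler_pM2r ?exprn_gt0//.
  rewrite ler_wiXn2l//; first by rewrite divr_ge0 ?ltW.
  by rewrite ler_pdivrMr ?mul1r.
rewrite (_ : [set w | _] = set0) ?measure0 ?mule0//.
apply/seteqP; split=> // w /= tE; move: nw; rewrite -tE.
have cs : consistent (string_count Xi n w) by exact: consistent_prefix_count.
have s0 : string_count Xi n w [::] = n by exact: prefix_count_nil.
case: n cs s0 {tE} => [|[|n]] cs s0.
- by rewrite /trie_of count_nodes0// fset_set0 /weight eqxx.
- by rewrite /trie_of count_nodes1// fset_set1 /weight eqxx; case: ifP.
- by rewrite /weight; case: ifP => //; case: ifP.
Qed.

Lemma poisson_sum1 (l : R) : 0 < l ->
  (\sum_(n <oo) (poisson_pmf l n)%:E = 1)%E.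
Proof.
move=> l0; rewrite -(probability_setT (poisson_prob l 0)) /= /poisson_prob l0.
by rewrite nneseries_esumT// => n; rewrite lee_fin poisson_pmf_ge0.
Qed.

(** Almost surely the leaf count is the Poisson number of strings. The exponential factor turns the
    Poisson weights into those of intensity [l * expR u], which sum to 1. *)
Lemma leaves_expR l u : 0 < l ->
  (\int[P]_w (expR (u * leaves R (random_trie Xi N l w)))%:E =
   (expR (l * (expR u - 1)))%:E)%E.
Proof.
move=> l0.
rewrite (ae_eq_integral (fun w => (expR (u * (N l w)%:R))%:E)) //; first last.
- exists collision; split; [exact: measurable_collision|exact: collision0|].
  move=> w /= nE; apply: contrapT => ncol; apply: nE => _.
  by rewrite leaves_random_trie.
- exact: (discrete_measurableE (fun n : nat => (expR (u * n%:R))%:E) (@N_discrete _ _ _ _ N l)).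
- exact: (discrete_measurableE (fun t : {fset (seq A)} => (expR (u * leaves R t))%:E) (@random_trie_discrete l)).
rewrite (@integral_discrete _ _ _ _ P (N l) (fun n => (expR (u * n%:R))%:E)); first last.
- by move=> n; rewrite lee_fin expR_ge0.
- exact: N_discrete.
have lu0 : 0 < l * expR u by rewrite mulr_gt0 ?expR_gt0.
rewrite (eq_eseriesr (g := fun n => (expR (l * (expR u - 1)))%:E * (poisson_pmf (l * expR u) n)%:E)%E).
  rewrite nneseriesZl => [|n _]; last by rewrite lee_fin poisson_pmf_ge0.
  by rewrite poisson_sum1// mule1.
move=> n _; rewrite [X in (_ * X)%E](_ : _ = (poisson_pmf l n)%:E)/=; last exact: (size_law model).
rewrite -!EFinM; congr EFin.
rewrite /poisson_pmf l0 lu0 exprMn expRM_natr.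
have -> : expR (- l) = expR (l * (expR u - 1)) * expR (- (l * expR u)).
  by rewrite -expRD; congr expR; ring.
by ring.
Qed.

End Model.

Lemma powR_homo (R : realType) (r x y : R) :
  0 <= r -> 0 <= x -> x <= y -> x `^ r <= y `^ r.
Proof.
move=> r0 x0 xy; apply: ge0_ler_powR => //.
by have : 0 <= y := le_trans x0 xy.
Qed.

(** * Moments of additive functionals *)

Section TruncatedPower.
Variable R : realType.
Implicit Types (b s x y c : R).

(** This is |x|^s up to [b] and grows only quadratically beyond, so a finite second moment makes its
    mean finite. *)
Definition tpow b s x : R := x ^+ 2 * Num.min `|x| b `^ (s - 2).

Lemma tpow_ge0 b s x : 0 <= tpow b s x.
Proof. by rewrite mulr_ge0 ?sqr_ge0 ?powR_ge0. Qed.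

Lemma powR_sqr x s : 2 < s -> `|x| `^ s = x ^+ 2 * `|x| `^ (s - 2).
Proof.
move=> s2; have [->|x0] := eqVneq x 0.
  by rewrite normr0 expr2 !mul0r powR0// gt_eqF// (lt_trans _ s2).
rewrite -[in LHS](subrK 2 s) addrC [LHS]powRD; last by rewrite normr_eq0 x0 implybT.
by rewrite powR_mulrn// real_normK ?num_real.
Qed.

Lemma tpow_le b s x : 0 <= b -> 2 < s -> tpow b s x <= `|x| `^ s.
Proof.
move=> b0 s2; rewrite powR_sqr// ler_wpM2l ?sqr_ge0// powR_homo//.
- by rewrite subr_ge0 ltW.
- by rewrite le_min normr_ge0.
- by rewrite ge_min lexx.
Qed.

Lemma tpow_sqr b s x : 0 <= b -> 2 < s -> tpow b s x <= b `^ (s - 2) * x ^+ 2.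
Proof.
move=> b0 s2; rewrite /tpow mulrC ler_wpM2r ?sqr_ge0// powR_homo//.
- by rewrite subr_ge0 ltW.
- by rewrite le_min normr_ge0.
- by rewrite ge_min lexx orbT.
Qed.

Lemma tpow_eq b s x : 2 < s -> `|x| <= b -> tpow b s x = `|x| `^ s.
Proof. by move=> s2 xb; rewrite powR_sqr// /tpow (min_idPl xb). Qed.

Lemma tpow_homo b s x y : 0 <= b -> 2 < s -> `|x| <= `|y| ->
  tpow b s x <= tpow b s y.
Proof.
move=> b0 s2 xy; apply: ler_pM; rewrite ?sqr_ge0 ?powR_ge0//.
  by rewrite -(real_normK (num_real x)) -(real_normK (num_real y)) lerXn2r.
apply: powR_homo; rewrite ?le_min ?normr_ge0//.
  by rewrite subr_ge0 ltW.
by rewrite !ge_min lexx xy orbT.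
Qed.

Lemma tpowZ b s c x : 0 <= b -> 2 < s -> 1 <= c ->
  tpow b s (c * x) <= c `^ s * tpow b s x.
Proof.
move=> b0 s2 c1; have c0 : 0 <= c by exact: le_trans c1.
rewrite -{2}(ger0_norm c0) powR_sqr// /tpow exprMn.
have key : Num.min `|c * x| b `^ (s - 2) <=
    `|c| `^ (s - 2) * Num.min `|x| b `^ (s - 2).
  rewrite -powRM ?le_min ?normr_ge0//; apply: powR_homo.
  - by rewrite subr_ge0 ltW.
  - by rewrite le_min normr_ge0.
  rewrite (ger0_norm c0) minr_pMr// normrM (ger0_norm c0) le_min ge_min lexx/=.
  by rewrite ge_min ler_peMl ?orbT.
apply: le_trans (ler_wpM2l _ key) _; first by rewrite mulr_ge0 ?sqr_ge0.
by rewrite le_eqVlt; apply/orP; left; apply/eqP; ring.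
Qed.

(* If one term dominates, the left-hand side is close to its [tpow]; otherwise
   the cross terms or [y] control it. *)
Lemma tpow_sum (A : finType) (a0 : A) s e : 2 < s -> 0 < e ->
  exists2 C, 0 < C & forall b (x : A -> R) y, 0 < b ->
  tpow b s (\sum_a x a + y) <= (1 + e) * \sum_a tpow b s (x a) +
    C * (\sum_a \sum_(a' | a' != a) `|x a| `^ (s / 2) * `|x a'| `^ (s / 2)) +
    C * `|y| `^ s.
Proof.
move=> s2 e0; have s0 : 0 < s by exact: lt_trans s2.
pose k : R := #|A|%:R; have k0 : 0 < k by rewrite ltr0n; apply/card_gt0P; exists a0.
(* [h] solves (1 + (k + 1) h)^s = 1 + e: if [y] and all other terms are at most h |x m|, the whole
   sum is at most (1 + (k + 1) h) |x m|. *)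
pose h := ((1 + e) `^ s^-1 - 1) / (k + 1).
have k10 : 0 < k + 1 by rewrite addr_gt0.
have e1 : 1 < 1 + e by rewrite ltrDl.
have h0 : 0 < h.
  rewrite divr_gt0// subr_gt0 -[ltLHS](powRr0 (1 + e)).
  rewrite /powR gt_eqF; last lra.
  by rewrite ltr_expR mul0r mulr_gt0 ?invr_gt0// ln_gt0.
have hs : (1 + (k + 1) * h) `^ s = 1 + e.
  rewrite mulrC divfK ?gt_eqF// addrC subrK -powRrM mulVf ?gt_eqF// powRr1//; lra.
pose C := (k / h + 1) `^ s + (k + h) `^ s / h `^ (s / 2).
have hp : 0 < h `^ (s / 2) by exact: powR_gt0.
have C1 : (k / h + 1) `^ s <= C.
  by rewrite lerDl divr_ge0// powR_ge0.
have C2 : (k + h) `^ s / h `^ (s / 2) <= C by rewrite lerDr powR_ge0.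
have C0 : 0 < C.
  by apply: lt_le_trans C1; rewrite powR_gt0// addr_gt0// divr_gt0.
exists C => // b x y b0; have bge := ltW b0.
have T1 : 0 <= (1 + e) * \sum_a tpow b s (x a).
  by rewrite mulr_ge0 ?sumr_ge0//; [lra|move=> a _; exact: tpow_ge0].
have X0 a a' : 0 <= `|x a| `^ (s / 2) * `|x a'| `^ (s / 2).
  by rewrite mulr_ge0 ?powR_ge0.
have T2 : 0 <= C * (\sum_a \sum_(a' | a' != a) `|x a| `^ (s / 2) * `|x a'| `^ (s / 2)).
  by rewrite mulr_ge0 ?(ltW C0)// sumr_ge0// => a _; exact: sumr_ge0.
have T3 : 0 <= C * `|y| `^ s by rewrite mulr_ge0 ?powR_ge0// ltW.
pose m := [arg max_(a > a0) `|x a|]%O.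
have xm a : `|x a| <= `|x m|.
  by rewrite /m; case: arg_maxP => // i _ /(_ a); exact.
have Sm : `|\sum_a x a| <= k * `|x m|.
  apply: (le_trans (ler_norm_sum _ _ _)).
  rewrite (le_trans (ler_sum _ (fun a _ => xm a)))//.
  by rewrite sumr_const mulr_natl.
have [yh|hy] := leP `|y| (h * `|x m|); last first.
  have : `|\sum_a x a + y| <= (k / h + 1) * `|y|.
    rewrite (le_trans (ler_normD _ _))// mulrDl mul1r lerD2r (le_trans Sm)//.
    by rewrite -mulrA ler_wpM2l ?(ltW k0)// ler_pdivlMl// ltW.
  move=> Sy; apply: (@le_trans _ _ (C * `|y| `^ s)); last lra.
  apply: le_trans (tpow_le _ bge s2) _.
  apply: (@le_trans _ _ (((k / h + 1) * `|y|) `^ s)).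
    by apply: powR_homo => //; exact: ltW.
  rewrite powRM//; last by rewrite addr_ge0// divr_ge0 ?ltW.
  by rewrite ler_wpM2r ?powR_ge0.
have [[a' a'm ha']|small] := pselect (exists2 a', a' != m & h * `|x m| < `|x a'|).
  have Sm' : `|\sum_a x a + y| <= (k + h) * `|x m|.
    by rewrite (le_trans (ler_normD _ _))// mulrDl lerD.
  apply: (@le_trans _ _ (C * (`|x m| `^ (s / 2) * `|x a'| `^ (s / 2)))); last first.
    have : `|x m| `^ (s / 2) * `|x a'| `^ (s / 2) <=
        \sum_a \sum_(a' | a' != a) `|x a| `^ (s / 2) * `|x a'| `^ (s / 2).
      rewrite (bigD1 m)//= (bigD1 a')//= -addrA lerDl addr_ge0// ?sumr_ge0// => i _.
      exact: sumr_ge0.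
    by move=> /(ler_wpM2l (ltW C0)); lra.
  apply: le_trans (tpow_le _ bge s2) _.
  apply: (@le_trans _ _ (((k + h) * `|x m|) `^ s)).
    by apply: powR_homo => //; exact: ltW.
  rewrite powRM//; last by rewrite addr_ge0 ?ltW.
  apply: (@le_trans _ _ ((k + h) `^ s / h `^ (s / 2) *
     (`|x m| `^ (s / 2) * `|x a'| `^ (s / 2)))).
    rewrite -mulrA ler_wpM2l ?powR_ge0//.
    rewrite ler_pdivlMl//.
    have xm2 : `|x m| `^ s = `|x m| `^ (s / 2) * `|x m| `^ (s / 2).
      have [->|xm0] := eqVneq (x m) 0.
        by rewrite normr0 !powR0 ?mul0r// ?mulf_neq0 ?invr_eq0 ?gt_eqF.
      rewrite -powRD; first by congr (_ `^ _); field.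
      by rewrite normr_eq0 xm0 implybT.
    rewrite xm2 mulrCA ler_wpM2l ?powR_ge0// -powRM ?(ltW h0)//.
    by apply: powR_homo; [lra|rewrite mulr_ge0 // ltW|exact: ltW].
  by rewrite ler_wpM2r.
have Sm' : `|\sum_a x a + y| <= `|(1 + (k + 1) * h) * x m|.
  rewrite normrM [X in X * _]ger0_norm; last first.
    by rewrite addr_ge0// mulr_ge0 ?ltW.
  rewrite (le_trans (ler_normD _ _))// (bigD1 m)//=.
  have : `|\sum_(i | i != m) x i| <= k * (h * `|x m|).
    apply: (le_trans (ler_norm_sum _ _ _)).
    apply: (@le_trans _ _ (\sum_(a : A) h * `|x m|)); last first.
      by rewrite sumr_const mulr_natl.
    rewrite big_mkcond; apply: ler_sum => a _; case: ifPn => am.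
      by rewrite leNgt; apply/negP => ha; apply: small; exists a.
    by rewrite mulr_ge0// ltW.
  have := ler_normD (x m) (\sum_(i | i != m) x i).
  lra.
apply: (@le_trans _ _ ((1 + e) * tpow b s (x m))).
  rewrite -hs; apply: le_trans (tpow_homo bge s2 Sm') _.
  by apply: tpowZ => //; rewrite lerDl mulr_ge0 ?ltW.
have : tpow b s (x m) <= \sum_a tpow b s (x a).
  rewrite (bigD1 m)//= lerDl sumr_ge0// => a _; exact: tpow_ge0.
have e1' : 0 <= 1 + e by lra.
by move=> /(ler_wpM2l e1'); lra.
Qed.

End TruncatedPower.

(** * Independent real random variables *)

Section Independence.
Context d (Om : measurableType d) (R : realType) (P : probability Om R).

Definition indep2 (X Y : Om -> R) := forall B C : set R, measurable B ->
  measurable C -> P (X @^-1` B `&` Y @^-1` C) = (P (X @^-1` B) * P (Y @^-1` C))%E.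

Definition mkRV (X : Om -> R) (mX : measurable_fun setT X) : {RV P >-> R} :=
  mfun_Sub (mem_set mX).

Variables (X Y : Om -> R).
Hypotheses (mX : measurable_fun setT X) (mY : measurable_fun setT Y).
Hypothesis indXY : indep2 X Y.

Let mXY : measurable_fun setT (fun w => (X w, Y w)).
Proof. exact: measurable_fun_pair. Qed.

(** The joint law agrees with the product of the marginals on rectangles, hence everywhere; the
    product formulas below then follow from Tonelli and Fubini. *)
Let joint_measure (B : set (R * R)) : measurable B ->
  (distribution P (mkRV mX) \x distribution P (mkRV mY))%E B =
  pushforward P (fun w => (X w, Y w)) B.
Proof.
move=> mB.
pose XY : {mfun Om >-> (R * R)%type} := mfun_Sub (mem_set mXY).
have := @product_measure_unique _ _ _ _ _ (distribution P (mkRV mX))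
  (distribution P (mkRV mY)) (distribution P XY).
move=> /(_ _ _ mB) ->; last by move=> B1 B2 mB1 mB2; exact: indXY.
by [].
Qed.

Lemma indep_tonelli (F : R * R -> \bar R) : measurable_fun setT F ->
  (forall z, 0 <= F z)%E ->
  (\int[P]_w F (X w, Y w) = \int[P]_w \int[P]_w' F (X w, Y w'))%E.
Proof.
move=> mF F0.
transitivity (\int[distribution P (mkRV mX) \x distribution P (mkRV mY)]_z F z)%E.
  rewrite [RHS](eq_measure_integral (pushforward P (fun w => (X w, Y w)))) /=; last first.
    by move=> B mB _; exact: joint_measure.
  by rewrite (ge0_integral_pushforward mXY).
rewrite fubini_tonelli1// ge0_integral_distribution//=; first last.
- by move=> x; exact: integral_ge0.
- exact: measurable_fun_fubini_tonelli_F.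
apply: eq_integral => w _; rewrite /fubini_F ge0_integral_distribution//=.
by apply: measurableT_comp => //; exact: measurable_pair1.
Qed.

Lemma indep_mul_ge0 (f g : R -> \bar R) : measurable_fun setT f ->
  measurable_fun setT g -> (forall x, 0 <= f x)%E -> (forall x, 0 <= g x)%E ->
  (\int[P]_w (f (X w) * g (Y w)) = \int[P]_w f (X w) * \int[P]_w g (Y w))%E.
Proof.
move=> mf mg f0 g0.
rewrite (indep_tonelli (F := fun z => (f z.1 * g z.2)%E)); last 2 first.
- by apply: emeasurable_funM; apply: measurableT_comp.
- by move=> z; exact: mule_ge0.
have mgY : measurable_fun setT (fun w => g (Y w)) by exact: measurableT_comp.
have mfX : measurable_fun setT (fun w => f (X w)) by exact: measurableT_comp.
under eq_integral => w _ do rewrite /= ge0_integralZl//.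
rewrite ge0_integralZr//; exact: integral_ge0.
Qed.

Lemma indep_mul (iX : P.-integrable setT (EFin \o X))
    (iY : P.-integrable setT (EFin \o Y)) :
  P.-integrable setT (EFin \o (fun w => X w * Y w)) /\
  \int[P]_w (X w * Y w) = \int[P]_w X w * \int[P]_w Y w.
Proof.
set mu := (distribution P (mkRV mX) \x distribution P (mkRV mY))%E.
have mprod : measurable_fun setT (fun z : R * R => (z.1 * z.2)%:E).
  by apply/measurable_EFinP; apply: measurable_funM.
have iXY : P.-integrable setT (EFin \o (fun w => X w * Y w)).
  apply/integrableP; split; first by apply/measurable_EFinP; exact: measurable_funM.
  under eq_integral do rewrite /= normrM EFinM.
  rewrite (indep_mul_ge0 (f := fun x => `|x|%:E) (g := fun x => `|x|%:E))//; last 2 first.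
  - by apply/measurable_EFinP; exact: normr_measurable.
  - by apply/measurable_EFinP; exact: normr_measurable.
  move/integrableP : iX => [_ iX]; move/integrableP : iY => [_ iY].
  by rewrite lte_mul_pinfty ?integral_ge0// ge0_fin_numE ?integral_ge0.
split => //.
have imu : mu.-integrable setT (fun z : R * R => (z.1 * z.2)%:E).
  apply/integrableP; split => //.
  rewrite [X in (X < _)%E](eq_measure_integral (pushforward P (fun w => (X w, Y w)))) /=; last first.
    by move=> B mB _; exact: joint_measure.
  rewrite (ge0_integral_pushforward mXY)//=; last first.
    by apply/measurable_EFinP; apply: measurableT_comp => //; exact/measurable_EFinP.
  by move/integrableP : iXY => [].
have E : (\int[P]_w (X w * Y w)%:E = \int[P]_w (X w)%:E * \int[P]_w (Y w)%:E)%E.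
  transitivity (\int[mu]_z (z.1 * z.2)%:E)%E.
    rewrite [RHS](eq_measure_integral (pushforward P (fun w => (X w, Y w)))) /=; last first.
      by move=> B mB _; exact: joint_measure.
    by rewrite (integral_pushforward mXY).
  rewrite -integral12_prod_meas1//.
  rewrite /fubini_F/=.
  have EY : (\int[distribution P (mkRV mY)]_y y%:E = \int[P]_w (Y w)%:E)%E.
    by rewrite integral_distribution//.
  have fY : (\int[P]_w (Y w)%:E)%E \is a fin_num by exact: integrable_fin_num.
  have iidY : (distribution P (mkRV mY)).-integrable setT (fun y : R => y%:E).
    apply/integrableP; split; first exact/measurable_EFinP.
    rewrite ge0_integral_distribution//=.
      by move/integrableP : iY => [].
    by apply: measurableT_comp => //; exact/measurable_EFinP.
  under eq_integral => x _.
    rewrite (eq_integral (fun y => x%:E * y%:E)%E); last by move=> y _; rewrite EFinM.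
    rewrite integralZl// EY -(fineK fY).
    over.
  rewrite /= integral_distribution//=; last 2 first.
  - apply: emeasurable_funM => //; exact/measurable_EFinP.
  - by rewrite -(fineK fY); apply: integrableZr.
  by rewrite -(fineK fY) integralZr.
by rewrite /Rintegral E fineM// integrable_fin_num.
Qed.

End Independence.

(** * Power sums of the letter probabilities and the abstract splitting recursion *)

Section PowerSums.
Context (R : realType) (A : finType) (p : A -> R).
Hypotheses (hA : (2 <= #|A|)%N) (p_gt0 : forall a, 0 < p a).
Hypothesis (p_sum1 : \sum_a p a = 1).

Lemma letter_prob_lt1 a : p a < 1.
Proof.
have /card_gt1P[x [y [_ _ xy]]] : (1 < #|A|)%N by [].
have [b ab] : exists b, b != a.
  by have [<-|] := eqVneq x a; [exists y; rewrite eq_sym|exists x].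
rewrite -p_sum1 (bigD1 a)//= ltrDl (bigD1 b)//= ltr_pwDl// sumr_ge0// => c _.
exact: ltW.
Qed.

Lemma sum_powR_lt1 q : 1 < q -> \sum_a p a `^ q < 1.
Proof.
move=> q1; rewrite -p_sum1.
have /card_gt1P[x _] : (1 < #|A|)%N by [].
have lt a : p a `^ q < p a.
  rewrite -{2}(powRr1 (ltW (p_gt0 a))) /powR !gt_eqF// ltr_expR.
  by rewrite ltr_nM2r// ln_lt0// p_gt0 letter_prob_lt1.
rewrite [ltRHS](bigD1 x)//= [ltLHS](bigD1 x)//= ltr_leD//.
by apply: ler_sum => a _; exact: ltW.
Qed.

End PowerSums.

(* [T l] is the random trie with Poisson(l) strings and [U l x] the trie of the
   suffixes of its strings starting with [x]. *)
Record trie_recursion d (Om : measurableType d) (R : realType)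
    (P : probability Om R) (A : finType) (p : A -> R)
    (T : R -> Om -> {fset (seq A)}) (U : R -> A -> Om -> {fset (seq A)})
    (Z : set Om) : Prop := {
  discreteT : forall l, discrete (T l);
  discreteU : forall l x, discrete (U l x);
  split_law : forall (l : R) (B : A -> set {fset (seq A)}), 0 < l ->
    P (\bigcap_x (U l x @^-1` B x)) = (\prod_x P (T (l * p x)%R @^-1` B x))%E;
  measurableZ : measurable Z;
  nullZ : P Z = 0%E;
  joinedTU : forall (l : R) (w : Om), ~ Z w -> joined (T l w) (fun x => U l x w);
  dominatedT : forall (l l' : R) (t : {fset (seq A)}), 0 < l -> l <= l' ->
    (P (T l @^-1` [set t]) <=
    ((l / l') ^+ weight t * expR l')%:E * P (T l' @^-1` [set t]))%E;
  leaves_mgf : forall l u : R, 0 < l ->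
    (\int[P]_w (expR (u * leaves R (T l w)))%:E =
     (expR (l * (expR u - 1)))%:E)%E }.

Section Recursion.
Context d (Om : measurableType d) (R : realType) (P : probability Om R).
Context (A : finType) (p : A -> R).
Variables (T : R -> Om -> {fset (seq A)}) (U : R -> A -> Om -> {fset (seq A)}).
Variable (Z : set Om).
Hypothesis M : trie_recursion P p T U Z.
Let dT := discreteT M.
Let dU := discreteU M.
Let splitU := split_law M.
Let domT := dominatedT M.
Implicit Types (l : R) (t : {fset (seq A)}).

Lemma measurable_TU l (F : {fset (seq A)} -> (A -> {fset (seq A)}) -> \bar R) :
  measurable_fun setT (fun w => F (T l w) (fun x => U l x w)).
Proof.
have dV := discrete_pair (dT l) (discrete_ffun (dU l)).
have := discrete_measurableE
  (fun c : {fset (seq A)} * {ffun A -> {fset (seq A)}} => F c.1 (fun x => c.2 x)) dV.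
congr measurable_fun; apply/funext => w /=; congr (F _ _).
by apply/funext => x; rewrite ffunE.
Qed.

Lemma measurable_T l (f : {fset (seq A)} -> \bar R) :
  measurable_fun setT (fun w => f (T l w)).
Proof. exact: (measurable_TU l (fun t _ => f t)). Qed.

Lemma measurable_TR l (f : {fset (seq A)} -> R) :
  measurable_fun setT (fun w => f (T l w)).
Proof. exact: discrete_measurableR. Qed.

Lemma measurable_UR l x (f : {fset (seq A)} -> R) :
  measurable_fun setT (fun w => f (U l x w)).
Proof. exact: discrete_measurableR. Qed.

Lemma subtrie_law l x B : 0 < l -> P (U l x @^-1` B) = P (T (l * p x) @^-1` B).
Proof.
move=> l0.
have := splitU (fun y => if y == x then B else setT) l0.
rewrite (bigD1 x)//= eqxx [X in (_ * X)%E]big1 ?mule1; last first.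
  by move=> y /negbTE ->; rewrite preimage_setT probability_setT.
move=> <-; congr (P _); apply/seteqP; split=> [w Bw y _|w /(_ x Logic.I)].
  by case: eqP => [->|].
by rewrite eqxx.
Qed.

Lemma subtrie_integral l x (f : {fset (seq A)} -> \bar R) : 0 < l ->
  (forall t, 0 <= f t)%E ->
  (\int[P]_w f (U l x w) = \int[P]_w f (T (l * p x) w))%E.
Proof.
move=> l0 f0; rewrite !integral_discrete//.
apply: eq_eseriesr => n _; congr (_ * _)%E.
exact: (subtrie_law x (fun t => choice.pickle t = n) l0).
Qed.

Lemma indep2_subtrie l x y (f g : {fset (seq A)} -> R) : 0 < l -> x != y ->
  indep2 P (fun w => f (U l x w)) (fun w => g (U l y w)).
Proof.
move=> l0 xy B C mB mC.
pose BC z := if z == x then f @^-1` B else if z == y then g @^-1` C else setT.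
rewrite (_ : _ `&` _ = \bigcap_z (U l z @^-1` BC z)); last first.
  apply/seteqP; split=> [w [Bw Cw] z _|w h].
    by rewrite /BC; case: eqP => [->//|_]; case: eqP => [->|].
  split; first by have := h x Logic.I; rewrite /BC eqxx.
  by have := h y Logic.I; rewrite /BC eqxx eq_sym (negbTE xy).
rewrite splitU// (bigD1 x)//= (bigD1 y) 1?eq_sym//= big1 ?mule1.
  rewrite /BC !eqxx eq_sym (negbTE xy).
  by rewrite -!subtrie_law.
move=> z /andP[zx zy]; rewrite /BC (negbTE zx) (negbTE zy).
by rewrite preimage_setT probability_setT.
Qed.

(** Lowering the intensity gains a factor (l / l')^k on functions that vanish on tries of weight
    below [k]. With k = 0 this carries integrability down to small [l]; with k = 2 it gives bounds
    of order l^2. *)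
Lemma dom_integral k l l' (f : {fset (seq A)} -> \bar R) : 0 < l -> l <= l' ->
  (forall t, 0 <= f t)%E -> (forall t, (weight t < k)%N -> f t = 0%E) ->
  (\int[P]_w f (T l w) <=
   ((l / l') ^+ k * expR l')%:E * \int[P]_w f (T l' w))%E.
Proof.
move=> l0 ll' f0 fk; have l'0 : 0 < l' by exact: lt_le_trans ll'.
rewrite !integral_discrete// -nneseriesZl; last first.
  move=> n _; rewrite mule_ge0 ?measure_ge0//.
  by case: choice.unpickle => //= c; exact: f0.
have r0 : 0 <= (l / l') ^+ k * expR l' by rewrite mulr_ge0 ?expR_ge0// exprn_ge0// divr_ge0 ?ltW.
apply: lee_nneseries => [n _ _|n _].
  by rewrite mule_ge0 ?measure_ge0//; case: choice.unpickle => //= c; exact: f0.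
case E : (choice.unpickle n) => [t|]/=; last by rewrite !mul0e mule0.
have [tn|tn] := eqVneq (choice.pickle t) n; last first.
  have empty l1 : (fun w => choice.pickle (T l1 w)) @^-1` [set n] = set0.
    apply/seteqP; split=> // w /= wn; move: E; rewrite -wn choice.pickleK => -[tw].
    by move: tn; rewrite -tw wn eqxx.
  by rewrite !empty !measure0 !mule0.
have fiber l1 : (fun w => choice.pickle (T l1 w)) @^-1` [set n] = T l1 @^-1` [set t].
  apply/seteqP; split=> w /=; rewrite -tn; last by move=> ->.
  exact: (pcan_inj choice.pickleK).
rewrite !fiber.
have [tk|kt] := ltnP (weight t) k; first by rewrite fk// !mul0e mule0.
rewrite muleCA; apply: lee_wpmul2l => //.
apply: le_trans; first exact: (dominatedT M _ l0 ll').
apply: lee_wpmul2r; first exact: measure_ge0.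
rewrite lee_fin ler_pM2r ?expR_gt0// ler_wiXn2l//; first by rewrite divr_ge0 ?ltW.
by rewrite ler_pdivrMr ?mul1r.
Qed.

End Recursion.

Lemma le_ge0_integral d (Om : measurableType d) (R : realType)
    (mu : {measure set Om -> \bar R}) (f g : Om -> R) :
  measurable_fun setT f -> measurable_fun setT g ->
  (forall w, 0 <= f w) -> (forall w, f w <= g w) ->
  (\int[mu]_w (f w)%:E <= \int[mu]_w (g w)%:E)%E.
Proof.
move=> mf mg f0 fg; apply: ge0_le_integral => //.
- by move=> w _; rewrite lee_fin.
- exact/measurable_EFinP.
- exact/measurable_EFinP.
- by move=> w _; rewrite lee_fin.
Qed.

(** * Contraction for one moment exponent *)

Section MomentStep.
Context d (Om : measurableType d) (R : realType) (P : probability Om R).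
Context (A : finType) (p : A -> R).
Variables (T : R -> Om -> {fset (seq A)}) (U : R -> A -> Om -> {fset (seq A)}).
Variable (Z : set Om).
Hypothesis M : trie_recursion P p T U Z.
Hypotheses (hA : (2 <= #|A|)%N) (p_gt0 : forall a, 0 < p a).
Hypothesis (p_sum1 : \sum_a p a = 1).

Variables (Psi tau : {fset (seq A)} -> R) (m b : R -> R) (q s : R).
Hypotheses (q1 : 1 < q) (s2 : 2 < s).
Hypothesis recPsi : forall (l : R) w, 0 < l -> ~ Z w ->
  Psi (T l w) = tau (T l w) + \sum_x Psi (U l x w).
Hypothesis recm : forall l, 0 < l -> m l = b l + \sum_x m (l * p x).
(** The first power serves small [l], the second large [l]. Both exponents exceed 1, so splitting
    [l] into the [l * p x] contracts each of them. *)
Let g l := l `^ q + l `^ (s / 2).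

Lemma moment_growth : exists2 k, 0 <= k < 1 &
  forall l, 0 < l -> \sum_x g (l * p x) <= k * g l.
Proof.
have s21 : 1 < s / 2 by rewrite ltr_pdivlMr ?mul1r.
have sq := sum_powR_lt1 hA p_gt0 p_sum1 q1.
have ss := sum_powR_lt1 hA p_gt0 p_sum1 s21.
exists (Num.max (\sum_a p a `^ q) (\sum_a p a `^ (s / 2))).
  rewrite le_max gt_max sq ss sumr_ge0//= => a _; exact: powR_ge0.
move=> l l0; rewrite /g.
under eq_bigr => x _ do rewrite !powRM ?(ltW l0) ?(ltW (p_gt0 x))//.
rewrite big_split/= -!mulr_sumr mulrDr lerD// mulrC ler_wpM2r ?powR_ge0//.
  by rewrite le_max lexx.
by rewrite le_max lexx orbT.
Qed.

Let g_gt0 l : 0 < l -> 0 < g l.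
Proof. by move=> l0; rewrite /g addr_gt0 ?powR_gt0. Qed.

Variables (K0 D1 D2 : R) (G : R -> R).
Hypothesis sqrPsi : forall l, 0 < l ->
  (\int[P]_w ((Psi (T l w) - m l) ^+ 2)%:E <= (K0 * g l)%:E)%E.
(** Distinct branches are independent, so the cross terms of [tpow_sum] factor into moments of order
    s / 2, bounded here by [G]. *)
Hypothesis halfPsi : forall l, 0 < l ->
  (\int[P]_w (`|Psi (T l w) - m l| `^ (s / 2))%:E <= (G l)%:E)%E.
Hypothesis G_homo : forall l l', 0 < l -> l <= l' -> G l <= G l'.
Hypothesis G_sqr : forall l, 0 < l -> G l ^+ 2 <= D1 * g l.
Hypothesis toll_s : forall l, 0 < l ->
  (\int[P]_w (`|tau (T l w) - b l| `^ s)%:E <= (D2 * g l)%:E)%E.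

Let a0 : A.
Proof. by move: hA; case: (pickP (@predT A)) => // h; rewrite eq_card0. Qed.

Let G_ge0 l : 0 < l -> 0 <= G l.
Proof.
move=> l0; rewrite -lee_fin; apply: le_trans (halfPsi l0).
by apply: integral_ge0 => w _; rewrite lee_fin powR_ge0.
Qed.

(* The constants do not depend on the truncation level [c], so the contraction
   bounds the truncated moments uniformly even though only their finiteness at
   each fixed level is known at first. *)
Lemma moment_contraction : exists t, 0 <= t < 1 /\ exists D, 0 <= D /\
  forall c K, 0 < c -> 0 <= K ->
  (forall l, 0 < l -> (\int[P]_w (tpow c s (Psi (T l w) - m l))%:E <= (K * g l)%:E)%E) ->
  forall l, 0 < l ->
    (\int[P]_w (tpow c s (Psi (T l w) - m l))%:E <= ((t * K + D) * g l)%:E)%E.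
Proof.
have [k /andP[k0 k1] gk] := moment_growth.
(* This makes (1 + e) k < 1: indeed 1 - (1 + e) k = (1 - k)(2 - k) / 2. *)
pose e := (1 - k) / 2.
have e0 : 0 < e by rewrite /e; lra.
have [C C0 HC] := tpow_sum a0 s2 e0.
exists ((1 + e) * k); split.
  rewrite mulr_ge0//=; last by rewrite /e; lra.
  rewrite /e; nra.
have D10 : 0 <= D1.
  have := le_trans (sqr_ge0 (G 1)) (G_sqr ltr01).
  by rewrite pmulr_lge0// g_gt0.
have D20 : 0 <= D2.
  rewrite -(pmulr_lge0 _ (g_gt0 ltr01)) -lee_fin.
  apply: le_trans (toll_s ltr01).
  by apply: integral_ge0 => w _; rewrite lee_fin powR_ge0.
pose n2 : R := \sum_(x : A) \sum_(y : A | y != x) 1.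
have n20 : 0 <= n2 by rewrite sumr_ge0// => x _; rewrite sumr_ge0.
exists (C * n2 * D1 + C * D2); split.
  by rewrite addr_ge0// ?mulr_ge0// ltW.
move=> c K c0 K0' IH l l0.
have lp x : 0 < l * p x by rewrite mulr_gt0.
pose Y x w := Psi (U l x w) - m (l * p x).
have mY x (h : R -> R) : measurable_fun setT (fun w => h (Y x w)).
  exact: (measurable_UR M l x (fun t => h (Psi t - m (l * p x)))).
have mtau (h : R -> R) : measurable_fun setT (fun w => h (tau (T l w) - b l)).
  exact: (measurable_TR M l (fun t => h (tau t - b l))).
pose F1 w := (\sum_x (tpow c s (Y x w))%:E)%E.
pose F2 w := (\sum_x \sum_(y <- [seq y <- index_enum A | y != x])
   ((`|Y x w| `^ (s / 2))%:E * (`|Y y w| `^ (s / 2))%:E))%E.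
pose F3 w := (`|tau (T l w) - b l| `^ s)%:E.
have mF1 : measurable_fun setT F1.
  by apply: emeasurable_sum => x; apply/measurable_EFinP; exact: mY.
have mF2' x y : measurable_fun setT
    (fun w => (`|Y x w| `^ (s / 2))%:E * (`|Y y w| `^ (s / 2))%:E)%E.
  by apply: emeasurable_funM; apply/measurable_EFinP;
    [exact: (mY x (fun r => `|r| `^ (s / 2)))|exact: (mY y (fun r => `|r| `^ (s / 2)))].
have mF2 : measurable_fun setT F2.
  by apply: emeasurable_sum => x; apply: emeasurable_sum => y; exact: mF2'.
have mF3 : measurable_fun setT F3.
  by apply/measurable_EFinP; exact: (mtau (fun r => `|r| `^ s)).
have F10 w : (0 <= F1 w)%E by apply: sume_ge0 => x _; rewrite lee_fin tpow_ge0.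
have F2'0 x y w : (0 <= (`|Y x w| `^ (s / 2))%:E * (`|Y y w| `^ (s / 2))%:E)%E.
  by rewrite mule_ge0// lee_fin powR_ge0.
have F20 w : (0 <= F2 w)%E by apply: sume_ge0 => x _; apply: sume_ge0 => y _.
have F30 w : (0 <= F3 w)%E by rewrite lee_fin powR_ge0.
have e10 : (0 <= (1 + e)%:E)%E by rewrite lee_fin; lra.
have C0' : (0 <= C%:E :> \bar R)%E by rewrite lee_fin ltW.
apply: (@le_trans _ _ (\int[P]_w ((1 + e)%:E * F1 w + C%:E * F2 w + C%:E * F3 w))%E).
  apply: ae_ge0_le_integral => //.
  - by move=> w _; rewrite lee_fin tpow_ge0.
  - exact: (measurable_T M l (fun t => (tpow c s (Psi t - m l))%:E)).
  - by move=> w _; rewrite !adde_ge0// mule_ge0.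
  - by do ![apply: emeasurable_funD|apply: emeasurable_funM].
  exists Z; split; [exact: (measurableZ M)|exact: (nullZ M)|].
  move=> w /= nle; apply: contrapT => nZw; apply: nle => _.
  have -> : Psi (T l w) - m l = \sum_x Y x w + (tau (T l w) - b l).
    by rewrite sumrB recPsi// recm//; ring.
  rewrite /F1 /F2 /F3 sumEFin.
  have -> : (\sum_x \sum_(y <- [seq y <- index_enum A | y != x])
     ((`|Y x w| `^ (s / 2))%:E * (`|Y y w| `^ (s / 2))%:E))%E =
    (\sum_x \sum_(y | y != x) (`|Y x w| `^ (s / 2) * `|Y y w| `^ (s / 2)))%:E.
    rewrite -sumEFin; apply: eq_bigr => x _; rewrite big_filter -sumEFin.
    by apply: eq_bigr.
  rewrite -!EFinM -!EFinD lee_fin; exact: HC.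
have mE (r : R) (f : Om -> \bar R) : measurable_fun setT f ->
    measurable_fun setT (fun w => r%:E * f w)%E.
  by move=> mf; apply: emeasurable_funM.
rewrite ge0_integralD//; first last.
- exact: mE.
- by move=> w _; rewrite mule_ge0.
- by apply: emeasurable_funD; exact: mE.
- by move=> w _; rewrite adde_ge0 ?mule_ge0.
rewrite ge0_integralD//; first last.
- exact: mE.
- by move=> w _; rewrite mule_ge0.
- exact: mE.
- by move=> w _; rewrite mule_ge0.
rewrite !ge0_integralZl//.
have B1 : (\int[P]_w F1 w <= (K * (k * g l))%:E)%E.
  rewrite /F1 ge0_integral_sum//; first last.
  - by move=> x w _; rewrite lee_fin tpow_ge0.
  - by move=> x; apply/measurable_EFinP; exact: mY.
  apply: (@le_trans _ _ (\sum_x (K * g (l * p x))%:E)%E).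
    apply: lee_sum => x _.
    rewrite (subtrie_integral M x (f := fun t => (tpow c s (Psi t - m (l * p x)))%:E))//.
      exact: IH.
    by move=> t; rewrite lee_fin tpow_ge0.
  by rewrite sumEFin lee_fin -mulr_sumr ler_wpM2l// gk.
have B2 : (\int[P]_w F2 w <= (n2 * (D1 * g l))%:E)%E.
  rewrite /F2 ge0_integral_sum//; first last.
  - by move=> x w _; apply: sume_ge0.
  - by move=> x; apply: emeasurable_sum => y; exact: mF2'.
  rewrite /n2 mulr_suml -sumEFin; apply: lee_sum => x _.
  rewrite ge0_integral_sum//.
  rewrite big_filter mulr_suml -sumEFin; apply: lee_sum => y yx.
  have habs : measurable_fun setT (fun r : R => (`|r| `^ (s / 2))%:E).
    by apply/measurable_EFinP; apply: (measurableT_comp (measurable_powR (s / 2))).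
  have ind : indep2 P (Y x) (Y y).
    apply: (indep2_subtrie M (fun t => Psi t - m (l * p x)) (fun t => Psi t - m (l * p y)) l0).
    by rewrite eq_sym.
  have habs0 (r : R) : (0 <= (`|r| `^ (s / 2))%:E)%E by rewrite lee_fin powR_ge0.
  rewrite [X in (X <= _)%E](indep_mul_ge0 (mY x id) (mY y id) ind habs habs habs0 habs0).
  have HH z : (\int[P]_w (`|Y z w| `^ (s / 2))%:E <= (G l)%:E)%E.
    rewrite (subtrie_integral M z (f := fun t => (`|Psi t - m (l * p z)| `^ (s / 2))%:E))//.
    apply: (le_trans (halfPsi (lp z))); rewrite lee_fin; apply: G_homo => //.
    by rewrite ler_piMr ?ltW// letter_prob_lt1.
  rewrite mul1r; apply: (@le_trans _ _ ((G l)%:E * (G l)%:E)%E).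
    by apply: lee_pmul; rewrite ?integral_ge0// => w _; rewrite lee_fin powR_ge0.
  by rewrite -EFinM lee_fin -expr2 G_sqr.
have B3 : (\int[P]_w F3 w <= (D2 * g l)%:E)%E by exact: toll_s.
apply: (@le_trans _ _ ((1 + e)%:E * (K * (k * g l))%:E + C%:E * (n2 * (D1 * g l))%:E +
   C%:E * (D2 * g l)%:E)%E).
  by rewrite !leeD// lee_wpmul2l.
rewrite -!EFinM -!EFinD lee_fin le_eqVlt; apply/orP; left; apply/eqP; ring.
Qed.

(** The second moment bounds the truncated moment with a constant depending on [c]. Iterating the
    map K -> t K + D forgets this start and approaches the fixed point [E], so 1 + E works for every
    [c]; monotone convergence then removes the truncation. *)
Lemma moment_bound : exists C, forall l, 0 < l ->
  (\int[P]_w (`|Psi (T l w) - m l| `^ s)%:E <= (C * g l)%:E)%E.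
Proof.
have [t [/andP[t0 t1] [D [D0 HD]]]] := moment_contraction.
have K00 : 0 <= K0.
  rewrite -(pmulr_lge0 _ (g_gt0 ltr01)) -lee_fin.
  apply: le_trans (sqrPsi ltr01).
  by apply: integral_ge0 => w _; rewrite lee_fin sqr_ge0.
have t10 : 0 < 1 - t by rewrite subr_gt0.
pose E := D / (1 - t); have E0 : 0 <= E by rewrite divr_ge0// ltW.
have tE : t * E + D = E by rewrite /E; field; rewrite gt_eqF.
have base c : 0 < c -> forall l, 0 < l ->
    (\int[P]_w (tpow c s (Psi (T l w) - m l))%:E <= (c `^ (s - 2) * K0 * g l)%:E)%E.
  move=> c0 l l0.
  apply: (@le_trans _ _ ((c `^ (s - 2))%:E * \int[P]_w ((Psi (T l w) - m l) ^+ 2)%:E)%E).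
    rewrite -ge0_integralZl//; last 3 first.
    - exact: (measurable_T M l (fun t => ((Psi t - m l) ^+ 2)%:E)).
    - by move=> w _; rewrite lee_fin sqr_ge0.
    - by rewrite lee_fin powR_ge0.
    apply: le_ge0_integral.
    - exact: (measurable_TR M l (fun t => tpow c s (Psi t - m l))).
    - exact: (measurable_TR M l (fun t => c `^ (s - 2) * (Psi t - m l) ^+ 2)).
    - by move=> w; exact: tpow_ge0.
    - by move=> w; apply: tpow_sqr => //; exact: ltW.
  rewrite -mulrA [leRHS]EFinM lee_wpmul2l ?sqrPsi//.
  by rewrite lee_fin powR_ge0.
have iter c n : 0 < c -> forall l, 0 < l ->
    (\int[P]_w (tpow c s (Psi (T l w) - m l))%:E <=
      ((t ^+ n * (c `^ (s - 2) * K0) + E) * g l)%:E)%E.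
  move=> c0; elim: n => [|n IH] l l0.
    rewrite expr0 mul1r; apply: le_trans (base c c0 l l0) _.
    by rewrite lee_fin ler_wpM2r ?(ltW (g_gt0 l0))// lerDl.
  have Kn : 0 <= t ^+ n * (c `^ (s - 2) * K0) + E.
    by rewrite addr_ge0// !mulr_ge0 ?exprn_ge0 ?powR_ge0.
  apply: (le_trans (HD c _ c0 Kn IH l l0)).
  by rewrite lee_fin ler_wpM2r ?(ltW (g_gt0 l0))// mulrDr -addrA tE exprS mulrA.
have unif c : 0 < c -> forall l, 0 < l ->
    (\int[P]_w (tpow c s (Psi (T l w) - m l))%:E <= ((1 + E) * g l)%:E)%E.
  move=> c0 l l0.
  have : (t ^+ n * (c `^ (s - 2) * K0)) @[n --> \oo] --> (0 * (c `^ (s - 2) * K0)).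
    by apply: cvgMl; apply: cvg_expr; rewrite ger0_norm.
  rewrite mul0r => /cvgr0_norm_lt/(_ 1 ltr01)[n _ /(_ n (leqnn _))] /=.
  rewrite ger0_norm ?mulr_ge0 ?exprn_ge0 ?powR_ge0// => /ltW tn.
  apply: (le_trans (iter c n c0 l l0)).
  by rewrite lee_fin ler_wpM2r ?(ltW (g_gt0 l0))// lerD2r.
exists (1 + E) => l l0.
pose h n w := (tpow n.+1%:R s (Psi (T l w) - m l))%:E.
have hlim w : h n w @[n --> \oo] --> (`|Psi (T l w) - m l| `^ s)%:E.
  apply: cvg_near_cst; near=> n; rewrite /h tpow_eq//.
  near: n; exists (Num.truncn `|Psi (T l w) - m l|) => // n /= tn.
  by rewrite (le_trans (ltW (truncnS_gt _)))// ler_nat ltnS.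
rewrite (_ : (\int[P]_w _)%E = (\int[P]_w limn (h^~ w))%E); last first.
  by apply: eq_integral => w _; apply/esym/cvg_lim.
rewrite monotone_convergence//; first last.
- move=> w _ i j ij; rewrite lee_fin /tpow ler_wpM2l ?sqr_ge0//.
  apply: powR_homo; first by rewrite subr_ge0 ltW.
    by rewrite le_min normr_ge0 ler0n.
  by rewrite le_min !ge_min lexx/= ler_nat ltnS ij orbT.
- by move=> n w _; rewrite lee_fin tpow_ge0.
- by move=> n; exact: (measurable_T M l (fun t => (tpow n.+1%:R s (Psi t - m l))%:E)).
apply: lime_le; last by near=> n; exact: unif.
apply: ereal_nondecreasing_is_cvgn => i j ij.
apply: le_ge0_integral.
- exact: (measurable_TR M l (fun t => tpow i.+1%:R s (Psi t - m l))).
- exact: (measurable_TR M l (fun t => tpow j.+1%:R s (Psi t - m l))).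
- by move=> w; exact: tpow_ge0.
- move=> w; rewrite /tpow ler_wpM2l ?sqr_ge0//.
  apply: powR_homo; first by rewrite subr_ge0 ltW.
    by rewrite le_min normr_ge0 ler0n.
  by rewrite le_min !ge_min lexx/= ler_nat ltnS ij orbT.
Unshelve. all: by end_near. Qed.

End MomentStep.

(** * Integrable and square integrable variables *)

Section L2.
Context d (Om : measurableType d) (R : realType) (P : probability Om R).
Implicit Types (X Y : Om -> R).

Definition L1 X := P.-integrable setT (EFin \o X).

Definition square_integrable X :=
  measurable_fun setT X /\ (\int[P]_w ((X w) ^+ 2)%:E < +oo)%E.

Lemma L1_le X Y : measurable_fun setT X -> L1 Y -> (forall w, `|X w| <= Y w) -> L1 X.
Proof.
move=> mX iY XY; apply: le_integrable iY => //; first exact/measurable_EFinP.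
by move=> w _ /=; rewrite lee_fin (le_trans (XY w))// ler_norm.
Qed.

Lemma L1_cst r : L1 (fun=> r).
Proof. exact: finite_measure_integrable_cst. Qed.

Lemma L1_bounded X c : measurable_fun setT X -> (forall w, `|X w| <= c) -> L1 X.
Proof. by move=> mX Xc; apply: L1_le (L1_cst c) Xc. Qed.

Lemma L1D X Y : L1 X -> L1 Y -> L1 (fun w => X w + Y w).
Proof.
move=> iX iY; have := integrableD measurableT iX iY.
by apply: eq_integrable => // w _; rewrite /= EFinD.
Qed.

Lemma L1Z r X : L1 X -> L1 (fun w => r * X w).
Proof.
move=> iX; have := integrableZl measurableT r iX.
by apply: eq_integrable => // w _; rewrite /= EFinM.
Qed.

Lemma L1B X Y : L1 X -> L1 Y -> L1 (fun w => X w - Y w).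
Proof.
move=> iX iY; have := L1D iX (L1Z (-1) iY).
by apply: eq_integrable => // w _ /=; rewrite mulN1r.
Qed.

Lemma L1_measurable X : L1 X -> measurable_fun setT X.
Proof. by move=> /integrableP[/measurable_EFinP]. Qed.

Lemma L1_abs X : L1 X -> L1 (fun w => `|X w|).
Proof.
move=> iX; apply: (@L1_le _ (fun w => `|X w|)) => [||w].
- by apply: measurableT_comp => //; exact: L1_measurable.
- by move: (integrable_abse iX); apply: eq_integrable.
- by rewrite normr_id.
Qed.

Lemma L1_ge0 X : measurable_fun setT X -> (forall w, 0 <= X w) ->
  (\int[P]_w (X w)%:E < +oo)%E -> L1 X.
Proof.
move=> mX X0 iX; apply/integrableP; split; first exact/measurable_EFinP.
by under eq_integral do rewrite /= ger0_norm//.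
Qed.

Lemma EFin_Rintegral X : L1 X -> (\int[P]_w X w)%:E = (\int[P]_w (X w)%:E)%E.
Proof. by move=> iX; rewrite /Rintegral fineK// integrable_fin_num. Qed.

Lemma Rintegral_prob r : \int[P]_(w in setT) (r : R) = r.
Proof. by rewrite Rintegral_cst//= probability_setT mulr1. Qed.

Lemma Rintegral_sum (I : Type) (s : seq I) (X : I -> Om -> R) :
  (forall i, L1 (X i)) ->
  L1 (fun w => \sum_(i <- s) X i w) /\
  \int[P]_w (\sum_(i <- s) X i w) = \sum_(i <- s) \int[P]_w X i w.
Proof.
move=> iX; elim: s => [|i s [IH1 IH2]].
  under eq_fun do rewrite big_nil.
  by rewrite big_nil Rintegral_prob; split => //; exact: L1_cst.
under eq_fun do rewrite big_cons.
split; first exact: L1D.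
by rewrite big_cons -IH2; apply: RintegralD => //; exact: iX.
Qed.

Lemma square_integrable_L1 X : square_integrable X -> L1 X.
Proof.
move=> [mX iX]; apply: (@L1_le _ (fun w => 1 + X w ^+ 2)) => // [|w].
  apply: L1D; first exact: L1_cst.
  by apply: L1_ge0 => //; [exact: measurable_funX|move=> w; exact: sqr_ge0].
have := sqr_ge0 (`|X w| - 1); rewrite sqrrB real_normK ?num_real// => h.
have := normr_ge0 (X w); lra.
Qed.

Lemma square_integrable_sqr X : square_integrable X -> L1 (fun w => X w ^+ 2).
Proof.
by move=> [mX iX]; apply: L1_ge0 => //; [exact: measurable_funX|move=> w; exact: sqr_ge0].
Qed.

Lemma square_integrableP X : measurable_fun setT X ->
  L1 (fun w => X w ^+ 2) -> square_integrable X.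
Proof.
move=> mX iX; split => //; move/integrableP : iX => [_].
by under eq_integral do rewrite /= ger0_norm ?sqr_ge0//.
Qed.

Lemma square_integrableM X Y : square_integrable X -> square_integrable Y ->
  L1 (fun w => X w * Y w).
Proof.
move=> sX sY; have [mX _] := sX; have [mY _] := sY.
apply: (@L1_le _ (fun w => X w ^+ 2 + Y w ^+ 2)) => [||w].
- exact: measurable_funM.
- by apply: L1D; exact: square_integrable_sqr.
have := sqr_ge0 (X w - Y w); have := sqr_ge0 (X w + Y w).
rewrite sqrrB sqrrD => h1 h2; rewrite ler_norml; apply/andP; split; nra.
Qed.

Lemma square_integrableD X Y : square_integrable X -> square_integrable Y ->
  square_integrable (fun w => X w + Y w).
Proof.
move=> sX sY; have [mX _] := sX; have [mY _] := sY.
apply: square_integrableP; first exact: measurable_funD.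
have := L1D (L1D (square_integrable_sqr sX) (square_integrable_sqr sY))
  (L1Z 2 (square_integrableM sX sY)).
by apply: eq_integrable => // w _ /=; congr EFin; ring.
Qed.

Lemma square_integrableZ r X : square_integrable X ->
  square_integrable (fun w => r * X w).
Proof.
move=> sX; have [mX _] := sX.
apply: square_integrableP; first exact: measurable_funM.
have := L1Z (r ^+ 2) (square_integrable_sqr sX).
by apply: eq_integrable => // w _ /=; congr EFin; ring.
Qed.

Lemma square_integrable_cst r : square_integrable (fun=> r).
Proof. by apply: square_integrableP => //; exact: L1_cst. Qed.

Lemma square_integrableB X Y : square_integrable X -> square_integrable Y ->
  square_integrable (fun w => X w - Y w).
Proof.
move=> sX sY; have [mX _] := sX; have [mY _] := sY.
have := square_integrableD sX (square_integrableZ (-1) sY).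
by congr square_integrable; apply/funext => w; ring.
Qed.

Lemma square_integrable_sum (I : Type) (s : seq I) (X : I -> Om -> R) :
  (forall i, square_integrable (X i)) ->
  square_integrable (fun w => \sum_(i <- s) X i w).
Proof.
move=> sX; elim: s => [|i s IH].
  by under eq_fun do rewrite big_nil; exact: square_integrable_cst.
under eq_fun do rewrite big_cons; exact: square_integrableD.
Qed.

Lemma square_integrable_center X r : measurable_fun setT X ->
  (\int[P]_w ((X w - r) ^+ 2)%:E < +oo)%E -> square_integrable X.
Proof.
move=> mX iX; have sX : square_integrable (fun w => X w - r).
  by split => //; exact: measurable_funB.
have := square_integrableD sX (square_integrable_cst r).
by congr square_integrable; apply/funext => w; rewrite subrK.
Qed.

Lemma ge0_integral_affine (a b : R) X : 0 <= a -> 0 <= b ->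
  measurable_fun setT X -> (forall w, 0 <= X w) ->
  (\int[P]_w (a + b * X w)%:E = a%:E + b%:E * \int[P]_w (X w)%:E)%E.
Proof.
move=> a0 b0 mX X0.
have mXE : measurable_fun setT (fun w => (X w)%:E) by exact/measurable_EFinP.
under eq_integral do rewrite EFinD EFinM.
rewrite ge0_integralD//; last 2 first.
- by move=> w _; rewrite mule_ge0// lee_fin.
- by apply: emeasurable_funM.
rewrite integral_cst//= probability_setT mule1 ge0_integralZl//.
by move=> w _; rewrite lee_fin.
Qed.

Lemma variance_le_sqr X : square_integrable X ->
  \int[P]_w ((X w - \int[P]_w' X w') ^+ 2) <= \int[P]_w (X w ^+ 2).
Proof.
move=> sX; set m := \int[P]_w' X w'.
have i1 := square_integrable_L1 sX; have i2 := square_integrable_sqr sX.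
have -> : \int[P]_w ((X w - m) ^+ 2) = \int[P]_w (X w ^+ 2 + (- (2 * m) * X w + m ^+ 2)).
  by apply: eq_Rintegral => w _; ring.
rewrite RintegralD//; last by apply: L1D; [exact: L1Z|exact: L1_cst].
rewrite RintegralD//; [|exact: L1Z|exact: L1_cst].
rewrite RintegralZl// Rintegral_prob -/m.
have := sqr_ge0 m; lra.
Qed.

Lemma fine_expectation X : fine 'E_P[X] = \int[P]_w X w.
Proof. by rewrite unlock. Qed.

Lemma varianceRE X : 'V_P[X] =
  (\int[P]_w ((X w - \int[P]_w' X w') ^+ 2)%:E)%E.
Proof.
rewrite /variance unlock [in LHS]unlock.
by apply: eq_integral => w _; rewrite expr2.
Qed.

End L2.

(** * Growth rates in the intensity *)

Section Growth.
Variable R : realType.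
Implicit Types (x y s r l C : R).

(** The first term suffices for x <= y, the second for x > y. With [y] the square root of the
    intensity, lower moments follow from higher ones at the correct scale. *)
Lemma powR_interpolation x y s r : 0 <= x -> 0 < y -> 0 <= s -> s <= r ->
  x `^ s <= y `^ s + y `^ (s - r) * x `^ r.
Proof.
move=> x0 y0 s0 sr; have [xy|yx] := leP x y.
  apply: (@le_trans _ _ (y `^ s)); first exact: powR_homo.
  by rewrite lerDl mulr_ge0 ?powR_ge0.
apply: (@le_trans _ _ (y `^ (s - r) * x `^ r)); last by rewrite lerDr powR_ge0.
have [z z1 ->] : exists2 z, 1 <= z & x = y * z.
  exists (x / y); first by rewrite ler_pdivlMr ?mul1r// ltW.
  by rewrite mulrC divfK// gt_eqF.
have z0 : 0 <= z by exact: le_trans z1.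
rewrite !powRM ?(ltW y0)// mulrA -powRD; last by rewrite (gt_eqF y0) implybT.
by rewrite subrK ler_wpM2l ?powR_ge0//; exact: ler_powR.
Qed.

Lemma powRD_le x y s : 0 <= s ->
  `|x + y| `^ s <= 2 `^ s * (`|x| `^ s + `|y| `^ s).
Proof.
move=> s0; wlog xy : x y / `|y| <= `|x|.
  move=> H; have [/H//|/ltW yx] := leP `|y| `|x|.
  by have := H y x yx; rewrite [y + x]addrC [(`|y| `^ s + _)%R]addrC.
apply: (@le_trans _ _ ((2 * `|x|) `^ s)).
  apply: powR_homo => //; rewrite (le_trans (ler_normD _ _))//; lra.
by rewrite powRM// ler_wpM2l ?powR_ge0// lerDl powR_ge0.
Qed.

(** Near 0, a functional that vanishes on at most one string is controlled by the presence of two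
    strings, which has probability of order l^2. *)
Definition growth s l : R := if l <= 1 then l ^+ 2 else l `^ (s / 2).

Lemma growth_bound s (I : R -> \bar R) C l0 C' : 0 <= s -> 1 <= l0 -> 0 <= C' ->
  (forall l, l0 <= l -> (I l <= (C * l `^ (s / 2))%:E)%E) ->
  (forall l, 0 < l -> l <= l0 -> (I l <= (C' * l ^+ 2)%:E)%E) ->
  exists2 D, 0 <= D & forall l, 0 < l -> (I l <= (D * growth s l)%:E)%E.
Proof.
move=> s0 l01 C'0 large small; exists (`|C| + C' * l0 ^+ 2).
  by rewrite addr_ge0// mulr_ge0// sqr_ge0.
move=> l lgt0; rewrite /growth; case: (leP l 1) => l1.
  apply: le_trans (small l lgt0 (le_trans l1 l01)) _.
  rewrite lee_fin ler_wpM2r ?sqr_ge0//; apply: (@le_trans _ _ (C' * l0 ^+ 2)).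
    by rewrite ler_peMr// expr_ge1// (le_trans ler01).
  by rewrite lerDr.
have lp : 1 <= l `^ (s / 2).
  by rewrite -[leLHS](powRr0 l); apply: ler_powR; [exact: ltW|exact: divr_ge0].
have [ll0|l0l] := leP l l0.
  apply: (le_trans (small l lgt0 ll0)); rewrite lee_fin.
  apply: (@le_trans _ _ (C' * l0 ^+ 2)).
    by rewrite ler_wpM2l// lerXn2r// nnegrE ltW// (lt_le_trans ltr01).
  rewrite -[leLHS]mulr1; apply: ler_pM => //; first by rewrite mulr_ge0 ?sqr_ge0.
  by rewrite lerDr.
apply: (le_trans (large l (ltW l0l))); rewrite lee_fin ler_wpM2r ?powR_ge0//.
by rewrite (le_trans (ler_norm C))// lerDl mulr_ge0// sqr_ge0.
Qed.

Lemma growth_le s q l : 0 < l -> 1 < q -> q <= 2 -> 2 <= s ->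
  growth s l <= l `^ q + l `^ (s / 2).
Proof.
move=> l0 q1 q2 s2; rewrite /growth; case: (leP l 1) => l1; last first.
  by rewrite lerDr powR_ge0.
apply: (@le_trans _ _ (l `^ q)); last by rewrite lerDl powR_ge0.
by rewrite -powR_mulrn ?(ltW l0)//; apply: ger_powR => //; rewrite l0.
Qed.

Lemma growth_homo s s' l : 0 < l -> s <= s' -> growth s l <= growth s' l.
Proof.
move=> l0 ss; rewrite /growth; case: (leP l 1) => // l1.
by apply: ler_powR; [exact: ltW|rewrite ler_pM2r].
Qed.

Lemma growth2_le l : 0 < l -> growth 2 l <= l.
Proof.
move=> l0; rewrite /growth; case: (leP l 1) => l1.
  by rewrite expr2 ler_piMl// ltW.
by rewrite divff ?powRr1// ltW.
Qed.

(** Halving stops in the interval (2, 4]. There s / 2 <= 2, so the half moment comes from the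
    variance, and each later exponent has its predecessor as half moment. *)
Lemma halving r : 2 < r -> exists k s, [/\ 2 < s, s <= 4 & r = s * 2 ^+ k].
Proof.
move=> r2; have [n rn] : exists n, r <= 4 * 2 ^+ n.
  exists (Num.truncn r).+1.
  apply: (@le_trans _ _ (2 ^+ (Num.truncn r).+1)).
    apply: (le_trans (ltW (truncnS_gt r))).
    by rewrite -natrX ler_nat ltnW// ltn_expl.
  by rewrite ler_peMl// ?exprn_ge0//; lra.
elim: n r r2 rn => [|n IH] r r2 rn.
  by exists 0%N, r; split => //; [lra|rewrite mulr1].
have [r4|r4] := leP r 4; first by exists 0%N, r; split => //; rewrite mulr1.
have [||k [s [s2 s4 rs]]] := IH (r / 2).
- lra.
- by rewrite ler_pdivrMr// -mulrA -exprSr.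
by exists k.+1, s; split => //; rewrite exprSr mulrA -rs divfK.
Qed.

End Growth.

(** * Moments of functionals that vanish on at most one string *)

Section MomentTheorem.
Context d (Om : measurableType d) (R : realType) (P : probability Om R).
Context (A : finType) (p : A -> R).
Variables (T : R -> Om -> {fset (seq A)}) (U : R -> A -> Om -> {fset (seq A)}).
Variable (Z : set Om).
Hypothesis M : trie_recursion P p T U Z.
Hypotheses (hA : (2 <= #|A|)%N) (p_gt0 : forall a, 0 < p a).
Hypothesis (p_sum1 : \sum_a p a = 1).

Definition trie_mean (F : {fset (seq A)} -> R) (l : R) : R := \int[P]_w F (T l w).
Local Notation mean := trie_mean.

Lemma L1_subtrie (F : {fset (seq A)} -> R) l x : 0 < l ->
  L1 P (fun w => F (T (l * p x) w)) ->
  L1 P (fun w => F (U l x w)) /\ \int[P]_w F (U l x w) = mean F (l * p x).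
Proof.
move=> l0 iF.
have abs0 (h : R -> R) : (forall r, 0 <= h r) ->
    (\int[P]_w (h (F (U l x w)))%:E = \int[P]_w (h (F (T (l * p x) w)))%:E)%E.
  move=> h0; apply: (subtrie_integral M x (f := fun t => (h (F t))%:E)) => // t.
  by rewrite lee_fin.
have iU : L1 P (fun w => F (U l x w)).
  apply/integrableP; split.
    by apply/measurable_EFinP; exact: (measurable_UR M l x F).
  rewrite /= (abs0 (fun r => `|r|) (@normr_ge0 _ _)).
  by move/integrableP : iF => [].
split => //; rewrite /mean.
(* The transfer is available for nonnegative functions, so a signed one is written as the difference
   of |f| + f and |f|. *)
have dec (f : Om -> R) : L1 P f -> \int[P]_w f w =
    \int[P]_w (`|f w| + f w) - \int[P]_w `|f w|.
  move=> if_; rewrite RintegralD//; last exact: L1_abs.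
  by rewrite addrAC subrr add0r.
rewrite (dec _ iU) (dec _ iF) /Rintegral.
have h0 (r : R) : 0 <= `|r| + r by have := ler_norm (- r); rewrite normrN; lra.
by rewrite (abs0 (fun r => `|r| + r) h0) (abs0 (fun r => `|r|) (@normr_ge0 _ _)).
Qed.

Lemma small_moment (F : {fset (seq A)} -> R) s l0 : 0 < l0 -> 0 < s ->
  (forall t, (weight t < 2)%N -> F t = 0) ->
  (\int[P]_w (`|F (T l0 w)| `^ s)%:E < +oo)%E ->
  exists2 C, 0 <= C & forall l, 0 < l -> l <= l0 ->
    (\int[P]_w (`|F (T l w)| `^ s)%:E <= (C * l ^+ 2)%:E)%E.
Proof.
move=> l00 s0 F0 fin; set I := (\int[P]_w _)%E in fin.
have I0 : (0 <= I)%E by apply: integral_ge0 => w _; rewrite lee_fin powR_ge0.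
exists (l0 ^- 2 * expR l0 * fine I).
  by rewrite !mulr_ge0 ?expR_ge0 ?fine_ge0// invr_ge0 exprn_ge0// ltW.
move=> l lgt0 ll0.
have := dom_integral M (k := 2) (f := fun t => (`|F t| `^ s)%:E) lgt0 ll0.
have f0 t : (0 <= (`|F t| `^ s)%:E)%E by rewrite lee_fin powR_ge0.
have fk t : (weight t < 2)%N -> (`|F t| `^ s)%:E = 0%E.
  by move=> t2; rewrite F0// normr0 powR0// gt_eqF.
move=> /(_ f0 fk) h; apply: (le_trans h).
rewrite -/I -[in leLHS](fineK (x := I)) ?ge0_fin_numE//.
rewrite -EFinM lee_fin le_eqVlt; apply/orP; left; apply/eqP.
by rewrite exprMn exprVn; ring.
Qed.

End MomentTheorem.

Section MomentTheorem.
Context d (Om : measurableType d) (R : realType) (P : probability Om R).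
Context (A : finType) (p : A -> R).
Variables (T : R -> Om -> {fset (seq A)}) (U : R -> A -> Om -> {fset (seq A)}).
Variable (Z : set Om).
Hypothesis M : trie_recursion P p T U Z.
Hypotheses (hA : (2 <= #|A|)%N) (p_gt0 : forall a, 0 < p a).
Hypothesis (p_sum1 : \sum_a p a = 1).
Local Notation mean := (trie_mean P T).

Section MeanRec.
Variables (Psi tau : {fset (seq A)} -> R).
Hypothesis recPsi : forall (l : R) w, ~ Z w ->
  Psi (T l w) = tau (T l w) + \sum_x Psi (U l x w).
Hypothesis sqPsi : forall l, 0 < l -> square_integrable P (fun w => Psi (T l w)).
Hypothesis sqtau : forall l, 0 < l -> square_integrable P (fun w => tau (T l w)).

Lemma mean_rec l : 0 < l -> mean Psi l = mean tau l + \sum_x mean Psi (l * p x).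
Proof.
move=> l0.
have iU x : L1 P (fun w => Psi (U l x w)) /\ \int[P]_w Psi (U l x w) = mean Psi (l * p x).
  by apply: (L1_subtrie M) => //; apply/square_integrable_L1/sqPsi; rewrite mulr_gt0.
have [iS eS] := Rintegral_sum (index_enum A) (fun x => (iU x).1).
have it := square_integrable_L1 (sqtau l0).
transitivity (\int[P]_w (tau (T l w) + \sum_x Psi (U l x w))).
  rewrite /trie_mean /Rintegral; congr fine; apply: ae_eq_integral => //.
  - exact: (measurable_T M l (fun t => (Psi t)%:E)).
  - by apply/measurable_EFinP; apply: measurable_funD; [exact: L1_measurable it|exact: L1_measurable iS].
  exists Z; split; [exact: measurableZ M|exact: nullZ M|].
  move=> w /= nE; apply: contrapT => nZ; apply: nE => _.
  by rewrite recPsi.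
rewrite RintegralD// eS; congr (_ + _).
by apply: eq_bigr => x _; exact: (iU x).2.
Qed.
End MeanRec.

Lemma integral_sqr_powR (F : Om -> R) :
  (\int[P]_w (`|F w| `^ 2)%:E = \int[P]_w (F w ^+ 2)%:E)%E.
Proof.
by apply: eq_integral => w _; rewrite powR_mulrn// real_normK// num_real.
Qed.

Section Killed.
Variable (F : {fset (seq A)} -> R).
Hypothesis killF : forall t, (weight t < 2)%N -> F t = 0.
Hypothesis sqF : forall l, 0 < l -> square_integrable P (fun w => F (T l w)).

(** For large [l] this is the assumption. For small [l] the variance is at most the second moment,
    which is of order l^2 because [F] vanishes on at most one string. *)
Lemma centered_square_growth C l0 :
  (forall l, l0 <= l ->
     (\int[P]_w ((F (T l w) - mean F l) ^+ 2)%:E <= (C * l)%:E)%E) ->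
  exists2 D, 0 <= D & forall l, 0 < l ->
    (\int[P]_w ((F (T l w) - mean F l) ^+ 2)%:E <= (D * growth 2 l)%:E)%E.
Proof.
move=> large; pose l1 := Num.max 1 l0.
have l11 : 1 <= l1 by rewrite le_max lexx.
have l10 : 0 < l1 by exact: lt_le_trans l11.
have fin2 : (\int[P]_w (`|F (T l1 w)| `^ 2)%:E < +oo)%E.
  by rewrite integral_sqr_powR; exact: (sqF l10).2.
have [C' C'0 small] := small_moment M l10 (ltr0n _ 2) killF fin2.
apply: (@growth_bound _ _ _ C l1 C') => // [l l1l|l lgt0 ll1].
  rewrite divff// powRr1; last by rewrite (le_trans _ l1l)// ltW.
  by apply: large; rewrite (le_trans _ l1l)// le_max lexx orbT.
apply: le_trans (small l lgt0 ll1); rewrite integral_sqr_powR.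
have sq := sqF lgt0.
have sqc : square_integrable P (fun w => F (T l w) - mean F l).
  by apply: square_integrableB => //; exact: square_integrable_cst.
rewrite -!EFin_Rintegral ?lee_fin; first exact: variance_le_sqr.
  exact: square_integrable_sqr.
exact: square_integrable_sqr.
Qed.

(** Above a threshold, interpolation at sqrt l deduces order [s] from order [r]. Below it, both
    E|F|^s and |E F| are of order l^2, and so is |E F|^s since s > 1. *)
Lemma centered_power_growth r C l0 : 2 < r ->
  (forall l, l0 <= l ->
     (\int[P]_w (`|F (T l w) - mean F l| `^ r)%:E <= (C * l `^ (r / 2))%:E)%E) ->
  forall s, 2 <= s -> s <= r ->
  exists2 D, 0 <= D & forall l, 0 < l ->
    (\int[P]_w (`|F (T l w) - mean F l| `^ s)%:E <= (D * growth s l)%:E)%E.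
Proof.
move=> r2 large s s2 sr; pose l1 := Num.max 1 l0.
have s0 : 0 < s by exact: lt_le_trans s2.
have l11 : 1 <= l1 by rewrite le_max lexx.
have l10 : 0 < l1 by exact: lt_le_trans l11.
have mF l (h : R -> R) : measurable_fun setT (fun w => h (F (T l w))).
  exact: (measurable_TR M l (fun t => h (F t))).
have big l : l1 <= l -> (\int[P]_w (`|F (T l w) - mean F l| `^ s)%:E <=
    ((1 + C) * l `^ (s / 2))%:E)%E.
  move=> l1l; have lgt0 : 0 < l by exact: lt_le_trans l1l.
  have lr : l0 <= l by rewrite (le_trans _ l1l)// le_max lexx orbT.
  pose y := l `^ 2^-1; have y0 : 0 < y by exact: powR_gt0.
  have ys u : y `^ u = l `^ (u / 2) by rewrite /y -powRrM mulrC.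
  apply: (@le_trans _ _ (\int[P]_w (y `^ s + y `^ (s - r) * `|F (T l w) - mean F l| `^ r)%:E)%E).
    apply: le_ge0_integral.
    - exact: (mF l (fun u => `|u - mean F l| `^ s)).
    - exact: (mF l (fun u => y `^ s + y `^ (s - r) * `|u - mean F l| `^ r)).
    - by move=> w; exact: powR_ge0.
    - by move=> w; apply: powR_interpolation => //; exact: ltW.
  rewrite ge0_integral_affine ?powR_ge0//; last first.
    exact: (mF l (fun u => `|u - mean F l| `^ r)).
  apply: (@le_trans _ _ ((y `^ s)%:E + (y `^ (s - r))%:E * (C * l `^ (r / 2))%:E)%E).
    rewrite leeD2l// lee_wpmul2l ?lee_fin ?powR_ge0//; exact: large.
  rewrite -EFinM -EFinD lee_fin le_eqVlt; apply/orP; left; apply/eqP.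
  rewrite !ys mulrCA -powRD; last by rewrite (gt_eqF lgt0) implybT.
  by rewrite (_ : (s - r) / 2 + r / 2 = s / 2); [ring|field].
have fins : (\int[P]_w (`|F (T l1 w)| `^ s)%:E < +oo)%E.
  apply: (@le_lt_trans _ _ (\int[P]_w (2 `^ s * `|mean F l1| `^ s + 2 `^ s * `|F (T l1 w) - mean F l1| `^ s)%:E)%E).
    apply: le_ge0_integral.
    - exact: (mF l1 (fun u => `|u| `^ s)).
    - exact: (mF l1 (fun u => 2 `^ s * `|mean F l1| `^ s + 2 `^ s * `|u - mean F l1| `^ s)).
    - by move=> w; exact: powR_ge0.
    - by move=> w; have := powRD_le (F (T l1 w) - mean F l1) (mean F l1) (ltW s0); rewrite subrK -mulrDr [X in _ -> _ <= _ * X]addrC.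
  rewrite ge0_integral_affine ?mulr_ge0 ?powR_ge0//; last first.
    exact: (mF l1 (fun u => `|u - mean F l1| `^ s)).
  have I0 : (0 <= \int[P]_w (`|F (T l1 w) - mean F l1| `^ s)%:E)%E.
    by apply: integral_ge0 => w _; rewrite lee_fin powR_ge0.
  have Ioo := le_lt_trans (big l1 (lexx _)) (ltry _).
  rewrite lte_add_pinfty ?ltry// lte_mul_pinfty ?lee_fin ?powR_ge0//.
have [C1 C10 small] := small_moment M l10 s0 killF fins.
have fin1 : (\int[P]_w (`|F (T l1 w)| `^ 1)%:E < +oo)%E.
  have := L1_abs (square_integrable_L1 (sqF l10)) => /integrableP[_].
  by congr (_ < _)%E; apply: eq_integral => w _ /=; rewrite powRr1// normr_id.
have [C2 C20 small1] := small_moment M l10 ltr01 killF fin1.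
(* From |F - m|^s <= 2^s (|F|^s + |m|^s) and |m|^s <= (C2 l1^2)^(s - 1) |m|, with |m| <= C2 l^2. *)
pose C' := 2 `^ s * (C1 + (C2 * l1 ^+ 2) `^ (s - 1) * C2).
apply: (@growth_bound _ _ _ (1 + C) l1 C') => // [||l lgt0 ll1].
- exact: ltW.
- by rewrite mulr_ge0 ?powR_ge0// addr_ge0// mulr_ge0 ?powR_ge0.
have mb : `|mean F l| <= C2 * l ^+ 2.
  have iF := square_integrable_L1 (sqF lgt0).
  apply: (le_trans (le_normr_Rintegral _ _)) => //.
  rewrite -lee_fin EFin_Rintegral; last exact: L1_abs.
  apply: le_trans (small1 l lgt0 ll1).
  by rewrite le_eqVlt; apply/orP; left; apply/eqP; apply: eq_integral => w _; rewrite powRr1.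
have mbs : `|mean F l| `^ s <= (C2 * l1 ^+ 2) `^ (s - 1) * C2 * l ^+ 2.
  rewrite -mulr_powRB1// mulrC -mulrA; apply: ler_pM; rewrite ?powR_ge0//.
  apply: powR_homo => //; first lra.
  rewrite (le_trans mb)// ler_wpM2l// lerXn2r// nnegrE ltW//.
apply: (@le_trans _ _ (\int[P]_w (2 `^ s * `|mean F l| `^ s + 2 `^ s * `|F (T l w)| `^ s)%:E)%E).
  apply: le_ge0_integral.
  - exact: (mF l (fun u => `|u - mean F l| `^ s)).
  - exact: (mF l (fun u => 2 `^ s * `|mean F l| `^ s + 2 `^ s * `|u| `^ s)).
  - by move=> w; exact: powR_ge0.
  - by move=> w; have := powRD_le (F (T l w)) (- mean F l) (ltW s0); rewrite normrN -mulrDr [X in _ -> _ <= _ * X]addrC.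
rewrite ge0_integral_affine ?mulr_ge0 ?powR_ge0//; last first.
  exact: (mF l (fun u => `|u| `^ s)).
apply: (@le_trans _ _ ((2 `^ s * ((C2 * l1 ^+ 2) `^ (s - 1) * C2 * l ^+ 2))%:E + (2 `^ s)%:E * (C1 * l ^+ 2)%:E)%E).
  rewrite leeD ?lee_fin ?ler_wpM2l ?powR_ge0// lee_wpmul2l ?lee_fin ?powR_ge0//.
  exact: small.
by rewrite -EFinM -EFinD lee_fin /C' le_eqVlt; apply/orP; left; apply/eqP; ring.
Qed.

End Killed.

Section Chain.
Variables (Psi tau : {fset (seq A)} -> R).
Hypothesis recPsi : forall (l : R) w, ~ Z w ->
  Psi (T l w) = tau (T l w) + \sum_x Psi (U l x w).
Hypothesis killPsi : forall t, (weight t < 2)%N -> Psi t = 0.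
Hypothesis killtau : forall t, (weight t < 2)%N -> tau t = 0.
Hypothesis sqPsi : forall l, 0 < l -> square_integrable P (fun w => Psi (T l w)).
Hypothesis sqtau : forall l, 0 < l -> square_integrable P (fun w => tau (T l w)).
Variables (r C1 C2 l1 l2 : R).
Hypothesis r2 : 2 < r.
Hypothesis varPsi : forall l, l1 <= l ->
  (\int[P]_w ((Psi (T l w) - mean Psi l) ^+ 2)%:E <= (C1 * l)%:E)%E.
Hypothesis powtau : forall l, l2 <= l ->
  (\int[P]_w (`|tau (T l w) - mean tau l| `^ r)%:E <= (C2 * l `^ (r / 2))%:E)%E.

(** Induction doubles the exponent: the bound for s 2^k is the half moment needed for s 2^(k+1), and
    at the start s / 2 <= 2 makes the variance sufficient. The exponent for small intensities stays
    q = s / 2 <= 2 throughout, because the bounds near 0 never improve on l^2. *)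
Lemma chain q k s : 2 < s -> s <= 4 -> q = s / 2 -> s * 2 ^+ k <= r ->
  exists C, forall l, 0 < l ->
  (\int[P]_w (`|Psi (T l w) - mean Psi l| `^ (s * 2 ^+ k))%:E <=
    (C * (l `^ q + l `^ (s * 2 ^+ k / 2)))%:E)%E.
Proof.
move=> s2 s4 qE.
have q1 : 1 < q by rewrite qE; lra.
have q2 : q <= 2 by rewrite qE; lra.
have [V V0 HV] := centered_square_growth killPsi sqPsi varPsi.
have mP l (h : R -> R) : measurable_fun setT (fun w => h (Psi (T l w))).
  exact: (measurable_TR M l (fun t => h (Psi t))).
elim: k => [|k IH] kr.
  have sr : s <= r by move: kr; rewrite mulr1.
  rewrite mulr1.
  have [D D0 HD] := centered_power_growth killtau sqtau r2 powtau (ltW s2) sr.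
  apply: (@moment_bound _ _ _ _ _ _ _ _ _ M hA p_gt0 p_sum1 Psi tau (mean Psi)
    (mean tau) q s q1 s2 _ _ V ((1 + V) ^+ 2) D (fun l => (1 + V) * l `^ (s / 4))).
  - by move=> l w _; exact: recPsi.
  - exact: mean_rec.
  - move=> l l0; apply: (le_trans (HV l l0)); rewrite lee_fin ler_wpM2l//.
    by apply: (le_trans (growth_homo l0 (ltW s2))); apply: growth_le => //; exact: ltW.
  - move=> l l0.
    (* Interpolation at y = sqrt l turns the variance bound V l into (1 + V) l^(s/4) for the order s
       / 2. *)
    pose y := l `^ 2^-1; have y0 : 0 < y by exact: powR_gt0.
    have ys u : y `^ u = l `^ (u / 2) by rewrite /y -powRrM mulrC.
    apply: (@le_trans _ _ (\int[P]_w (y `^ (s / 2) + y `^ (s / 2 - 2) * (Psi (T l w) - mean Psi l) ^+ 2)%:E)%E).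
      apply: le_ge0_integral.
      + exact: (mP l (fun u => `|u - mean Psi l| `^ (s / 2))).
      + exact: (mP l (fun u => y `^ (s / 2) + y `^ (s / 2 - 2) * (u - mean Psi l) ^+ 2)).
      + by move=> w; exact: powR_ge0.
      + move=> w.
        rewrite -[_ ^+ 2](real_normK (num_real _)) -powR_mulrn//.
        by apply: powR_interpolation => //; lra.
    rewrite ge0_integral_affine ?powR_ge0//; last 2 first.
    + exact: (mP l (fun u => (u - mean Psi l) ^+ 2)).
    + by move=> w; exact: sqr_ge0.
    apply: (@le_trans _ _ ((y `^ (s / 2))%:E + (y `^ (s / 2 - 2))%:E * (V * l)%:E)%E).
      rewrite leeD2l// lee_wpmul2l ?lee_fin ?powR_ge0//; apply: (le_trans (HV l l0)).
      by rewrite lee_fin ler_wpM2l// growth2_le.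
    rewrite -EFinM -EFinD lee_fin le_eqVlt; apply/orP; left; apply/eqP.
    rewrite !ys mulrCA -{3}(powRr1 (ltW l0)) -powRD; last by rewrite (gt_eqF l0) implybT.
    rewrite (_ : (s / 2 - 2) / 2 + 1 = s / 4); last by field.
    by rewrite (_ : s / 2 / 2 = s / 4); [ring|field].
  - move=> l l' l0 ll'; rewrite ler_wpM2l ?addr_ge0//.
    by apply: powR_homo => //; [lra|exact: ltW].
  - move=> l l0; rewrite exprMn ler_wpM2l ?sqr_ge0//.
    rewrite -powR_mulrn ?powR_ge0// -powRrM (_ : s / 4 * 2%:R = s / 2); last by field.
    by rewrite lerDr powR_ge0.
  - move=> l l0; apply: (le_trans (HD l l0)); rewrite lee_fin ler_wpM2l//.
    by apply: growth_le => //; exact: ltW.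
have s'0 : s <= s * 2 ^+ k.
  rewrite ler_peMr//; first by lra.
  by rewrite -natrX ler1n expn_gt0.
have kr' : s * 2 ^+ k <= r.
  by apply: le_trans kr; rewrite exprS; nra.
have [C HC] := IH kr'.
set s' := s * 2 ^+ k in s'0 kr' HC *.
have ss' : s * 2 ^+ k.+1 = s' * 2 by rewrite /s' exprSr mulrA.
rewrite ss'; rewrite ss' in kr.
have s's2 : s' * 2 / 2 = s' by rewrite mulfK.
have s'2 : 2 < s' * 2 by lra.
have [D D0 HD] := centered_power_growth killtau sqtau r2 powtau (ltW s'2) kr.
have C0 : 0 <= C.
  have := le_trans _ (HC 1 ltr01); rewrite !powR1 => /(_ 0%E); rewrite lee_fin => H.
  suff : 0 <= C * (1 + 1) by lra.
  by apply: H; apply: integral_ge0 => w _; rewrite lee_fin powR_ge0.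
apply: (@moment_bound _ _ _ _ _ _ _ _ _ M hA p_gt0 p_sum1 Psi tau (mean Psi)
  (mean tau) q (s' * 2) q1 s'2 _ _ V (C ^+ 2 * 4) D (fun l => C * (l `^ q + l `^ (s' / 2)))).
- by move=> l w _; exact: recPsi.
- exact: mean_rec.
- move=> l l0; apply: (le_trans (HV l l0)); rewrite lee_fin ler_wpM2l//.
  by apply: (le_trans (growth_homo l0 (ltW s'2))); apply: growth_le => //; exact: ltW.
- by move=> l l0; rewrite s's2; exact: HC.
- move=> l l' l0 ll'; rewrite ler_wpM2l// lerD//; apply: powR_homo => //; try lra; exact: ltW.
- move=> l l0; rewrite s's2 exprMn -mulrA ler_wpM2l ?sqr_ge0//.
  have e2 u v : (l `^ u + l `^ v) ^+ 2 <= 2 * (l `^ (u * 2) + l `^ (v * 2)).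
    have pe t : l `^ (t * 2) = (l `^ t) ^+ 2 by rewrite -powR_mulrn ?powR_ge0// -powRrM.
    rewrite !pe; have := sqr_ge0 (l `^ u - l `^ v); nra.
  apply: (le_trans (e2 _ _)); rewrite (_ : s' / 2 * 2 = s'); last by rewrite divfK.
  have q2s : q * 2 <= s' by rewrite qE; lra.
  (* As q <= 2 q <= s', the middle power is at most the sum of the outer two; this yields the
     constant 4. *)
  have : l `^ (q * 2) <= l `^ q + l `^ s'.
    have [l1'|l1'] := leP l 1.
      apply: (@le_trans _ _ (l `^ q)); last by rewrite lerDl powR_ge0.
      by apply: ger_powR; [rewrite l0|lra].
    apply: (@le_trans _ _ (l `^ s')); last by rewrite lerDr powR_ge0.
    by apply: ler_powR => //; exact: ltW.
  have := powR_ge0 l q; have := powR_ge0 l s'; lra.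
- move=> l l0; apply: (le_trans (HD l l0)); rewrite lee_fin ler_wpM2l//.
  by apply: growth_le => //; exact: ltW.
Qed.

Lemma killed_moment : exists C, forall l, 1 <= l ->
  (\int[P]_w (`|Psi (T l w) - mean Psi l| `^ r)%:E <= (C * l `^ (r / 2))%:E)%E.
Proof.
have [k [s [s2 s4 rE]]] := halving r2.
have [||C HC] := @chain (s / 2) k s s2 s4 => //; first by rewrite -rE.
rewrite -rE in HC; exists (C * 2) => l lge1.
have l0 : 0 < l by exact: lt_le_trans lge1.
have C0 : 0 <= C.
  have := le_trans _ (HC 1 ltr01); rewrite !powR1 => /(_ 0%E); rewrite lee_fin => H.
  suff : 0 <= C * (1 + 1) by lra.
  by apply: H; apply: integral_ge0 => w _; rewrite lee_fin powR_ge0.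
apply: (le_trans (HC l l0)); rewrite lee_fin -mulrA ler_wpM2l//.
have : l `^ (s / 2) <= l `^ (r / 2).
  apply: ler_powR => //; rewrite rE ler_pM2r// ler_peMr; [lra|lra|].
  by rewrite -natrX ler1n expn_gt0.
lra.
Qed.

End Chain.
End MomentTheorem.

(** * Moments of the Poisson leaf count *)

Section ExpBounds.
Variable R : realType.
Implicit Types (x u s : R).

Lemma powR_le_expR s : 0 <= s -> exists2 C, 0 <= C & forall x, 0 <= x -> x `^ s <= C * expR x.
Proof.
move=> s0; pose n := Num.truncn s.
have sn : s <= n.+1%:R by rewrite ltW// truncnS_gt.
have f1 : 1 <= n.+1`!%:R :> R by rewrite ler1n fact_gt0.
exists (n.+1`!%:R); first lra.
move=> x x0.
have h := expR_ge1Dxn n x0.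
have e1 : 1 <= expR x by rewrite -expR0 ler_expR.
have [x1|x1] := leP x 1.
  apply: (@le_trans _ _ 1); last by nra.
  by have := powR_homo s0 x0 x1; rewrite powR1.
apply: (@le_trans _ _ (x ^+ n.+1)).
  by rewrite -powR_mulrn//; apply: ler_powR => //; exact: ltW.
have : x ^+ n.+1 / n.+1`!%:R <= expR x by lra.
by rewrite ler_pdivrMr ?(lt_le_trans ltr01)// mulrC.
Qed.

Lemma expR_quad u : `|u| <= 2^-1 -> expR u - 1 - u <= 2 * u ^+ 2.
Proof.
rewrite ler_norml => /andP[u1 u2].
have h := expR_ge1Dx (- u).
have m1 : 0 < 1 - u by lra.
have : expR u <= (1 - u)^-1.
  by rewrite -[expR u]invrK lef_pV2 ?posrE ?invr_gt0 ?expR_gt0// -expRN.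
have : (1 - u)^-1 <= 1 + u + 2 * u ^+ 2.
  rewrite -[_^-1]mul1r ler_pdivrMr//.
  have : 0 <= u ^+ 2 * (1 - 2 * u) by rewrite mulr_ge0 ?sqr_ge0//; lra.
  rewrite !expr2; nra.
lra.
Qed.

End ExpBounds.

Section Leaves.
Context d (Om : measurableType d) (R : realType) (P : probability Om R).
Context (A : finType) (p : A -> R).
Variables (T : R -> Om -> {fset (seq A)}) (U : R -> A -> Om -> {fset (seq A)}).
Variable (Z : set Om).
Hypothesis M : trie_recursion P p T U Z.

(** Chernoff's method at u = 1 / (2 sqrt l): the exponential moments of the centred count at u and
    -u are at most [expR 1], since l (e^u - 1 - u) <= 2 l u^2 = 1/2, and (u |x|)^s is at most a
    multiple of e^(u |x|). *)
Lemma leaves_power s : 0 <= s -> exists2 C, 0 <= C & forall l, 1 <= l ->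
  (\int[P]_w (`|leaves R (T l w) - l| `^ s)%:E <= (C * l `^ (s / 2))%:E)%E.
Proof.
move=> s0; have [C C0 HC] := @powR_le_expR R s s0.
exists (2 `^ s * C * (2 * expR 1)); first by rewrite !mulr_ge0 ?powR_ge0 ?expR_ge0.
move=> l l1; have l0 : 0 < l by exact: lt_le_trans l1.
pose y := Num.sqrt l; have y0 : 0 < y by rewrite sqrtr_gt0.
have y1 : 1 <= y by rewrite -sqrtr1 ler_sqrt// ltW.
have yy : y ^+ 2 = l by rewrite sqr_sqrtr// ltW.
pose u := (2 * y)^-1; have u0 : 0 < u by rewrite invr_gt0 mulr_gt0.
have mL (h : R -> R) : measurable_fun setT (fun w => h (leaves R (T l w))).
  exact: (measurable_TR M l (fun t => h (leaves R t))).
have mgf v : `|v| = u -> (\int[P]_w (expR (v * (leaves R (T l w) - l)))%:E <= (expR 1)%:E)%E.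
  move=> vu.
  rewrite (eq_integral (fun w => (0 + expR (- (v * l)) * expR (v * leaves R (T l w)))%:E)); last first.
    by move=> w _; rewrite add0r -expRD; congr (expR _)%:E; ring.
  rewrite ge0_integral_affine ?expR_ge0//; last exact: (mL (fun x => expR (v * x))).
  rewrite add0e.
  rewrite (leaves_mgf M)// -EFinM -expRD lee_fin ler_expR.
  have u12 : `|v| <= 2^-1 by rewrite vu lef_pV2 ?posrE ?mulr_gt0//; lra.
  have h := expR_quad u12.
  have v2 : v ^+ 2 = (4 * l)^-1.
    rewrite -(real_normK (num_real v)) vu /u -yy exprVn; congr (_^-1); ring.
  have : l * (expR v - 1 - v) <= l * (2 * v ^+ 2) by rewrite ler_wpM2l// ltW.
  have -> : l * (2 * v ^+ 2) = 2^-1 by rewrite v2; field; rewrite gt_eqF.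
  lra.
apply: (@le_trans _ _ (\int[P]_w (0 + (2 `^ s * C * l `^ (s / 2)) *
    (expR (u * (leaves R (T l w) - l)) + expR (- u * (leaves R (T l w) - l))))%:E)%E).
  apply: le_ge0_integral.
  - exact: (mL (fun x => `|x - l| `^ s)).
  - exact: (mL (fun x => 0 + (2 `^ s * C * l `^ (s / 2)) * (expR (u * (x - l)) + expR (- u * (x - l))))).
  - by move=> w; exact: powR_ge0.
  - move=> w; set x := leaves R (T l w) - l; rewrite add0r.
    have -> : `|x| = 2 * y * (u * `|x|).
      by rewrite /u mulrA divff ?mul1r// gt_eqF// mulr_gt0.
    have ux0 : 0 <= u * `|x| by rewrite mulr_ge0// ltW.
    rewrite powRM//; last by rewrite mulr_ge0// ltW.
    rewrite powRM//; last exact: ltW.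
    have -> : y `^ s = l `^ (s / 2).
      by rewrite /y -powR12_sqrt ?(ltW l0)// -powRrM mulrC.
    rewrite -!mulrA ler_wpM2l ?powR_ge0// mulrCA ler_wpM2l ?powR_ge0//.
    apply: (le_trans (HC _ ux0)); rewrite ler_wpM2l//.
    have := expR_ge0 (u * x); have := expR_ge0 (- u * x).
    by have [x0|x0] := leP 0 x; [rewrite ger0_norm|rewrite ltr0_norm // mulrN -mulNr] => //; lra.
rewrite ge0_integral_affine ?mulr_ge0 ?powR_ge0//; last first.
  exact: (mL (fun x => expR (u * (x - l)) + expR (- u * (x - l)))).
rewrite add0e.
have -> : (\int[P]_w (expR (u * (leaves R (T l w) - l)) + expR (- u * (leaves R (T l w) - l)))%:E =
   \int[P]_w (expR (u * (leaves R (T l w) - l)))%:E + \int[P]_w (expR (- u * (leaves R (T l w) - l)))%:E)%E.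
  under eq_integral do rewrite EFinD.
  by rewrite ge0_integralD//; apply/measurable_EFinP;
    [exact: (mL (fun x => expR (u * (x - l))))|
     exact: (mL (fun x => expR (- u * (x - l))))].
apply: (@le_trans _ _ ((2 `^ s * C * l `^ (s / 2))%:E * ((expR 1)%:E + (expR 1)%:E))%E).
  rewrite lee_wpmul2l ?lee_fin ?mulr_ge0 ?powR_ge0// leeD// mgf//.
    by rewrite gtr0_norm.
  by rewrite normrN gtr0_norm.
by rewrite -EFinD -EFinM lee_fin le_eqVlt; apply/orP; left; apply/eqP; ring.
Qed.

End Leaves.

(** * Independence of partial sums *)

Section SumIndependence.
Context d (Om : measurableType d) (R : realType) (P : probability Om R).
Context (I : finType) (C : countType) (X : I -> Om -> C) (f : I -> C -> R).
Hypothesis dX : forall i, discrete (X i).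
Hypothesis indX : forall B : I -> set C,
  P (\bigcap_i (X i @^-1` B i)) = (\prod_i P (X i @^-1` B i))%E.

Let S (s : seq I) w := \sum_(i <- s) f i (X i w).

Let dXff : discrete (fun w => [ffun i => X i w]).
Proof. exact: discrete_ffun. Qed.

Lemma measurable_partial_sum s (B : set R) (E : I -> set C) :
  measurable ((S s) @^-1` B `&` \bigcap_(i in [set i | i \notin s]) (X i @^-1` E i)).
Proof.
have := discrete_preimage (fun g : {ffun I -> C} =>
  B (\sum_(i <- s) f i (g i)) /\ forall i, i \notin s -> E i (g i)) dXff.
congr measurable; apply/seteqP; split=> w /=.
  move=> [Bw Ew]; split.
    by move: Bw; congr B; apply: eq_bigr => i _; rewrite ffunE.
  by move=> i /= /Ew; rewrite ffunE.
move=> [Bw Ew]; split.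
  by move: Bw; congr B; apply: eq_bigr => i _; rewrite ffunE.
by move=> i /= /Ew; rewrite ffunE.
Qed.

(** Conditioning on the value of [X i] removes one summand and shifts [B]. The coordinates outside
    [s] keep arbitrary events, which lets the induction fix the value of the coordinate that it
    adds. *)
Lemma partial_sum_law (s : seq I) (B : set R) (E : I -> set C) : uniq s ->
  P ((S s) @^-1` B `&` \bigcap_(i in [set i | i \notin s]) (X i @^-1` E i)) =
  (P ((S s) @^-1` B) * \prod_(i | i \notin s) P (X i @^-1` E i))%E.
Proof.
elim: s B E => [|i s IH] B E.
  move=> _; have [B0|B0] := pselect (B 0).
    rewrite (_ : S [::] @^-1` B = setT); last first.
      by apply/seteqP; split=> // w _; rewrite /= /S big_nil.
    by rewrite setTI probability_setT mul1e -indX; congr (P _); apply: eq_bigcapl.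
  rewrite (_ : S [::] @^-1` B = set0); last first.
    by apply/seteqP; split=> // w; rewrite /= /S big_nil.
  by rewrite set0I measure0 mul0e.
rewrite cons_uniq => /andP[is_ us].
pose shift c : set R := [set r | B (f i c + r)].
have key (n : nat) (E' : I -> set C) :
    P ((S (i :: s) @^-1` B `&` \bigcap_(j in [set j | j \notin i :: s]) (X j @^-1` E' j)) `&`
       (fun w => choice.pickle (X i w)) @^-1` [set n]) =
    (oapp (fun c => P ((S s) @^-1` (shift c)) *
       P (X i @^-1` [set c' | choice.pickle c' = n])) 0 (choice.unpickle n) *
     \prod_(j | j \notin i :: s) P (X j @^-1` E' j))%E.
  case En : (choice.unpickle n) => [c|]/=; last first.
    rewrite mul0e (_ : _ `&` _ = set0) ?measure0//.
    apply/seteqP; split=> // w [_ /= wn].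
    by move: En; rewrite -wn choice.pickleK.
  have wc w : choice.pickle (X i w) = n -> X i w = c.
    by move=> wn; move: En; rewrite -wn choice.pickleK => -[].
  pose E2 j := if j == i then [set c' | choice.pickle c' = n] else E' j.
  have := IH (shift c) E2 us.
  rewrite [X in (_ * X)%E](bigD1 i)//= {2}/E2 eqxx muleA => H.
  transitivity (P (S s @^-1` (shift c) `&`
      \bigcap_(j in [set j | j \notin s]) (X j @^-1` E2 j))).
    congr (P _); apply/seteqP; split=> w.
      move=> [[Bw Ew] wn]; split.
        by move: Bw; rewrite /= /S big_cons (wc w wn).
      move=> j /= js; rewrite /E2; case: eqP => [->//|/eqP ji].
      by apply: Ew => /=; rewrite inE negb_or ji.
    move=> [Bw Ew]; have := Ew i is_; rewrite /= /E2 eqxx /= => wn.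
    split => //; split; first by rewrite /= /S big_cons (wc w wn).
    move=> j /=; rewrite inE negb_or => /andP[ji js].
    by have := Ew j js; rewrite /= /E2 (negbTE ji).
  rewrite H; congr (_ * _)%E; apply: eq_big => j.
    by rewrite inE negb_or andbC.
  by move=> /andP[_ ji]; rewrite /E2 (negbTE ji).
rewrite (measure_discrete P (dX i)); last exact: measurable_partial_sum.
have finE : (\prod_(j | j \notin i :: s) P (X j @^-1` E j))%E \is a fin_num.
  apply: prode_fin_num => j _; apply: fin_num_measure; exact: discrete_preimage.
(* [key] is used twice, with the events [E] and with full events: the two expansions have the same
   coefficients. *)
have ET : S (i :: s) @^-1` B = S (i :: s) @^-1` B `&`
    \bigcap_(j in [set j | j \notin i :: s]) (X j @^-1` setT).
  by apply/seteqP; split=> w //= [].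
rewrite [in RHS]ET [X in (X * _)%E](measure_discrete P (dX i)); last exact: measurable_partial_sum.
rewrite muleC -(fineK finE) -nneseriesZl; last by move=> n _; exact: measure_ge0.
apply: eq_eseriesr => n _; rewrite (fineK finE).
apply: (eq_trans (key n E)); rewrite muleC; congr (_ * _)%E.
apply/esym; apply: (eq_trans (key n (fun=> setT))).
rewrite [X in (_ * X)%E]big1 ?mule1// => j _.
by rewrite preimage_setT probability_setT.
Qed.

Lemma indep2_sum (s : seq I) i (g : C -> R) : uniq s -> i \notin s ->
  indep2 P (fun w => \sum_(j <- s) f j (X j w)) (fun w => g (X i w)).
Proof.
move=> us is_ B D mB mD.
pose E j := if j == i then g @^-1` D else setT.
have := partial_sum_law B E us.
rewrite (bigD1 i)//= {2}/E eqxx big1 ?mule1; last first.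
  by move=> j /andP[_ ji]; rewrite /E (negbTE ji) preimage_setT probability_setT.
move=> <-; congr (P _); apply/seteqP; split=> w.
  move=> [Bw Dw]; split => // j _; rewrite /E /=.
  by case: eqP => [->|].
move=> [Bw /(_ i is_)]; rewrite /E eqxx => Dw.
by split.
Qed.

End SumIndependence.

(** * Characteristic functions *)

Section TrigTaylor.
Variable R : realType.
Implicit Types x y t s : R.

(** Each Taylor inequality below is the integral of an earlier one. *)
Lemma ge0_of_derive (f f' : R -> R) : f 0 = 0 ->
  (forall x, is_derive x 1 f (f' x)) -> (forall x, 0 <= x -> 0 <= f' x) ->
  forall x, 0 <= x -> 0 <= f x.
Proof.
move=> f0 df f'0 x; rewrite le_eqVlt => /predU1P[<-|x0]; first by rewrite f0.
have [|c /[!in_itv]/= /andP[c0 _]] := @MVT R f f' 0 x x0 (fun y _ => df y).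
  by apply: derivable_within_continuous => y _; exact: (@ex_derive _ _ _ _ _ _ _ (df y)).
by rewrite f0 !subr0 => ->; rewrite mulr_ge0 ?f'0// ltW.
Qed.

Lemma sin_le x : 0 <= x -> sin x <= x.
Proof.
move=> x0; rewrite -subr_ge0.
apply: (@ge0_of_derive (fun x => x - sin x) (fun x => 1 - cos x)) => //.
by rewrite sin0 subr0.
Qed.

Lemma cos_ge x : 0 <= x -> 0 <= cos x - 1 + x ^+ 2 / 2.
Proof.
apply: (@ge0_of_derive (fun x => cos x - 1 + x ^+ 2 / 2) (fun x => x - sin x)).
- by rewrite cos0 expr0n mul0r subrr addr0.
- by move=> y; apply: is_derive_eq; rewrite /GRing.scale/=; field.
- by move=> y y0; rewrite subr_ge0 sin_le.
Qed.

Lemma sin_ge x : 0 <= x -> 0 <= sin x - x + x ^+ 3 / 6.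
Proof.
apply: (@ge0_of_derive (fun x => sin x - x + x ^+ 3 / 6)
  (fun x => cos x - 1 + x ^+ 2 / 2)).
- by rewrite sin0 expr0n mul0r subrr addr0.
- by move=> y; apply: is_derive_eq; rewrite /GRing.scale/=; field.
- exact: cos_ge.
Qed.

Lemma cos_le x : 0 <= x -> 0 <= x ^+ 4 / 24 - (cos x - 1 + x ^+ 2 / 2).
Proof.
apply: (@ge0_of_derive (fun x => x ^+ 4 / 24 - (cos x - 1 + x ^+ 2 / 2))
  (fun x => sin x - x + x ^+ 3 / 6)).
- by rewrite cos0 !expr0n/= !mul0r subrr addr0 subrr.
- by move=> y; apply: is_derive_eq; rewrite /GRing.scale/=; field.
- exact: sin_ge.
Qed.

(** Below 1 the remainders of orders four and three are at most x^3 <= x^s; above 1 everything is at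
    most a multiple of x^2 <= x^s. *)
Lemma trig_remainder x s : 0 <= x -> 2 <= s -> s <= 3 ->
  0 <= x - sin x /\ (cos x - 1 + x ^+ 2 / 2) + (x - sin x) <= 3 * x `^ s.
Proof.
move=> x0 s2 s3; have sx := sin_le x0; split; first lra.
have [x1|x1] := leP x 1.
  have [->|xn0] := eqVneq x 0.
    by rewrite cos0 sin0 expr0n mul0r !subrr !addr0 mulr_ge0 ?powR_ge0.
  have c4 := cos_le x0; have s3' := sin_ge x0.
  have : x ^+ 3 <= x `^ s.
    rewrite -powR_mulrn//; apply: ger_powR => //.
    by rewrite x1 lt_neqAle eq_sym xn0 x0.
  have : x ^+ 4 <= x ^+ 3 by rewrite exprS ler_piMl// exprn_ge0.
  have := exprn_ge0 3 x0; lra.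
have : x ^+ 2 <= x `^ s.
  by rewrite -powR_mulrn//; apply: ler_powR => //; exact: ltW.
have := cos_le1 x; have := sin_geN1 x.
have : x <= x ^+ 2 by rewrite expr2 ler_peMl// ltW.
lra.
Qed.

Lemma cos_taylor x t s : 2 <= s -> s <= 3 ->
  `|cos (x + t) - (cos t - x * sin t - x ^+ 2 / 2 * cos t)| <= 3 * `|x| `^ s.
Proof.
move=> s2 s3.
have [h1 h2] := trig_remainder (normr_ge0 x) s2 s3.
have h3 := cos_ge (normr_ge0 x).
rewrite cos_norm real_normK ?num_real// in h2 h3.
have h4 : `|x - sin x| = `|x| - sin `|x|.
  have [x0|x0] := leP 0 x.
    by rewrite ger0_norm ?subr_ge0 ?sin_le// (ger0_norm x0).
  rewrite (ltr0_norm x0) sinN ler0_norm; first by ring.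
  have : 0 <= - x by lra.
  by move=> /sin_le; rewrite sinN; lra.
rewrite cosD.
have -> : cos x * cos t - sin x * sin t - (cos t - x * sin t - x ^+ 2 / 2 * cos t) =
  (cos x - 1 + x ^+ 2 / 2) * cos t + (x - sin x) * sin t by ring.
apply: (le_trans (ler_normD _ _)); apply: le_trans h2; rewrite -h4 !normrM.
rewrite lerD//; last by rewrite ler_piMr// sin_max.
by rewrite (ger0_norm h3) ler_piMr// cos_max.
Qed.

Lemma cos_lip x y : `|cos x - cos y| <= 2 * `|x - y|.
Proof.
have -> : x = (x - y) + y by rewrite subrK.
rewrite addrK; move: (x - y) => h.
rewrite cosD (_ : _ - _ - _ = (cos h - 1) * cos y - sin h * sin y); last by ring.
apply: (le_trans (ler_normB _ _)); rewrite !normrM.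
have c1 : `|cos h - 1| <= `|h|.
  rewrite ler0_norm; last by rewrite subr_le0 cos_le1.
  have h0 := normr_ge0 h.
  have := cos_ge h0; rewrite cos_norm.
  have := cos_geN1 h.
  have [h2|h2] := leP `|h| 2; last lra.
  have : `|h| ^+ 2 <= 2 * `|h| by rewrite expr2 ler_wpM2r.
  lra.
have s1 : `|sin h| <= `|h|.
  have h0 := normr_ge0 h.
  have [hp|hn] := leP 0 h.
    rewrite [leRHS]ger0_norm// ler_norml (sin_le hp) andbT.
    have := sin_geN1 h; have [h1|h1] := leP h 1; last lra.
    have := sin_ge hp.
    have : h ^+ 3 <= h by rewrite exprS ler_piMr// expr_le1.
    lra.
  have hn' : 0 <= - h by lra.
  rewrite -normrN -sinN [leRHS]ltr0_norm// ler_norml (sin_le hn') andbT.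
  have := sin_geN1 (- h); have [h1|h1] := leP (- h) 1; last lra.
  have := sin_ge hn'.
  have : (- h) ^+ 3 <= - h by rewrite exprS ler_piMr// expr_le1.
  lra.
have : `|cos h - 1| * `|cos y| <= `|h|.
  by apply: le_trans c1; rewrite ler_piMr// cos_max.
have : `|sin h| * `|sin y| <= `|h|.
  by apply: le_trans s1; rewrite ler_piMr// sin_max.
lra.
Qed.

Lemma expRN_taylor y s : 0 <= y -> 1 <= s -> s <= 2 ->
  `|expR (- y) - (1 - y)| <= y `^ s.
Proof.
move=> y0 s1 s2; rewrite ger0_norm; last by have := expR_ge1Dx (- y); lra.
have y1 : expR (- y) <= 1 by rewrite expR_le1 oppr_le0.
have y2 : expR (- y) - (1 - y) <= y ^+ 2.
  have y10 : 0 < 1 + y by lra.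
  have : expR (- y) <= (1 + y)^-1.
    by rewrite expRN lef_pV2 ?posrE ?expR_gt0// expR_ge1Dx.
  have : (1 + y)^-1 <= 1 - y + y ^+ 2.
    rewrite -[_^-1]mul1r ler_pdivrMr//.
    have := exprn_ge0 3 y0; rewrite (_ : (1 - y + y ^+ 2) * (1 + y) = 1 + y ^+ 3); [lra|ring].
  lra.
have [->|yn0] := eqVneq y 0; first by rewrite oppr0 expR0 addr0 subrr powR_ge0.
have yp : 0 < y by rewrite lt_neqAle eq_sym yn0.
have [le1|gt1] := leP y 1.
  apply: (le_trans y2); rewrite -powR_mulrn//; apply: ger_powR => //.
  by rewrite yp.
apply: (@le_trans _ _ y); first lra.
by rewrite -{1}(powRr1 y0); apply: ler_powR => //; exact: ltW.
Qed.

Lemma expRN_lip (a b : R) : 0 <= a -> 0 <= b -> `|expR (- a) - expR (- b)| <= `|a - b|.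
Proof.
wlog ab : a b / a <= b.
  move=> H a0 b0; have [ab|/ltW ba] := leP a b; first exact: H.
  by rewrite distrC [leRHS]distrC H.
move=> a0 b0.
have eab : expR (- b) <= expR (- a) by rewrite ler_expR; lra.
rewrite ger0_norm ?subr_ge0// ler0_norm ?subr_le0//.
have -> : expR (- b) = expR (- a) * expR (- (b - a)).
  by rewrite -expRD; congr expR; ring.
have := expR_ge1Dx (- (b - a)).
have : expR (- a) <= 1 by rewrite expR_le1 oppr_le0.
have : expR (- (b - a)) <= 1 by rewrite expR_le1 oppr_le0 subr_ge0.
have := expR_gt0 (- a).
nra.
Qed.

End TrigTaylor.

Section CfClose.
Context d (Om : measurableType d) (R : realType) (P : probability Om R).
Implicit Types (X Y : Om -> R).

(* Quantifying over the phase [t] encodes closeness of the complex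
   characteristic functions at 1. *)
Definition cf_close X (c D : R) := forall t,
  `|\int[P]_w cos (X w + t) - c * cos t| <= D.

Lemma measurable_cosD X t : measurable_fun setT X ->
  measurable_fun setT (fun w => cos (X w + t)).
Proof.
move=> mX; apply: (measurableT_comp (f := cos)).
  by apply: continuous_measurable_fun; exact: continuous_cos.
exact: measurable_funD.
Qed.

Lemma L1_cos X t : measurable_fun setT X -> L1 P (fun w => cos (X w + t)).
Proof.
by move=> mX; apply: (@L1_bounded _ _ _ _ _ 1) => [|w]; [exact: measurable_cosD|exact: cos_max].
Qed.

Lemma Rintegral_close (f g : Om -> R) : L1 P f -> L1 P g ->
  `|\int[P]_w f w - \int[P]_w g w| <= \int[P]_w `|f w - g w|.
Proof.
move=> if_ ig; rewrite -RintegralB//.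
by apply: le_normr_Rintegral => //; exact: L1B.
Qed.

Lemma le_Rintegral_cst (f : Om -> R) D : L1 P f -> (forall w, f w <= D) ->
  \int[P]_w f w <= D.
Proof.
move=> if_ fD; rewrite -[leRHS](Rintegral_prob P).
by apply: le_Rintegral => //; exact: L1_cst.
Qed.

Lemma indep2_comp X Y (f g : R -> R) : indep2 P X Y ->
  measurable_fun setT f -> measurable_fun setT g ->
  indep2 P (fun w => f (X w)) (fun w => g (Y w)).
Proof.
move=> XY mf mg B C mB mC; have := XY (f @^-1` B) (g @^-1` C).
by apply; rewrite -[_ @^-1` _]setTI; [exact: mf|exact: mg].
Qed.

Lemma cf_close0 : cf_close (fun=> 0) 1 0.
Proof.
move=> t; under eq_Rintegral do rewrite add0r.
by rewrite Rintegral_prob mul1r subrr normr0.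
Qed.

(** Independence allows [Y] to be held fixed: E cos(X + y) is within [D] of a cos y at y = Y + t.
    Averaging over [Y] then uses its own closeness, scaled by |a| <= 1. *)
Lemma cf_closeD X Y a b D E : measurable_fun setT X -> measurable_fun setT Y ->
  indep2 P X Y -> `|a| <= 1 -> cf_close X a D -> cf_close Y b E ->
  cf_close (fun w => X w + Y w) (a * b) (D + E).
Proof.
move=> mX mY indXY a1 cX cY t.
(* The means of cos X and sin X, as cos(x - pi/2) = sin x. By the addition formula they determine E
   cos(X + y) for every phase [y]. *)
pose c := \int[P]_w cos (X w + 0); pose s := \int[P]_w cos (X w + - (pi / 2)).
have gE y : \int[P]_w cos (X w + y) = c * cos y - s * sin y.
  have i1 := L1Z (cos y) (L1_cos 0 mX).
  have i2 := L1Z (sin y) (L1_cos (- (pi / 2)) mX).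
  transitivity (\int[P]_w (cos y * cos (X w + 0) - sin y * cos (X w + - (pi / 2)))).
    by apply: eq_Rintegral => w _; rewrite addr0 cosBpihalf cosD; ring.
  rewrite RintegralB// RintegralZl//; last exact: L1_cos.
  by rewrite RintegralZl//; [rewrite mulrC [sin y * _]mulrC|exact: L1_cos].
have mc u : measurable_fun setT (fun x : R => cos (x + u)).
  apply: (measurableT_comp (f := cos)); last exact: measurable_funD.
  by apply: continuous_measurable_fun; exact: continuous_cos.
have [i1 e1] := indep_mul (measurable_cosD 0 mX) (measurable_cosD t mY)
  (indep2_comp indXY (mc 0) (mc t)) (L1_cos 0 mX) (L1_cos t mY).
have [i2 e2] := indep_mul (measurable_cosD (- (pi / 2)) mX) (measurable_cosD (t - pi / 2) mY)
  (indep2_comp indXY (mc (- (pi / 2))) (mc (t - pi / 2))) (L1_cos _ mX) (L1_cos _ mY).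
have -> : \int[P]_w cos (X w + Y w + t) =
    \int[P]_w (cos (X w + 0) * cos (Y w + t) - cos (X w - pi / 2) * cos (Y w + (t - pi / 2))).
  apply: eq_Rintegral => w _.
  by rewrite addr0 cosBpihalf addrA cosBpihalf -[X w + Y w + t]addrA [LHS]cosD.
rewrite RintegralB// e1 e2 -/c -/s.
have -> : c * \int[P]_w cos (Y w + t) - s * \int[P]_w cos (Y w + (t - pi / 2)) =
    \int[P]_w (c * cos (Y w + t) - s * sin (Y w + t)).
  rewrite RintegralB//; [|exact/L1Z/L1_cos|]; last first.
    have := L1Z s (L1_cos (t - pi / 2) mY); apply: eq_integrable => // w _ /=.
    by rewrite addrA cosBpihalf.
  rewrite RintegralZl//; last exact: L1_cos.
  rewrite RintegralZl//; last first.
    have := L1_cos (t - pi / 2) mY; apply: eq_integrable => // w _ /=.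
    by rewrite addrA cosBpihalf.
  by congr (_ - s * _); apply: eq_Rintegral => w _; rewrite addrA cosBpihalf.
have iY := L1_cos t mY.
have iX : L1 P (fun w => c * cos (Y w + t) - s * sin (Y w + t)).
  apply: L1B; first exact: L1Z.
  have := L1Z s (L1_cos (t - pi / 2) mY); apply: eq_integrable => // w _ /=.
  by rewrite addrA cosBpihalf.
have h1 : `|\int[P]_w (c * cos (Y w + t) - s * sin (Y w + t)) -
    \int[P]_w (a * cos (Y w + t))| <= D.
  have iaY := L1Z a iY.
  apply: (le_trans (Rintegral_close iX iaY)).
  apply: le_Rintegral_cst; first exact/L1_abs/L1B.
  by move=> w; rewrite -gE; exact: cX.
have h2 : `|a * \int[P]_w cos (Y w + t) - a * b * cos t| <= E.
  rewrite -mulrA -mulrBr normrM; apply: le_trans (cY t).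
  by rewrite ler_piMl.
rewrite RintegralZl// in h1.
apply: le_trans (lerD h1 h2); apply: le_trans (ler_normD _ _).
by rewrite le_eqVlt; apply/orP; left; apply/eqP; congr (`|_|); ring.
Qed.

Lemma cf_close_perturb X Y a D E : measurable_fun setT X -> measurable_fun setT Y ->
  L1 P (fun w => X w - Y w) -> \int[P]_w `|X w - Y w| <= E ->
  cf_close Y a D -> cf_close X a (D + 2 * E).
Proof.
move=> mX mY iXY XY cY t.
have h : `|\int[P]_w cos (X w + t) - \int[P]_w cos (Y w + t)| <= 2 * E.
  apply: (le_trans (Rintegral_close (L1_cos t mX) (L1_cos t mY))).
  apply: (@le_trans _ _ (\int[P]_w (2 * `|X w - Y w|))).
    apply: le_Rintegral => //.
    - by apply/L1_abs/L1B; exact: L1_cos.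
    - exact/L1Z/L1_abs.
    - move=> w _; apply: (le_trans (cos_lip _ _)).
      by rewrite (_ : X w + t - (Y w + t) = X w - Y w)//; ring.
  by rewrite RintegralZl; [rewrite ler_pM2l| |exact: L1_abs].
rewrite [leRHS]addrC; apply: le_trans (lerD h (cY t)); apply: le_trans (ler_normD _ _).
by rewrite le_eqVlt; apply/orP; left; apply/eqP; congr (`|_|); ring.
Qed.

Lemma cf_close_le X a b D E : cf_close X a D -> D + `|a - b| <= E -> cf_close X b E.
Proof.
move=> cX DE t; apply: le_trans DE; apply: (le_trans _ (lerD (cX t) (lexx _))).
apply: (@le_trans _ _ (`|\int[P]_w cos (X w + t) - a * cos t| + `|(a - b) * cos t|)).
  apply: le_trans (ler_normD _ _).
  by rewrite le_eqVlt; apply/orP; left; apply/eqP; congr (`|_|); ring.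
by rewrite lerD2l normrM ler_piMr// cos_max.
Qed.

(** The linear Taylor term vanishes because [X] is centred, and the quadratic one gives 1 - v.
    Replacing this by exp(-v) costs v^(s/2), since 1 <= s / 2 <= 2. *)
Lemma cf_close_taylor X s : square_integrable P X -> \int[P]_w X w = 0 ->
  2 <= s -> s <= 3 -> L1 P (fun w => `|X w| `^ s) ->
  cf_close X (expR (- (\int[P]_w (X w ^+ 2) / 2)))
    (3 * \int[P]_w (`|X w| `^ s) + (\int[P]_w (X w ^+ 2) / 2) `^ (s / 2)).
Proof.
move=> sX X0 s2 s3 iXs t.
have mX := sX.1; have iX := square_integrable_L1 sX; have iX2 := square_integrable_sqr sX.
set v := \int[P]_w (X w ^+ 2) / 2.
have v0 : 0 <= v by rewrite divr_ge0// Rintegral_ge0// => w _; exact: sqr_ge0.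
pose g w := cos t - sin t * X w - (cos t / 2) * X w ^+ 2.
have ig : L1 P g.
  by apply: L1B; [apply: L1B; [exact: L1_cst|exact: L1Z]|exact: L1Z].
have Eg : \int[P]_w g w = (1 - v) * cos t.
  rewrite /g RintegralB//; [|by apply: L1B; [exact: L1_cst|exact: L1Z]|exact: L1Z].
  rewrite RintegralB//; [|exact: L1_cst|exact: L1Z].
  by rewrite Rintegral_prob !RintegralZl// X0 /v; field.
have h1 : `|\int[P]_w cos (X w + t) - (1 - v) * cos t| <= 3 * \int[P]_w (`|X w| `^ s).
  rewrite -Eg; apply: (le_trans (Rintegral_close (L1_cos t mX) ig)).
  rewrite -RintegralZl//; apply: le_Rintegral => //.
  - by apply/L1_abs/L1B => //; exact: L1_cos.
  - exact: L1Z.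
  - move=> w _; apply: le_trans (cos_taylor (X w) t s2 s3).
    by rewrite le_eqVlt; apply/orP; left; apply/eqP; congr (`|_|); rewrite /g; field.
have h2 : `|(1 - v) * cos t - expR (- v) * cos t| <= v `^ (s / 2).
  rewrite -mulrBl normrM distrC.
  apply: (le_trans _ (expRN_taylor (s := s / 2) v0 _ _)); [|lra|lra].
  by rewrite ler_piMr// cos_max.
apply: le_trans (lerD h1 h2); apply: le_trans (ler_normD _ _).
by rewrite le_eqVlt; apply/orP; left; apply/eqP; congr (`|_|); ring.
Qed.

End CfClose.

Lemma integral_sqr_sum d (Om : measurableType d) (R : realType)
    (P : probability Om R) (I : eqType) (s : seq I) (Y : I -> Om -> R) :
  uniq s -> (forall i, square_integrable P (Y i)) ->
  (forall i, \int[P]_w Y i w = 0) ->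
  (forall i j, i != j -> indep2 P (Y i) (Y j)) ->
  \int[P]_w ((\sum_(i <- s) Y i w) ^+ 2) = \sum_(i <- s) \int[P]_w (Y i w ^+ 2).
Proof.
move=> us sY Y0 ind; elim: s us => [|i s IH] /=.
  move=> _; rewrite big_nil; under eq_Rintegral do rewrite big_nil expr0n.
  exact: Rintegral_prob.
move=> /andP[is_ us]; rewrite big_cons -IH//.
have sS := square_integrable_sum s sY.
have [iC eC] := Rintegral_sum s (fun j => square_integrableM (sY i) (sY j)).
transitivity (\int[P]_w (Y i w ^+ 2 + (2 * (\sum_(j <- s) Y i w * Y j w) +
    (\sum_(j <- s) Y j w) ^+ 2))).
  by apply: eq_Rintegral => w _; rewrite big_cons -mulr_sumr; ring.
have iS2 := square_integrable_sqr sS.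
rewrite RintegralD//; [|exact: square_integrable_sqr|by apply: L1D => //; exact: L1Z].
rewrite RintegralD//; last exact: L1Z.
rewrite RintegralZl// eC big1_seq ?mulr0 ?add0r// => j /= js.
have ij : i != j by apply: contraNneq is_ => ->.
have [_ ->] := indep_mul (sY i).1 (sY j).1 (ind i j ij)
  (square_integrable_L1 (sY i)) (square_integrable_L1 (sY j)).
by rewrite Y0 mul0r.
Qed.

(** * The recursion for characteristic functions *)

Section CfTheorem.
Context d (Om : measurableType d) (R : realType) (P : probability Om R).
Context (A : finType) (p : A -> R).
Variables (T : R -> Om -> {fset (seq A)}) (U : R -> A -> Om -> {fset (seq A)}).
Variable (Z : set Om).
Hypothesis M : trie_recursion P p T U Z.
Hypotheses (hA : (2 <= #|A|)%N) (p_gt0 : forall a, 0 < p a).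
Hypothesis (p_sum1 : \sum_a p a = 1).
Local Notation mean := (trie_mean P T).

Variables (Psi tau : {fset (seq A)} -> R).
Hypothesis recPsi : forall (l : R) w, ~ Z w ->
  Psi (T l w) = tau (T l w) + \sum_x Psi (U l x w).
Hypothesis sqPsi : forall l, 0 < l -> square_integrable P (fun w => Psi (T l w)).
Hypothesis sqtau : forall l, 0 < l -> square_integrable P (fun w => tau (T l w)).

Let X l w := Psi (T l w) - mean Psi l.
Let v l := \int[P]_w (X l w ^+ 2).
Let z l w := tau (T l w) - mean tau l.
Let Y l x w := Psi (U l x w) - mean Psi (l * p x).

Let mX l : measurable_fun setT (X l).
Proof. exact: (measurable_TR M l (fun t => Psi t - mean Psi l)). Qed.

Let mY l x : measurable_fun setT (Y l x).
Proof. exact: (measurable_UR M l x (fun t => Psi t - mean Psi (l * p x))). Qed.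

Let lp_gt0 l x : 0 < l -> 0 < l * p x.
Proof. by move=> l0; rewrite mulr_gt0. Qed.

Let sqX l : 0 < l -> square_integrable P (X l).
Proof.
move=> l0; apply: square_integrableB; first exact: sqPsi.
exact: square_integrable_cst.
Qed.

Let sqz l : 0 < l -> square_integrable P (z l).
Proof.
move=> l0; apply: square_integrableB; first exact: sqtau.
exact: square_integrable_cst.
Qed.

Let meanX l : 0 < l -> \int[P]_w X l w = 0.
Proof.
move=> l0; have iP := square_integrable_L1 (sqPsi l0).
by rewrite RintegralB//; [rewrite Rintegral_prob subrr|exact: L1_cst].
Qed.

Let Ytransfer l x (h : R -> R) : 0 < l -> L1 P (fun w => h (X (l * p x) w)) ->
  L1 P (fun w => h (Y l x w)) /\ \int[P]_w h (Y l x w) = \int[P]_w h (X (l * p x) w).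
Proof.
move=> l0 iX.
exact: (L1_subtrie M (F := fun t => h (Psi t - mean Psi (l * p x))) l0 iX).
Qed.

Let sqY l x : 0 < l -> square_integrable P (Y l x).
Proof.
move=> l0; apply: square_integrableP => //.
apply: (Ytransfer (h := fun r => r ^+ 2) l0 _).1.
exact/square_integrable_sqr/sqX/lp_gt0.
Qed.

Let meanY l x : 0 < l -> \int[P]_w Y l x w = 0.
Proof.
move=> l0; rewrite (Ytransfer (h := id) l0 _).2 ?meanX//; first exact: lp_gt0.
exact/square_integrable_L1/sqX/lp_gt0.
Qed.

Let varY l x : 0 < l -> \int[P]_w (Y l x w ^+ 2) = v (l * p x).
Proof.
move=> l0; rewrite (Ytransfer (h := fun r => r ^+ 2) l0 _).2//.
exact/square_integrable_sqr/sqX/lp_gt0.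
Qed.

Let indY l x y : 0 < l -> x != y -> indep2 P (Y l x) (Y l y).
Proof.
move=> l0 xy.
exact: (indep2_subtrie M (fun t => Psi t - mean Psi (l * p x))
  (fun t => Psi t - mean Psi (l * p y)) l0 xy).
Qed.

Let Xrec l : 0 < l -> forall w, ~ Z w -> X l w = \sum_x Y l x w + z l w.
Proof.
move=> l0 w nZ; rewrite /X /Y /z sumrB recPsi// (mean_rec M p_gt0 recPsi)//.
by ring.
Qed.

Let ae_Rintegral (f g : Om -> R) : measurable_fun setT f -> measurable_fun setT g ->
  (forall w, ~ Z w -> f w = g w) -> \int[P]_w f w = \int[P]_w g w.
Proof.
move=> mf mg fg; rewrite /Rintegral; congr fine; apply: ae_eq_integral => //.
- exact/measurable_EFinP.
- exact/measurable_EFinP.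
exists Z; split; [exact: measurableZ M|exact: nullZ M|].
by move=> w /= nE; apply: contrapT => nZ; apply: nE => _; rewrite fg.
Qed.

Let v_ge0 l : 0 <= v l.
Proof. by apply: Rintegral_ge0 => w _; exact: sqr_ge0. Qed.

(** The branches are independent, so their variances add. The toll depends on them, so its cross
    term is split by 2 |a b| <= e a^2 + b^2 / e. *)
Lemma variance_rec l e : 0 < l -> 0 < e ->
  `|v l - \sum_x v (l * p x)| <=
    e * \sum_x v (l * p x) + (1 + e^-1) * \int[P]_w (z l w ^+ 2).
Proof.
move=> l0 e0.
have sS := square_integrable_sum (index_enum A) (fun x => @sqY l x l0).
have S2 : \int[P]_w ((\sum_x Y l x w) ^+ 2) = \sum_x v (l * p x).
  rewrite integral_sqr_sum ?index_enum_uniq//.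
  - by apply: eq_bigr => x _; exact: varY.
  - by move=> x; exact: sqY.
  - by move=> x; exact: meanY.
  - by move=> x y xy; exact: indY.
have iS2 := square_integrable_sqr sS.
have iz2 := square_integrable_sqr (sqz l0).
have iSz := square_integrableM sS (sqz l0).
have -> : v l = \int[P]_w ((\sum_x Y l x w) ^+ 2 + (2 * ((\sum_x Y l x w) * z l w) + z l w ^+ 2)).
  rewrite /v; apply: ae_Rintegral.
  - exact: measurable_funX.
  - exact: (L1_measurable (L1D iS2 (L1D (L1Z 2 iSz) iz2))).
  - by move=> w nZ; rewrite (Xrec l0 nZ); ring.
rewrite -S2.
have ib : L1 P (fun w => 2 * ((\sum_x Y l x w) * z l w) + z l w ^+ 2).
  by apply: L1D => //; exact: L1Z.
rewrite RintegralD// addrAC subrr add0r.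
apply: (le_trans (le_normr_Rintegral _ _)) => //.
rewrite -RintegralZl// -RintegralZl// -RintegralD//; try exact: L1Z.
apply: le_Rintegral => //; first exact: L1_abs.
  by apply: L1D; exact: L1Z.
move=> w _; set a := \sum_x _; set b := z l w.
have ei0 : 0 < e^-1 by rewrite invr_gt0.
have ee : e * e^-1 = 1 by rewrite divff// gt_eqF.
have h1 : 0 <= e^-1 * (e * a - b) ^+ 2 by rewrite mulr_ge0 ?sqr_ge0// ltW.
have h2 : 0 <= e^-1 * (e * a + b) ^+ 2 by rewrite mulr_ge0 ?sqr_ge0// ltW.
have E1 : e^-1 * (e * a - b) ^+ 2 = e * a ^+ 2 - 2 * (a * b) + e^-1 * b ^+ 2.
  by field; rewrite gt_eqF.
have E2 : e^-1 * (e * a + b) ^+ 2 = e * a ^+ 2 + 2 * (a * b) + e^-1 * b ^+ 2.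
  by field; rewrite gt_eqF.
have b20 := sqr_ge0 b.
rewrite /= ler_norml; apply/andP; split; lra.
Qed.

Variables (V L C s : R).
Hypotheses (L0 : 0 < L) (s2 : 2 < s) (s3 : s <= 3) (V0 : 0 <= V).
Hypothesis var_bound : forall l, L <= l -> v l <= V * l.
Hypothesis toll_small : forall e, 0 < e -> exists l0, forall l, l0 <= l ->
  \int[P]_w (z l w ^+ 2) <= e * l.
Hypothesis tail_bound : forall l, L <= l -> L1 P (fun w => `|X l w| `^ s) /\
  \int[P]_w (`|X l w| `^ s) <= C * l `^ (s / 2).

Let B := 3 * C + V `^ (s / 2).
Let rho := \sum_a p a `^ (s / 2).

Lemma variance_rec_small e : 0 < e -> exists l0, forall l, l0 <= l ->
  `|v l - \sum_x v (l * p x)| <= e * l.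
Proof.
(* [e1] and [e2] make each of the two error terms at most (e / 2) l. *)
move=> e0; pose e1 := e / (2 * (V + 1)).
have V1 : 0 < V + 1 by rewrite ltr_wpDl.
have e10 : 0 < e1 by rewrite divr_gt0// mulr_gt0.
pose e2 := e / (2 * (1 + e1^-1)).
have e120 : 0 < 1 + e1^-1 by rewrite addr_gt0 ?invr_gt0.
have e20 : 0 < e2 by rewrite divr_gt0// mulr_gt0.
have [l0 H0] := toll_small e20.
(* The second entry keeps every [l * p x] above [L]. *)
exists (Num.max l0 (\sum_x L / p x)) => l; rewrite ge_max => /andP[ll0 lL].
have Lx x : L <= l * p x.
  rewrite -ler_pdivrMr//; apply: le_trans lL; rewrite (bigD1 x)//= lerDl.
  by rewrite sumr_ge0// => y _; rewrite divr_ge0 ?ltW.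
have l_gt0 : 0 < l.
  have /card_gt0P[x _] : (0 < #|A|)%N by exact: leq_trans hA.
  by rewrite -(pmulr_lgt0 _ (p_gt0 x)) (lt_le_trans L0).
apply: (le_trans (variance_rec l_gt0 e10)).
have h1 : e1 * \sum_x v (l * p x) <= e / 2 * l.
  apply: (@le_trans _ _ (e1 * (V * l))).
    rewrite ler_pM2l//; apply: (@le_trans _ _ (\sum_x V * (l * p x))).
      by apply: ler_sum => x _; exact: var_bound.
    by rewrite -!mulr_sumr p_sum1 mulr1.
  have <- : e1 * (V + 1) = e / 2 by rewrite /e1; field; rewrite gt_eqF.
  by rewrite mulrA ler_pM2r// ler_pM2l// lerDl.
have h2 : (1 + e1^-1) * \int[P]_w (z l w ^+ 2) <= e / 2 * l.
  apply: (@le_trans _ _ ((1 + e1^-1) * (e2 * l))); first by rewrite ler_pM2l// H0.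
  rewrite mulrA ler_pM2r// /e2 le_eqVlt; apply/orP; left; apply/eqP.
  by move: (1 + e1^-1) e120 => c c0; field; rewrite gt_eqF.
lra.
Qed.

Lemma cf_base l u : L <= l ->
  cf_close P (fun w => u * X l w) (expR (- (u ^+ 2 * v l / 2))) (B * (u ^+ 2 * l) `^ (s / 2)).
Proof.
move=> Ll; have l0 : 0 < l by exact: lt_le_trans Ll.
have [iXs Xs] := tail_bound Ll.
have u2 : `|u| `^ s = (u ^+ 2) `^ (s / 2).
  rewrite -(real_normK (num_real u)) -powR_mulrn// -powRrM.
  by rewrite mulrC divfK.
have Eus w : `|u * X l w| `^ s = `|u| `^ s * `|X l w| `^ s by rewrite normrM powRM.
have iuXs : L1 P (fun w => `|u * X l w| `^ s).
  have := L1Z (`|u| `^ s) iXs; apply: eq_integrable => // w _ /=.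
  by rewrite Eus.
have Ev : \int[P]_w ((u * X l w) ^+ 2) = u ^+ 2 * v l.
  rewrite -RintegralZl//; last exact/square_integrable_sqr/sqX.
  by apply: eq_Rintegral => w _; rewrite exprMn.
have E0 : \int[P]_w (u * X l w) = 0.
  by rewrite RintegralZl ?meanX ?mulr0//; exact/square_integrable_L1/sqX.
have := cf_close_taylor (square_integrableZ u (sqX l0)) E0 (ltW s2) s3 iuXs.
rewrite Ev => /cf_close_le; apply; rewrite subrr normr0 addr0.
rewrite /B [leRHS]mulrDl; apply: lerD.
  rewrite -mulrA ler_wpM2l//.
  have -> : \int[P]_w (`|u * X l w| `^ s) = `|u| `^ s * \int[P]_w (`|X l w| `^ s).
    by rewrite -RintegralZl//; apply: eq_Rintegral => w _; exact: Eus.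
  rewrite u2 powRM ?sqr_ge0 ?(ltW l0)// mulrCA ler_wpM2l ?powR_ge0//.
have ul0 : 0 <= u ^+ 2 * l by rewrite mulr_ge0 ?sqr_ge0// ltW.
rewrite -powRM//; apply: powR_homo.
- by move: s2; lra.
- by rewrite divr_ge0// mulr_ge0 ?sqr_ge0.
- have : u ^+ 2 * v l <= u ^+ 2 * (V * l) by rewrite ler_wpM2l ?sqr_ge0 ?var_bound.
  have : 0 <= u ^+ 2 * v l by rewrite mulr_ge0 ?sqr_ge0.
  lra.
Qed.

(** The Gaussian factors multiply to the one with the summed variance, and the errors add because
    each factor is at most 1. *)
Lemma cf_sum l u (D : A -> R) : 0 < l ->
  (forall x, cf_close P (fun w => u * X (l * p x) w)
     (expR (- (u ^+ 2 * v (l * p x) / 2))) (D x)) ->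
  cf_close P (fun w => u * \sum_x Y l x w)
    (expR (- (u ^+ 2 * (\sum_x v (l * p x)) / 2))) (\sum_x D x).
Proof.
move=> l0 HD.
have cY x : cf_close P (fun w => u * Y l x w) (expR (- (u ^+ 2 * v (l * p x) / 2))) (D x).
  move=> t; rewrite (Ytransfer (h := fun r => cos (u * r + t)) l0 _).2; first exact: HD.
  by apply: L1_cos; exact: measurable_funM.
have muY x : measurable_fun setT (fun w => u * Y l x w) by exact: measurable_funM.
suff key (r : seq A) : uniq r -> cf_close P (fun w => \sum_(x <- r) u * Y l x w)
    (expR (- (u ^+ 2 * (\sum_(x <- r) v (l * p x)) / 2))) (\sum_(x <- r) D x).
  have := key _ (index_enum_uniq A); congr cf_close.
  by apply/funext => w; rewrite mulr_sumr.
elim: r => [|x r IH] /=.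
  rewrite !big_nil mulr0 mul0r oppr0 expR0 => _.
  rewrite (_ : (fun w => _) = fun=> 0); first exact: cf_close0.
  by apply/funext => w; rewrite big_nil.
move=> /andP[xr ur].
have ind : indep2 P (fun w => u * Y l x w) (fun w => \sum_(y <- r) u * Y l y w).
  have indU : forall E : A -> set {fset (seq A)},
      P (\bigcap_y (U l y @^-1` E y)) = (\prod_y P (U l y @^-1` E y))%E.
    move=> E; rewrite (split_law M)//; apply: eq_bigr => y _.
    by rewrite (subtrie_law M).
  have := @indep2_sum _ _ _ P A _ (U l) (fun y t => u * (Psi t - mean Psi (l * p y)))
    (discreteU M l) indU r x (fun t => u * (Psi t - mean Psi (l * p x))) ur xr.
  by move=> h E F mE mF; rewrite setIC muleC; exact: h.
have := cf_closeD (muY x) (measurable_sum _ muY) ind _ (cY x) (IH ur).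
rewrite !big_cons; rewrite ger0_norm ?expR_ge0// expR_le1 oppr_le0.
rewrite divr_ge0 ?(mulr_ge0 (sqr_ge0 u) (v_ge0 _))// => /(_ isT).
rewrite -expRD; congr cf_close.
  by apply/funext => w; rewrite big_cons.
by congr expR; field.
Qed.

(** The condition u^2 l <= 1 passes to the branches, and summing (u^2 l p_x)^(s/2) over the letters
    produces the factor [rho]. The new errors are e/2 from the branches, e/4 from dropping the toll
    and e/8 from the change of variance. *)
Lemma cf_claim m e : 0 < e -> exists l0, forall l, l0 <= l -> forall u, u ^+ 2 * l <= 1 ->
  cf_close P (fun w => u * X l w) (expR (- (u ^+ 2 * v l / 2)))
    (B * rho ^+ m * (u ^+ 2 * l) `^ (s / 2) + e).
Proof.
elim: m e => [|m IH] e e0.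
  exists L => l Ll u ul; rewrite expr0 mulr1.
  by apply: cf_close_le (cf_base u Ll) _; rewrite subrr normr0 addr0 lerDl ltW.
have nA : 0 < #|A|%:R :> R by rewrite ltr0n (leq_trans _ hA).
pose e' := e / (2 * #|A|%:R); have e'0 : 0 < e' by rewrite divr_gt0// mulr_gt0.
have [la Ha] := IH e' e'0.
(* With toll variance at most h^2 l, the bound |u z| <= h + u^2 z^2 / h has mean at most 2 h = e /
   8. *)
pose h := e / 16; have h0 : 0 < h by rewrite divr_gt0.
have [lb Hb] := toll_small (exprn_gt0 2 h0).
have e40 : 0 < e / 4 by rewrite divr_gt0.
have [lc Hc] := variance_rec_small e40.
pose l1 := Num.max 1 la.
exists (Num.max (Num.max lb lc) (\sum_x l1 / p x)) => l.
rewrite !ge_max => /andP[/andP[lbl lcl] lal] u ul.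
have l10 : 0 < l1 by rewrite lt_max ltr01.
have lx x : l1 <= l * p x.
  rewrite -ler_pdivrMr//; apply: le_trans lal; rewrite (bigD1 x)//= lerDl.
  by rewrite sumr_ge0// => y _; rewrite divr_ge0 ?ltW.
have l0 : 0 < l.
  have /card_gt0P[x _] : (0 < #|A|)%N by exact: leq_trans hA.
  by rewrite -(pmulr_lgt0 _ (p_gt0 x)) (lt_le_trans l10).
have u20 : 0 <= u ^+ 2 by exact: sqr_ge0.
have sub x := Ha (l * p x) (le_trans (_ : la <= l1) (lx x)) u.
have la1 : la <= l1 by rewrite le_max lexx orbT.
have ulx x : u ^+ 2 * (l * p x) <= 1.
  apply: le_trans ul; rewrite mulrA ler_piMr//; last by rewrite ltW// letter_prob_lt1.
  exact: mulr_ge0 u20 (ltW l0).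
have cS := cf_sum l0 (fun x => sub la1 x (ulx x)).
have sumD : \sum_x (B * rho ^+ m * (u ^+ 2 * (l * p x)) `^ (s / 2) + e') =
    B * rho ^+ m.+1 * (u ^+ 2 * l) `^ (s / 2) + e / 2.
  rewrite big_split/= sumr_const -mulr_sumr; congr (_ + _); last first.
    by rewrite -mulr_natl /e'; field; rewrite gt_eqF.
  have -> : \sum_i (u ^+ 2 * (l * p i)) `^ (s / 2) = (u ^+ 2 * l) `^ (s / 2) * rho.
    rewrite mulr_sumr; apply: eq_bigr => x _; rewrite mulrA powRM//.
      exact: mulr_ge0 u20 (ltW l0).
    exact: ltW.
  by rewrite (exprSr rho); ring.
rewrite {}sumD in cS.
have sS := square_integrable_sum (index_enum A) (fun x => @sqY l x l0).
have iuX : L1 P (fun w => u * X l w - u * \sum_x Y l x w).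
  apply: L1B; apply: L1Z; first exact/square_integrable_L1/sqX.
  exact: square_integrable_L1.
have Euz : \int[P]_w `|u * X l w - u * \sum_x Y l x w| <= e / 8.
  have iz2 := square_integrable_sqr (sqz l0).
  have -> : \int[P]_w `|u * X l w - u * \sum_x Y l x w| = \int[P]_w `|u * z l w|.
    apply: ae_Rintegral.
    - exact: (L1_measurable (L1_abs iuX)).
    - exact: (L1_measurable (L1_abs (L1Z u (square_integrable_L1 (sqz l0))))).
    - by move=> w nZ; rewrite (Xrec l0 nZ); congr (`|_|); ring.
  apply: (@le_trans _ _ (\int[P]_w (h + (u ^+ 2 / h) * z l w ^+ 2))).
    apply: le_Rintegral => //.
    - by apply/L1_abs/L1Z/square_integrable_L1/sqz.
    - by apply: L1D; [exact: L1_cst|exact: L1Z].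
    - move=> w _; set b := z l w.
      have hi0 : 0 < h^-1 by rewrite invr_gt0.
      have k : 0 <= h^-1 * (h - `|u * b|) ^+ 2 by rewrite mulr_ge0 ?sqr_ge0// ltW.
      have E : h^-1 * (h - `|u * b|) ^+ 2 = h - 2 * `|u * b| + u ^+ 2 / h * b ^+ 2.
        transitivity (h - 2 * `|u * b| + `|u * b| ^+ 2 / h); first by field; rewrite gt_eqF.
        by rewrite real_normK ?num_real// exprMn mulrAC.
      have := normr_ge0 (u * b); lra.
  rewrite RintegralD//; [|exact: L1_cst|exact: L1Z].
  rewrite Rintegral_prob RintegralZl//.
  have := Hb l lbl => k.
  have : u ^+ 2 / h * \int[P]_w (z l w ^+ 2) <= u ^+ 2 / h * (h ^+ 2 * l).
    by apply: ler_wpM2l => //; apply: divr_ge0 => //; exact: ltW.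
  have -> : u ^+ 2 / h * (h ^+ 2 * l) = h * (u ^+ 2 * l) by field; rewrite gt_eqF.
  have : h * (u ^+ 2 * l) <= h by rewrite ler_piMr// ltW.
  rewrite /h; lra.
have muX : measurable_fun setT (fun w => u * X l w) by exact: measurable_funM.
have muS : measurable_fun setT (fun w => u * \sum_x Y l x w).
  by apply: measurable_funM => //; exact: sS.1.
have := cf_close_perturb muX muS iuX Euz cS.
move=> /cf_close_le; apply.
have k1 : `|expR (- (u ^+ 2 * (\sum_x v (l * p x)) / 2)) - expR (- (u ^+ 2 * v l / 2))| <= e / 8.
  apply: le_trans (expRN_lip _ _) _.
  - by apply: divr_ge0 => //; apply: mulr_ge0 => //; apply: sumr_ge0.
  - by apply: divr_ge0 => //; apply: mulr_ge0.
  rewrite -mulrBl -mulrBr normrM normrM (ger0_norm u20) (ger0_norm (x := 2^-1))//.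
  rewrite distrC.
  have : u ^+ 2 * `|v l - \sum_x v (l * p x)| <= u ^+ 2 * (e / 4 * l).
    by rewrite ler_wpM2l// Hc.
  have : e / 4 * (u ^+ 2 * l) <= e / 4 by rewrite ler_piMr// ltW.
  have -> : u ^+ 2 * (e / 4 * l) = e / 4 * (u ^+ 2 * l) by ring.
  lra.
lra.
Qed.

(** First [m] is chosen with B rho^m < e / 2; then u = 1 / sqrt l gives u^2 l = 1. *)
Lemma cf_limit e : 0 < e -> exists l0, forall l, l0 <= l ->
  cf_close P (fun w => X l w / Num.sqrt l) (expR (- (v l / l / 2))) e.
Proof.
move=> e0.
have r0 : 0 <= rho by apply: sumr_ge0 => a _; exact: powR_ge0.
have r1 : rho < 1 by apply: sum_powR_lt1 => //; move: s2; lra.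
have : B * rho ^+ m @[m --> \oo] --> B * 0.
  by apply: cvgMr; apply: cvg_expr; rewrite ger0_norm.
have e20 : 0 < e / 2 by rewrite divr_gt0.
rewrite mulr0 => /cvgr0_norm_lt/(_ _ e20)[m _ /(_ m (leqnn _))] /= Bm.
have [l0 H] := cf_claim m e20.
exists (Num.max 1 l0) => l; rewrite ge_max => /andP[l1 ll].
have lgt0 : 0 < l by exact: lt_le_trans l1.
have u2 : (Num.sqrt l)^-1 ^+ 2 = l^-1 by rewrite exprVn sqr_sqrtr// ltW.
have ul : (Num.sqrt l)^-1 ^+ 2 * l = 1 by rewrite u2 mulVf// gt_eqF.
have := H l ll (Num.sqrt l)^-1; rewrite ul lexx powR1 mulr1 => /(_ isT).
rewrite (_ : (fun w => (Num.sqrt l)^-1 * X l w) = fun w => X l w / Num.sqrt l); last first.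
  by apply/funext => w; rewrite mulrC.
rewrite u2 [l^-1 * _]mulrC => /cf_close_le; apply; rewrite subrr normr0 addr0.
have := ler_norm (B * rho ^+ m); lra.
Qed.

End CfTheorem.

(** * Moment bounds at large intensity *)

Section PowerBound.
Context d (Om : measurableType d) (R : realType) (P : probability Om R).
Implicit Types (X Y : R -> Om -> R).

Definition power_bound s X := exists C L : R, forall l, L <= l ->
  (\int[P]_w (`|X l w| `^ s)%:E <= (C * l `^ (s / 2))%:E)%E.

Lemma measurable_powR_norm s (X : Om -> R) : measurable_fun setT X ->
  measurable_fun setT (fun w => `|X w| `^ s).
Proof.
move=> mX; apply: (measurableT_comp (f := fun x : R => x `^ s)) => //.
exact: measurableT_comp.
Qed.

Lemma power_boundD s X Y : 0 <= s -> (forall l, measurable_fun setT (X l)) ->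
  (forall l, measurable_fun setT (Y l)) ->
  power_bound s X -> power_bound s Y -> power_bound s (fun l w => X l w + Y l w).
Proof.
move=> s0 mX mY [C [L HX]] [D [L' HY]].
exists (2 `^ s * (C + D)), (Num.max L L') => l; rewrite ge_max => /andP[Ll L'l].
have mXs := measurable_powR_norm s (mX l); have mYs := measurable_powR_norm s (mY l).
apply: (@le_trans _ _ (\int[P]_w (0 + 2 `^ s * (`|X l w| `^ s + `|Y l w| `^ s))%:E)%E).
  apply: ge0_le_integral => //.
  - apply/measurable_EFinP; have := measurable_powR_norm s (measurable_funD (mX l) (mY l)); exact.
  - by apply/measurable_EFinP; apply: measurable_funD => //; apply: measurable_funM => //;
      apply: measurable_funD.
  - by move=> w _; rewrite lee_fin add0r powRD_le.
have mXY := measurable_funD mXs mYs.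
rewrite (ge0_integral_affine P (lexx 0) (powR_ge0 2 s) mXY) => [|w]; last first.
  by rewrite addr_ge0 ?powR_ge0.
rewrite add0e -mulrA EFinM lee_wpmul2l ?lee_fin ?powR_ge0//.
under eq_integral do rewrite EFinD.
rewrite ge0_integralD//; first by rewrite mulrDl EFinD leeD ?HX ?HY.
- exact/measurable_EFinP.
- exact/measurable_EFinP.
Qed.

Lemma power_boundZ s c X : 0 <= s -> (forall l, measurable_fun setT (X l)) ->
  power_bound s X -> power_bound s (fun l w => c * X l w).
Proof.
move=> s0 mX [C [L HX]]; exists (`|c| `^ s * C), L => l Ll.
have mXs := measurable_powR_norm s (mX l).
have -> : (\int[P]_w (`|c * X l w| `^ s)%:E =
    \int[P]_w (0 + `|c| `^ s * `|X l w| `^ s)%:E)%E.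
  by apply: eq_integral => w _; rewrite add0r normrM powRM.
rewrite ge0_integral_affine ?powR_ge0//.
by rewrite add0e -mulrA EFinM lee_wpmul2l ?lee_fin ?powR_ge0// HX.
Qed.

Lemma power_bound_le s r X : 0 <= s -> s <= r -> (forall l, measurable_fun setT (X l)) ->
  power_bound r X -> power_bound s X.
Proof.
move=> s0 sr mX [C [L HX]]; exists (1 + C), (Num.max 1 L) => l.
rewrite ge_max => /andP[l1 Ll]; have l0 : 0 < l by exact: lt_le_trans l1.
pose y := l `^ (2^-1); have y0 : 0 < y by rewrite powR_gt0.
have yq q : y `^ q = l `^ (q / 2) by rewrite -powRrM mulrC.
have mXs := measurable_powR_norm s (mX l); have mXr := measurable_powR_norm r (mX l).
apply: (@le_trans _ _ (\int[P]_w (y `^ s + y `^ (s - r) * `|X l w| `^ r)%:E)%E).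
  apply: ge0_le_integral => //.
  - exact/measurable_EFinP.
  - by apply/measurable_EFinP; apply: measurable_funD => //; apply: measurable_funM.
  - by move=> w _; rewrite lee_fin powR_interpolation.
rewrite ge0_integral_affine ?powR_ge0//.
apply: (@le_trans _ _ ((y `^ s)%:E + (y `^ (s - r))%:E * (C * l `^ (r / 2))%:E)%E).
  by rewrite leeD2l// lee_wpmul2l ?lee_fin ?powR_ge0// HX.
rewrite -EFinM -EFinD lee_fin mulrCA -(yq r) -powRD; last by rewrite (gt_eqF y0) implybT.
by rewrite subrK yq mulrDl mul1r.
Qed.

Lemma power_bound_bounded s c X : 0 <= s -> (forall l, measurable_fun setT (X l)) ->
  (forall l w, `|X l w| <= c) -> power_bound s X.
Proof.
move=> s0 mX Xc; exists (`|c| `^ s), 1 => l l1.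
have l0 : 0 < l by exact: lt_le_trans l1.
apply: (@le_trans _ _ (\int[P]_w (`|c| `^ s)%:E)%E).
  apply: ge0_le_integral => //.
  - by apply/measurable_EFinP/measurable_powR_norm.
  - by move=> w _; rewrite lee_fin; apply: powR_homo => //; rewrite (le_trans (Xc l w))// ler_norm.
rewrite integral_cst//= probability_setT mule1 lee_fin.
rewrite ler_peMr ?powR_ge0//; apply: (@le_trans _ _ (l `^ 0)); first by rewrite powRr0.
by rewrite ler_powR// divr_ge0.
Qed.

Lemma power_bound_eq s X Y : (forall l w, X l w = Y l w) -> power_bound s X -> power_bound s Y.
Proof.
move=> XY [C [L HX]]; exists C, L => l /HX; apply: le_trans.
by under eq_integral do rewrite -XY.
Qed.

Lemma normr_powR2 (x : R) : `|x| `^ 2 = x ^+ 2.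
Proof. by rewrite powR_mulrn// real_normK ?num_real. Qed.

Lemma power_bound2 X : power_bound 2 X <->
  exists C L : R, forall l, L <= l -> (\int[P]_w ((X l w) ^+ 2)%:E <= (C * l)%:E)%E.
Proof.
have E l : (\int[P]_w (`|X l w| `^ 2)%:E = \int[P]_w ((X l w) ^+ 2)%:E)%E.
  by apply: eq_integral => w _; rewrite normr_powR2.
have l1 l : 0 <= l -> l `^ (2 / 2) = l :> R by move=> l0; rewrite divff// powRr1.
split=> -[C [L H]]; exists C, (Num.max L 0) => l; rewrite ge_max => /andP[Ll l0].
  by rewrite -E -{2}(l1 l l0); exact: H.
by rewrite E l1//; exact: H.
Qed.

Lemma power_bound_L1 s X : (forall l, measurable_fun setT (X l)) -> power_bound s X ->
  exists C L : R, forall l, L <= l -> L1 P (fun w => `|X l w| `^ s) /\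
    \int[P]_w (`|X l w| `^ s) <= C * l `^ (s / 2).
Proof.
move=> mX [C [L H]]; exists C, L => l Ll.
have i : L1 P (fun w => `|X l w| `^ s).
  apply: L1_ge0 => [||].
  - exact: measurable_powR_norm.
  - by move=> w; exact: powR_ge0.
  - by apply: (le_lt_trans (H l Ll)); rewrite ltry.
by split=> //; rewrite -lee_fin EFin_Rintegral// H.
Qed.

End PowerBound.

(** * Moments and limit law of one functional *)

Section FunctionalLimit.
Context d (Om : measurableType d) (R : realType) (P : probability Om R).
Context (A : finType) (p : A -> R).
Variables (T : R -> Om -> {fset (seq A)}) (U : R -> A -> Om -> {fset (seq A)}).
Variable (Z : set Om).
Hypothesis M : trie_recursion P p T U Z.
Hypotheses (hA : (2 <= #|A|)%N) (p_gt0 : forall a, 0 < p a).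
Hypothesis (p_sum1 : \sum_a p a = 1).
Local Notation mean := (trie_mean P T).

Definition trie_centered (g : {fset (seq A)} -> R) (l : R) (w : Om) := g (T l w) - mean g l.
Local Notation centered := trie_centered.

Let mc g l : measurable_fun setT (centered g l).
Proof. exact: (measurable_TR M l (fun t => g t - mean g l)). Qed.

Let mcZ k g l : measurable_fun setT (fun w => k * centered g l w).
Proof. by apply: measurable_funM. Qed.

(** The hypotheses speak of large [l] only, while the recursion visits smaller intensities;
    finiteness is inherited downwards. *)
Lemma square_integrable_dom (g : {fset (seq A)} -> R) l l' : 0 < l -> l <= l' ->
  square_integrable P (fun w => g (T l' w)) -> square_integrable P (fun w => g (T l w)).
Proof.
move=> l0 ll' [m' i']; split; first exact: (measurable_TR M l g).
have := @dom_integral _ _ _ _ _ _ _ _ _ M 0 l l' (fun t => (g t ^+ 2)%:E) l0 ll'.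
move=> /(_ (fun t => _) (fun t => _))H; apply: (le_lt_trans (H _ _)) => //.
  by move=> t; rewrite lee_fin sqr_ge0.
by rewrite expr0 mul1r lte_mul_pinfty// lee_fin expR_ge0.
Qed.

Lemma square_integrable_of_bound (g : {fset (seq A)} -> R) : power_bound P 2 (centered g) ->
  forall l, 0 < l -> square_integrable P (fun w => g (T l w)).
Proof.
move=> /power_bound2[C [L H]] l l0; have ll : l <= Num.max l L by rewrite le_max lexx.
apply: (square_integrable_dom l0 ll).
apply: (@square_integrable_center _ _ _ _ _ (mean g (Num.max l L))).
  exact: (measurable_TR M _ g).
by apply: (le_lt_trans (H _ _)); rewrite ?ltry// le_max lexx orbT.
Qed.

Lemma centeredD g h c l w : 0 < l -> square_integrable P (fun w => g (T l w)) ->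
  square_integrable P (fun w => h (T l w)) ->
  centered (fun t => g t + c * h t) l w = centered g l w + c * centered h l w.
Proof.
move=> l0 /square_integrable_L1 ig /square_integrable_L1 ih.
rewrite /trie_centered /trie_mean RintegralD//; last exact: L1Z.
by rewrite RintegralZl//; ring.
Qed.

Lemma leaves_bound1 : power_bound P 2 (fun l w => leaves R (T l w) - l).
Proof.
have [C _ HC] := leaves_power M (ler0n R 2).
by exists C, 1 => l /HC.
Qed.

Lemma sqr_leaves l : 0 < l -> square_integrable P (fun w => leaves R (T l w)).
Proof.
move=> l0; have /power_bound2[C [L H]] := leaves_bound1.
have ll : l <= Num.max l L by rewrite le_max lexx.
apply: (square_integrable_dom l0 ll).
apply: (@square_integrable_center _ _ _ _ _ (Num.max l L)).
  exact: (measurable_TR M _ (leaves R)).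
by apply: (le_lt_trans (H _ _)); rewrite ?ltry// le_max lexx orbT.
Qed.

(** [leaves_power] centres at [l]. Passing to the mean costs at most the first absolute moment about
    [l], which has order sqrt l. *)
Lemma leaves_bound s : 0 <= s -> power_bound P s (centered (leaves R)).
Proof.
move=> s0; have [C _ HC] := leaves_power M s0.
have [D D0 HD] := leaves_power M (@ler01 R).
have ml l : measurable_fun setT (fun w => leaves R (T l w) - l).
  exact: (measurable_TR M l (fun t => leaves R t - l)).
apply: (@power_bound_eq _ _ _ _ _ (fun l w => (leaves R (T l w) - l) + (l - mean (leaves R) l))).
  by move=> l w; rewrite /trie_centered; ring.
apply: power_boundD => //; first by exists C, 1.
exists (D `^ s), 1 => l l1; have l0 : 0 < l by exact: lt_le_trans l1.
have il := square_integrable_L1 (sqr_leaves l0).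
have il' : L1 P (fun w => leaves R (T l w) - l) by apply: L1B => //; exact: L1_cst.
rewrite integral_cst//= probability_setT mule1 lee_fin.
have -> : D `^ s * l `^ (s / 2) = (D * l `^ (1 / 2)) `^ s.
  by rewrite powRM ?powR_ge0// -powRrM; congr (_ * _ `^ _); field.
apply: powR_homo => //; rewrite distrC.
have -> : mean (leaves R) l - l = \int[P]_w (leaves R (T l w) - l).
  by rewrite RintegralB// ?Rintegral_prob//; exact: L1_cst.
apply: (le_trans (le_normr_Rintegral _ _)) => //.
rewrite -lee_fin EFin_Rintegral; last exact: L1_abs.
apply: le_trans (HD l l1); under eq_integral do rewrite -[X in X%:E]powRr1//.
exact: lexx.
Qed.

Variable f : {fset (seq A)} -> R.
Hypothesis f0 : f fset0 = 0.
Let F := additive_functional f.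
Let tau := corrected f.
Let c := f (singleton_trie A).
Variable r : R.
Hypothesis r2 : 2 < r.
Hypothesis varF : power_bound P 2 (centered F).
Hypothesis varf : forall e, 0 < e -> exists L : R, forall l, L <= l ->
  (\int[P]_w ((centered f l w) ^+ 2)%:E <= (e * l)%:E)%E.
Hypothesis powf : power_bound P r (centered f).

Let one (t : {fset (seq A)}) : R := (t == singleton_trie A)%:R.

Let r0 : 0 <= r. Proof. by move: r2; lra. Qed.

Let varf2 : power_bound P 2 (centered f).
Proof.
apply/power_bound2; exists 1; exact: varf.
Qed.

Let sqF l : 0 < l -> square_integrable P (fun w => F (T l w)).
Proof. exact: square_integrable_of_bound. Qed.

Let sqf l : 0 < l -> square_integrable P (fun w => f (T l w)).
Proof. exact: square_integrable_of_bound. Qed.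

Let one_le1 t : `|one t| <= 1.
Proof. by rewrite /one; case: eqP; rewrite ?normr1 ?normr0. Qed.

Let sqone l : square_integrable P (fun w => one (T l w)).
Proof.
apply: square_integrableP; first exact: (measurable_TR M l one).
apply: (@L1_bounded _ _ _ _ _ 1); first exact: (measurable_TR M l (fun t => one t ^+ 2)).
by move=> w; rewrite normrX exprn_ile1.
Qed.

Let one_le2 l w : `|centered one l w| <= 2.
Proof.
apply: (le_trans (ler_normB _ _)); suff : `|mean one l| <= 1 by have := one_le1 (T l w); lra.
have i := square_integrable_L1 (sqone l).
apply: (le_trans (le_normr_Rintegral _ _)) => //.
rewrite -[leRHS](@Rintegral_prob _ _ _ P); apply: le_Rintegral => //.
- exact: L1_abs.
- exact: L1_cst.
Qed.

Let tauE : tau = (fun t => f t + (- c) * one t).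
Proof. by apply/funext => t; rewrite /tau /corrected mulNr. Qed.

Let sqtau l : 0 < l -> square_integrable P (fun w => tau (T l w)).
Proof.
move=> l0; rewrite tauE; apply: square_integrableD; first exact: sqf.
exact/square_integrableZ/sqone.
Qed.

Let ctau l w : 0 < l -> centered tau l w = centered f l w + (- c) * centered one l w.
Proof. by move=> l0; rewrite tauE centeredD//; exact: sqf. Qed.

Lemma power_bound_eq_gt0 s X Y : (forall l w, 0 < l -> X l w = Y l w) ->
  power_bound P s X -> power_bound P s Y.
Proof.
move=> XY [C [L HX]]; exists C, (Num.max 1 L) => l; rewrite ge_max => /andP[l1 /HX].
apply: le_trans; under eq_integral do rewrite -XY ?(lt_le_trans ltr01)//.
exact: lexx.
Qed.

Let powtau : power_bound P r (centered tau).
Proof.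
apply: (@power_bound_eq_gt0 _ (fun l w => centered f l w + (- c) * centered one l w)).
  by move=> l w l0; rewrite ctau.
apply: (power_boundD r0 (mc f) (mcZ (- c) one) powf).
exact: (power_boundZ (- c) r0 (mc one) (power_bound_bounded P r0 (mc one) one_le2)).
Qed.

Let recF (l : R) w : ~ Z w -> F (T l w) = tau (T l w) + \sum_x F (U l x w).
Proof. by move=> nZ; exact: (additive_functional_joined f0 (joinedTU M l nZ)). Qed.

(** [leaves] is 1 on the one-node trie and has zero corrected toll, so [Psi] vanishes on tries with
    at most one string and obeys the recursion of [F] with the same [tau]. *)
Let Psi t := F t + (- c) * leaves R t.

Let recPsi (l : R) w : ~ Z w -> Psi (T l w) = tau (T l w) + \sum_x Psi (U l x w).
Proof.
move=> nZ; rewrite /Psi recF// (leaves_joined R (joinedTU M l nZ)) big_split/= -mulr_sumr.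
by rewrite addrA.
Qed.

Let weight2 (t : {fset (seq A)}) : (weight t < 2)%N -> t = fset0 \/ t = singleton_trie A.
Proof. by rewrite /weight; case: eqP => [|_]; [left|case: eqP => [|_]; [right|]]. Qed.

Let one0 : one fset0 = 0.
Proof.
by rewrite /one (_ : (_ == _) = false)//; apply/eqP => /fsetP/(_ [::]); rewrite !inE.
Qed.

Let one1 : one (singleton_trie A) = 1. Proof. by rewrite /one eqxx. Qed.

Let killPsi t : (weight t < 2)%N -> Psi t = 0.
Proof.
rewrite /Psi /F /leaves => /weight2[->|->]; rewrite ?additive_functional0 ?additive_functional1.
- by rewrite mulr0 addr0.
- by rewrite -/(one _) one1 mulr1 subrr.
Qed.

Let killtau t : (weight t < 2)%N -> tau t = 0.
Proof.
rewrite tauE => /weight2[->|->]; first by rewrite f0 one0 mulr0 addr0.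
by rewrite one1 mulr1 subrr.
Qed.

Let sqPsi l : 0 < l -> square_integrable P (fun w => Psi (T l w)).
Proof.
move=> l0; apply: square_integrableD; first exact: sqF.
exact/square_integrableZ/sqr_leaves.
Qed.

Let cPsi l w : 0 < l -> centered Psi l w = centered F l w + (- c) * centered (leaves R) l w.
Proof. by move=> l0; rewrite centeredD//; [exact: sqF|exact: sqr_leaves]. Qed.

Let varPsi : power_bound P 2 (centered Psi).
Proof.
apply: (@power_bound_eq_gt0 _ (fun l w => centered F l w + (- c) * centered (leaves R) l w)).
  by move=> l w l0; rewrite cPsi.
have h2 : 0 <= 2 :> R by [].
apply: (power_boundD h2 (mc F) (mcZ (- c) (leaves R)) varF).
exact: (power_boundZ (- c) h2 (mc (leaves R)) (leaves_bound h2)).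
Qed.

Lemma functional_moment : power_bound P r (centered F).
Proof.
have /power_bound2[C1 [l1 H1]] := varPsi; have [C2 [l2 H2]] := powtau.
have [C HC] := killed_moment M hA p_gt0 p_sum1 recPsi killPsi killtau sqPsi sqtau r2 H1 H2.
apply: (@power_bound_eq_gt0 _ (fun l w => centered Psi l w + c * centered (leaves R) l w)).
  by move=> l w l0; rewrite cPsi//; ring.
apply: (power_boundD r0 (mc Psi) (mcZ c (leaves R))); first by exists C, 1.
exact: (power_boundZ c r0 (mc (leaves R)) (leaves_bound r0)).
Qed.

Lemma functional_cf_limit e : 0 < e -> exists l0, forall l, l0 <= l ->
  cf_close P (fun w => centered F l w / Num.sqrt l)
    (expR (- (\int[P]_w (centered F l w ^+ 2) / l / 2))) e.
Proof.
(* The Taylor estimate needs s <= 3, the contraction s > 2 and the moment bound s <= r. *)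
move=> e0; pose s := Num.min 3 r.
have s2 : 2 < s by rewrite lt_min r2 andbT; lra.
have s3 : s <= 3 by rewrite ge_min lexx.
have sr : s <= r by rewrite ge_min lexx orbT.
have /(power_bound_L1 (mc F))[C [La HC]] : power_bound P s (centered F).
  by apply: power_bound_le sr _ functional_moment => //; lra.
have /power_bound2[V [L2 HV]] := varF.
pose L := Num.max 1 (Num.max La L2).
have L0 : 0 < L by rewrite lt_max ltr01.
have LL l : L <= l -> [/\ 0 < l, La <= l & L2 <= l].
  by rewrite !ge_max => /and3P[l1 -> ->]; split => //; exact: lt_le_trans l1.
have i2 l g : square_integrable P (fun w => g (T l w)) ->
    L1 P (fun w => centered g l w ^+ 2).
  move=> sg; apply: square_integrable_sqr; apply: square_integrableB => //.
  exact: square_integrable_cst.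
apply: (@cf_limit _ _ _ P A p T U Z M hA p_gt0 p_sum1 F tau recF sqF sqtau
  `|V| L C s L0 s2 s3 (normr_ge0 V)) => //.
- move=> l /LL[l0 _ l2]; rewrite -lee_fin EFin_Rintegral; last exact/i2/sqF.
  by apply: (le_trans (HV l l2)); rewrite lee_fin ler_pM2r// ler_norm.
- move=> e1 e10; have e40 : 0 < e1 / 4 by rewrite divr_gt0.
  (* The correction changes the centred toll by at most 2 |c|, so it adds 8 c^2 to twice the square.
     Beyond the threshold 16 c^2 / e1 this is at most (e1 / 2) l. *)
  have [L3 H3] := varf e40; exists (Num.max (Num.max 1 L3) (16 * c ^+ 2 / e1)) => l.
  rewrite !ge_max => /andP[/andP[l1 l3]]; rewrite ler_pdivrMr// => lc.
  have l0 : 0 < l by exact: lt_le_trans l1.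
  apply: (@le_trans _ _ (\int[P]_w (2 * centered f l w ^+ 2 + 8 * c ^+ 2))).
    apply: le_Rintegral => //; [exact/i2/sqtau|apply: L1D; [exact/L1Z/i2/sqf|exact: L1_cst]|].
    move=> w _; rewrite -/(centered tau l w) ctau//; set a := centered f l w.
    have : (c * centered one l w) ^+ 2 <= 4 * c ^+ 2.
      rewrite exprMn mulrC ler_wpM2r ?sqr_ge0// -[leLHS]real_normK ?num_real//.
      by rewrite [4](_ : _ = 2 ^+ 2) ?lerXn2r ?nnegrE//; ring.
    have := sqr_ge0 (a + c * centered one l w).
    rewrite mulNr; set b := c * _; nra.
  rewrite RintegralD//; [|exact/L1Z/i2/sqf|exact: L1_cst].
  rewrite Rintegral_prob RintegralZl//; last exact/i2/sqf.
  have : \int[P]_w (centered f l w ^+ 2) <= e1 / 4 * l.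
    by rewrite -lee_fin EFin_Rintegral; [exact: H3|exact/i2/sqf].
  lra.
- by move=> l /LL[l0 l1 _]; exact: HC.
Qed.

End FunctionalLimit.

Lemma is_derive_Rintegral d (Om : measurableType d) (R : realType) (P : probability Om R)
    (f f' : R -> Om -> R) (G : Om -> R) (a : R) :
  (forall x, L1 P (f x)) -> L1 P G ->
  (forall (x : R) w, is_derive x (1 : R) (fun y : R => f y w) (f' x w)) ->
  (forall x w, `|x - a| < 1 -> `|f' x w| <= G w) ->
  is_derive a (1 : R) (fun x : R => \int[P]_w f x w) (\int[P]_w f' a w).
Proof.
move=> if_ iG df Gf.
have Ia : `]a - 1, a + 1[%classic a by rewrite /= in_itv/=; apply/andP; split; lra.
have G0 w : 0 <= G w.
  by apply: le_trans (Gf a w _); rewrite ?normr_ge0// subrr normr0.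
have dfE x w : partial1of2 f x w = f' x w by rewrite partial1of2E; exact: derive_val.
have Gub x w : `]a - 1, a + 1[%classic x -> [set: Om] w -> `|partial1of2 f x w| <= G w.
  rewrite /= in_itv/= => /andP[x1 x2] _; rewrite dfE Gf//.
  by rewrite ltr_norml; apply/andP; split; lra.
have dfd x w : `]a - 1, a + 1[%classic x -> [set: Om] w -> derivable (f ^~ w) x 1.
  by move=> _ _; exact: (@ex_derive _ _ _ _ _ _ _ (df x w)).
have ifI x : `]a - 1, a + 1[%classic x -> P.-integrable setT (EFin \o f x) by move=> _; exact: if_.
split; first exact: (derivable_under_integral measurableT Ia ifI dfd G0 iG Gub).
rewrite -derive1E (differentiation_under_integral measurableT Ia ifI dfd G0 iG Gub).
by apply: eq_Rintegral => w _; exact: dfE.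
Qed.

(** * Gaussian vectors *)

Section Normal.
Context (R : realType) (sigma : R).
Hypothesis s0 : sigma != 0.
Local Notation mu := (@lebesgue_measure R).

(** The Radon-Nikodym derivative and the density have the same integrals over measurable sets, so
    they agree almost everywhere. *)
Lemma ge0_integral_normal_prob (f : R -> \bar R) : measurable_fun setT f ->
  (forall x, 0 <= f x)%E ->
  (\int[normal_prob 0%R sigma]_x f x = \int[mu]_x (f x * (normal_pdf 0 sigma x)%:E))%E.
Proof.
move=> mf f0.
have dom := normal_prob_dominates 0%R sigma.
rewrite -(Radon_Nikodym_SigmaFinite.change_of_variables dom f0 measurableT mf).
have iRN := Radon_Nikodym_SigmaFinite.f_integrable dom.
apply: ae_eq_integral => //.
- by apply: emeasurable_funM => //; exact: measurable_int iRN.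
- by apply: emeasurable_funM => //; apply/measurable_EFinP; exact: measurable_normal_pdf.
apply: ae_eqe_mul2l; apply: integral_ae_eq => //.
- by apply/measurable_EFinP; exact: measurable_normal_pdf.
- by move=> E _ mE; rewrite -Radon_Nikodym_SigmaFinite.f_integral.
Qed.

Let k := (sigma ^+ 2)^-1.
(** The ratio of the normal densities with means [m] and 0. *)
Let tilt m x := expR (k * (m * x - m ^+ 2 / 2)).

Let ss : sigma ^+ 2 != 0. Proof. by rewrite expf_neq0. Qed.

Let k0 : 0 < k. Proof. by rewrite invr_gt0 exprn_even_gt0//=. Qed.

Let continuous_tilt m : continuous (tilt m).
Proof.
move=> x; apply: continuous_comp; last exact: continuous_expR.
apply: cvgMr; apply: cvgB; last exact: cvg_cst.
by apply: cvgMr; exact: cvg_id.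
Qed.

Lemma normal_shift m (h : R -> R) : continuous h -> (forall x, 0 <= h x) ->
  (\int[normal_prob 0%R sigma]_x (h (x + m))%:E =
   \int[normal_prob 0%R sigma]_x (h x * tilt m x)%:E)%E.
Proof.
move=> ch h0.
have cF : continuous (fun x : R => x + m).
  by move=> x; apply: cvgD; [exact: cvg_id|exact: cvg_cst].
have chm : continuous (fun x => h (x + m)).
  by move=> x; apply: continuous_comp; [exact: cF|exact: ch].
have cht : continuous (fun x => h x * tilt m x).
  by move=> x; apply: cvgM; [exact: ch|exact: continuous_tilt].
have mE (g : R -> R) : continuous g -> measurable_fun setT (fun x => (g x)%:E).
  by move=> cg; apply/measurable_EFinP; exact: continuous_measurable_fun.
rewrite !ge0_integral_normal_prob//; [|exact: mE| |exact: mE|]; last 2 first.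
- by move=> x; rewrite lee_fin mulr_ge0// expR_ge0.
- by move=> x; rewrite lee_fin.
pose G x := h x * tilt m x * normal_pdf 0 sigma x.
pose F x : R := x + m.
have F'E : F^`()%classic = cst 1.
  by apply/funext => x; rewrite derive1E /F deriveD// derive_id derive_cst addr0.
transitivity (\int[mu]_x (G x)%:E)%E; last first.
  by apply: eq_integral => x _; rewrite -EFinM.
rewrite (@increasing_ge0_integration_by_substitutionT _ F G).
- apply: eq_integral => x _; rewrite !fctE F'E /cst mulr1 -EFinM /G; congr EFin.
  rewrite -mulrA; congr (_ * _); rewrite /normal_pdf (negbTE s0) /F.
  rewrite mulrCA; congr (_ * _); rewrite /normal_fun -expRD; congr expR.
  by rewrite /k !subr0; field.
- by move=> x y xy; rewrite /F ltrD2r.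
- by rewrite F'E => x; exact: cvg_cst.
- by rewrite F'E; exact: is_cvg_cst.
- by rewrite F'E; exact: is_cvg_cst.
- by move=> x; exact: ex_derive.
- exact: cvg_addrr_Ny.
- exact: cvg_addrr.
- by move=> x; apply: cvgM; [exact: cht|exact: continuous_normal_pdf].
- by move=> x; rewrite !mulr_ge0// ?expR_ge0 ?normal_pdf_ge0.
Qed.

Let nu : probability _ R := normal_prob 0%R sigma.

Lemma normal_expR u : (\int[nu]_x (expR (u * x))%:E = (expR (u ^+ 2 * sigma ^+ 2 / 2))%:E)%E.
Proof.
(* For this [m], expR (u x) is [tilt m x] times the constant expR (u^2 sigma^2 / 2). *)
pose m := u * sigma ^+ 2.
have := @normal_shift m (fun=> expR (u ^+ 2 * sigma ^+ 2 / 2)) (fun=> cvg_cst _) (fun=> expR_ge0 _).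
rewrite integral_cst//= probability_setT mule1 => ->.
apply: eq_integral => x _; congr EFin; rewrite /tilt -expRD; congr expR.
by rewrite /m /k; field.
Qed.

Lemma L1_normal_expR c : L1 nu (fun x => expR (c * `|x|)).
Proof.
have i u : L1 nu (fun x => expR (u * x)).
  apply: L1_ge0 => [|x|]; last by rewrite normal_expR ltry.
    apply: continuous_measurable_fun => x; apply: continuous_comp; last exact: continuous_expR.
    by apply: cvgMr; exact: cvg_id.
  exact: expR_ge0.
apply: L1_le (L1D (i c) (i (- c))) _ => [|x].
  apply: continuous_measurable_fun => x; apply: continuous_comp; last exact: continuous_expR.
  by apply: cvgMr; exact: norm_continuous.
rewrite ger0_norm ?expR_ge0//; case: (ger0P x) => x0.
  by rewrite lerDl expR_ge0.
by rewrite mulrN mulNr lerDr expR_ge0.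
Qed.

Let continuous_trig t th : continuous (fun x : R => t * x + th).
Proof.
by move=> x; apply: cvgD; [apply: cvgMr; exact: cvg_id|exact: cvg_cst].
Qed.

Let continuous_sin_affine t th : continuous (fun x : R => sin (t * x + th)).
Proof.
move=> x; apply: (@continuous_comp _ _ _ (fun y : R => t * y + th) (@sin R)); first exact: continuous_trig.
exact: continuous_sin.
Qed.

Let continuous_cos_affine t th : continuous (fun x : R => cos (t * x + th)).
Proof.
move=> x; apply: (@continuous_comp _ _ _ (fun y : R => t * y + th) (@cos R)); first exact: continuous_trig.
exact: continuous_cos.
Qed.

Let sin_le1' (x : R) : `|sin x| <= 1.
Proof. by rewrite ler_norml sin_geN1 sin_le1. Qed.

Let cos_le1' (x : R) : `|cos x| <= 1.
Proof. by rewrite ler_norml cos_geN1 cos_le1. Qed.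

Let L1_sin t th : L1 nu (fun x => sin (t * x + th)).
Proof.
apply: (@L1_bounded _ _ _ _ _ 1) => // ; exact: continuous_measurable_fun.
Qed.

Let L1_cos' t th : L1 nu (fun x => cos (t * x + th)).
Proof.
apply: (@L1_bounded _ _ _ _ _ 1) => // ; exact: continuous_measurable_fun.
Qed.

Let tilt_le m x : tilt m x <= expR (k * `|m| * `|x|).
Proof.
rewrite /tilt ler_expR -mulrA ler_pM2l// -normrM.
have := ler_norm (m * x); have := sqr_ge0 m; lra.
Qed.

Let L1_tilt m (h : R -> R) : continuous h -> (forall x, `|h x| <= 1) ->
  L1 nu (fun x => h x * tilt m x).
Proof.
move=> ch h1; apply: L1_le (L1_normal_expR (k * `|m|)) _ => [|x].
  apply: continuous_measurable_fun => x.
  by apply: cvgM; [exact: ch|exact: continuous_tilt].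
rewrite normrM [X in _ * X]ger0_norm ?expR_ge0//.
by rewrite -[leRHS]mul1r ler_pM ?expR_ge0.
Qed.

(** [normal_shift] takes nonnegative functions, so it is applied to 1 + sin and to 1, and the
    results are subtracted. *)
Lemma normal_shift_sin m t th :
  \int[nu]_x sin (t * (x + m) + th) = \int[nu]_x (sin (t * x + th) * tilt m x).
Proof.
have cst1 : continuous (fun _ : R => 1 : R) by move=> x; exact: cvg_cst.
have c1 : continuous (fun x : R => 1 + sin (t * x + th)).
  by move=> x; apply: cvgD; [exact: cvg_cst|exact: continuous_sin_affine].
have p1 (x : R) : 0 <= 1 + sin (t * x + th) by have := sin_geN1 (t * x + th); lra.
have E1 := normal_shift m c1 p1.
have E2 := normal_shift m cst1 (fun=> ler01).
have iS : L1 nu (fun x => sin (t * (x + m) + th)).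
  have := L1_sin t (t * m + th); apply: eq_integrable => // x _ /=.
  by congr (sin _)%:E; ring.
have i1 := L1_tilt m cst1 (fun x => eq_ind_r (fun y => y <= 1) (lexx 1) (normr1 R)).
have i2 := L1_tilt m (@continuous_sin_affine t th) (fun x => sin_le1' _).
have R1 : \int[nu]_x (1 + sin (t * (x + m) + th)) =
    \int[nu]_x ((1 + sin (t * x + th)) * tilt m x) by rewrite /Rintegral E1.
have R2 : \int[nu]_(x in setT) (1 : R) = \int[nu]_x (1 * tilt m x) by rewrite /Rintegral E2.
rewrite RintegralD// in R1; last exact: L1_cst.
have R3 : \int[nu]_x ((1 + sin (t * x + th)) * tilt m x) =
    \int[nu]_x (1 * tilt m x) + \int[nu]_x (sin (t * x + th) * tilt m x).
  by rewrite -RintegralD//; apply: eq_Rintegral => x _; rewrite mulrDl.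
by rewrite R3 -R2 in R1; exact: addrI R1.
Qed.

(* Stein's identity, obtained by differentiating [normal_shift_sin] at m = 0. *)
Lemma normal_stein t th :
  \int[nu]_x (k * x * sin (t * x + th)) = t * \int[nu]_x cos (t * x + th).
Proof.
have d1 : is_derive (0 : R) (1 : R) (fun m : R => \int[nu]_x sin (t * (x + m) + th))
    (\int[nu]_x (t * cos (t * (x + 0) + th))).
  apply: (@is_derive_Rintegral _ _ _ nu (fun m x => sin (t * (x + m) + th))
    (fun m x => t * cos (t * (x + m) + th)) (fun=> `|t|)).
  - move=> m; have := L1_sin t (t * m + th); apply: eq_integrable => // x _ /=.
    by congr (sin _)%:E; ring.
  - exact: L1_cst.
  - by move=> m x; apply: is_derive_eq; rewrite /GRing.scale/=; ring.
  - by move=> m x _; rewrite normrM ler_piMr.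
have d2 : is_derive (0 : R) (1 : R) (fun m : R => \int[nu]_x (sin (t * x + th) * tilt m x))
    (\int[nu]_x (sin (t * x + th) * (k * (x - 0) * tilt 0 x))).
  apply: (@is_derive_Rintegral _ _ _ nu (fun m x => sin (t * x + th) * tilt m x)
    (fun m x => sin (t * x + th) * (k * (x - m) * tilt m x))
    (fun x => k * expR ((k + 1) * `|x|))).
  - by move=> m; apply: L1_tilt => // x; exact: continuous_sin_affine.
  - exact/L1Z/L1_normal_expR.
  - by move=> m x; rewrite /tilt; apply: is_derive_eq; rewrite /GRing.scale/=; field.
  - move=> m x; rewrite subr0 => m1; rewrite normrM.
    rewrite -[leRHS]mul1r; apply: ler_pM => //.
    rewrite normrM [X in _ * X]ger0_norm ?expR_ge0// normrM (gtr0_norm k0).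
    rewrite -mulrA ler_pM2l// (_ : expR _ = expR `|x| * expR (k * `|x|)); last first.
      by rewrite -expRD mulrDl mul1r addrC.
    apply: ler_pM => //; first exact: expR_ge0.
    + apply: le_trans (expR_ge1Dx _); apply: (le_trans (ler_normB _ _)).
      by rewrite addrC lerD2r ltW.
    + apply: (le_trans (tilt_le _ _)); rewrite ler_expR -mulrA ler_pM2l//.
      by rewrite ler_piMl// ltW.
have E : (fun m => \int[nu]_x sin (t * (x + m) + th)) =
    (fun m => \int[nu]_x (sin (t * x + th) * tilt m x)).
  by apply/funext => m; exact: normal_shift_sin.
rewrite E in d1.
have := @derive_val _ _ _ _ _ _ _ d2; rewrite (@derive_val _ _ _ _ _ _ _ d1) => E2.
rewrite -RintegralZl//; last exact: L1_cos'.
transitivity (\int[nu]_x (t * cos (t * (x + 0) + th))).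
  rewrite E2; apply: eq_Rintegral => x _.
  by rewrite subr0 /tilt expr0n mul0r !mul0r subr0 mulr0 expR0; ring.
by apply: eq_Rintegral => x _; rewrite addr0.
Qed.

(** Stein's identity gives f' = - sigma^2 t f for f(t) = E cos(t x + th), so f(t) expR (sigma^2 t^2
    / 2) is constant; the values at 1 and 0 are compared. *)
Lemma normal_cos th :
  \int[nu]_x cos (x + th) = expR (- (sigma ^+ 2 / 2)) * cos th.
Proof.
pose f t := \int[nu]_x cos (t * x + th).
have ix : L1 nu (fun x => `|x|).
  apply: L1_le (L1_normal_expR 1) _ => [|x].
    by apply: continuous_measurable_fun; exact: norm_continuous.
  by rewrite normr_id mul1r (le_trans _ (expR_ge1Dx _))// lerDr.
have df t : is_derive t (1 : R) f (- (sigma ^+ 2 * (t * f t))).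
  have -> : - (sigma ^+ 2 * (t * f t)) = \int[nu]_x (- (x * sin (t * x + th))).
    rewrite /f -normal_stein -RintegralZl//.
      rewrite -mulN1r -RintegralZl//.
        by apply: eq_Rintegral => x _; rewrite /k; field.
      apply: L1_le ix _ => [|x].
        apply: continuous_measurable_fun => x; apply: cvgMr.
        apply: cvgM; last exact: continuous_sin_affine.
        by apply: cvgMr; exact: cvg_id.
      rewrite mulrA mulrA normrM -[leRHS]mulr1 ler_pM// normrM /k.
      by rewrite mulfV// normr1 mul1r.
    apply: L1_le (L1Z k ix) _ => [|x].
      apply: continuous_measurable_fun => x.
      apply: cvgM; last exact: continuous_sin_affine.
      by apply: cvgMr; exact: cvg_id.
    by rewrite normrM normrM (gtr0_norm k0) -[leRHS]mulr1 ler_pM// mulr_ge0// ltW.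
  apply: (@is_derive_Rintegral _ _ _ nu (fun t x => cos (t * x + th))
    (fun t x => - (x * sin (t * x + th))) (fun x => `|x|)).
  - by move=> ?; exact: L1_cos'.
  - exact: ix.
  - by move=> s x; apply: is_derive_eq; rewrite /GRing.scale/=; ring.
  - by move=> s x _; rewrite normrN normrM ler_piMr.
pose g t := f t * expR (sigma ^+ 2 * t ^+ 2 / 2).
have dg t : is_derive t (1 : R) g 0.
  by apply: is_derive_eq; rewrite /GRing.scale/=; field.
have g01 : g 1 = g 0.
  have cg : {within `[0, 1], continuous g}.
    apply: continuous_subspaceT => t; apply: differentiable_continuous.
    by apply/derivable1_diffP; exact: (@ex_derive _ _ _ _ _ _ _ (dg t)).
  have [c _] := @MVT R g (fun=> 0) 0 1 ltr01 (fun x _ => dg x) cg.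
  by rewrite mul0r => /eqP; rewrite subr_eq0 => /eqP.
have f0 : f 0 = cos th.
  rewrite /f; transitivity (\int[nu]_(x in setT) cos th); last by rewrite Rintegral_prob.
  by apply: eq_Rintegral => x _; rewrite mul0r add0r.
have f1 : f 1 = \int[nu]_x cos (x + th) by apply: eq_Rintegral => x _; rewrite mul1r.
move: g01; rewrite /g f0 f1 expr0n mulr0 mul0r expR0 mulr1 expr1n mulr1 => <-.
by rewrite mulrCA -expRD addNr expR0 mulr1.
Qed.

End Normal.

Section CenteredNormal.
Context d (Om : measurableType d) (R : realType) (Q : probability Om R).
Variables (W : Om -> R) (v : R).
Hypotheses (mW : measurable_fun setT W) (v0 : 0 <= v).
Hypothesis lawW : forall B : set R, measurable B -> Q (W @^-1` B) = centered_normal v B.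

Let mWR : @measurable_fun _ _ Om (measurableTypeR R) setT W.
Proof. by move=> _ B mB; exact: mW. Qed.

(* [normal_prob] lives on [measurableTypeR R], whose measurable sets are those
   of [R] under another display. *)
Let RV : {RV Q >-> measurableTypeR R} := @mfun_Sub _ _ Om (measurableTypeR R) W (mem_set mWR).

Lemma centered_normal_cos th :
  \int[Q]_w cos (W w + th) = expR (- (v / 2)) * cos th.
Proof.
have mc : measurable_fun setT (fun x : R => (cos (x + th))%:E).
  by apply/measurable_EFinP; exact: measurable_cosD.
have -> : \int[Q]_w cos (W w + th) = \int[distribution Q RV]_x cos (x + th).
  by rewrite /Rintegral integral_distribution//; exact: L1_cos.
have [vz|vn] := eqVneq v 0.
  rewrite /Rintegral (eq_measure_integral (\d_((0 : R) : measurableTypeR R))) => [|B mB _]; last first.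
    by rewrite [LHS]lawW// /centered_normal vz eqxx.
  by rewrite integral_dirac// diracE mem_set// mul1e/= add0r vz mul0r oppr0 expR0 mul1r.
have s0 : Num.sqrt v != 0 by rewrite sqrtr_eq0 -ltNge lt_def vn.
have := normal_cos s0 th; rewrite sqr_sqrtr// => <-.
rewrite /Rintegral; congr fine; apply: eq_measure_integral => B mB _.
by rewrite [LHS]lawW// /centered_normal (negbTE vn).
Qed.

Lemma centered_normal_expR u :
  (\int[Q]_w (expR (u * W w))%:E = (expR (u ^+ 2 * v / 2))%:E)%E.
Proof.
have mu' : measurable_fun setT (fun x : R => (expR (u * x))%:E).
  by apply/measurable_EFinP; apply: measurableT_comp => //; exact: measurable_funM.
have -> : (\int[Q]_w (expR (u * W w))%:E = \int[distribution Q RV]_x (expR (u * x))%:E)%E.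
  by rewrite ge0_integral_distribution// => x; rewrite lee_fin expR_ge0.
have [vz|vn] := eqVneq v 0.
  rewrite (eq_measure_integral (\d_((0 : R) : measurableTypeR R))) => [|B mB _]; last first.
    by rewrite [LHS]lawW// /centered_normal vz eqxx.
  by rewrite integral_dirac// diracE mem_set// mul1e/= mulr0 vz mulr0 mul0r.
have s0 : Num.sqrt v != 0 by rewrite sqrtr_eq0 -ltNge lt_def vn.
have := normal_expR s0 u; rewrite sqr_sqrtr// => <-.
apply: eq_measure_integral => B mB _.
by rewrite [LHS]lawW// /centered_normal (negbTE vn).
Qed.

End CenteredNormal.

Section GaussianVector.
Context d (Om : measurableType d) (R : realType) (Q : probability Om R) (K : nat).
Variables (Y : Om -> 'rV[R]_K) (S : 'M[R]_K).
Hypothesis gY : gaussian_vector Q Y S.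

Lemma gaussian_vector_cos (t : 'rV[R]_K) th :
  \int[Q]_w cos (\sum_k t 0 k * Y w 0 k + th) =
  expR (- ((t *m S *m t^T) 0 0 / 2)) * cos th.
Proof.
have [mY _ /(_ t)[v0 lawW]] := gY.
apply: (centered_normal_cos (W := fun w => \sum_k t 0 k * Y w 0 k)) => //.
by apply: measurable_sum => k; apply: measurable_funM.
Qed.

Lemma gaussian_vector_expR u k :
  (\int[Q]_w (expR (u * Y w 0%R k))%:E = (expR (u ^+ 2 * S k k / 2))%:E)%E.
Proof.
have [mY _ /(_ (delta_mx 0 k))[v0 lawW]] := gY.
have vE : ((delta_mx 0 k : 'rV[R]_K) *m S *m (delta_mx 0 k : 'rV[R]_K)^T) 0 0 = S k k.
  by rewrite -rowE trmx_delta -colE !mxE.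
have YE w : \sum_j (delta_mx 0 k : 'rV[R]_K) 0 j * Y w 0 j = Y w 0 k.
  rewrite (bigD1 k)//= big1 => [|j jk]; rewrite mxE ?eqxx ?mul1r ?addr0//.
  by rewrite (negbTE jk) andbF mul0r.
rewrite vE in v0 lawW.
apply: (centered_normal_expR (W := fun w => Y w 0 k)) => // B mB.
rewrite -lawW//; congr (Q _); apply/seteqP; split => w /=; by rewrite YE.
Qed.

End GaussianVector.

(** * Approximation by trigonometric polynomials *)

Section SinDistance.
Context (R : realType).

Lemma sin_abs_ge (x : R) : `|x| - `|x| ^+ 3 / 6 <= `|sin x|.
Proof.
wlog x0 : x / 0 <= x.
  move=> H; have [/H//|/ltW x0] := leP 0 x.
  by have := H (- x); rewrite sinN !normrN; apply; rewrite oppr_ge0.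
rewrite (ger0_norm x0); have := sin_ge x0; have := ler_norm (sin x); lra.
Qed.

Lemma cos_abs_ge (x : R) : 1 - x ^+ 2 / 2 <= `|cos x|.
Proof.
wlog x0 : x / 0 <= x.
  move=> H; have [/H//|/ltW x0] := leP 0 x.
  by have := H (- x); rewrite cosN sqrrN; apply; rewrite oppr_ge0.
have := cos_ge x0; have := ler_norm (cos x); lra.
Qed.

(** The range of [a] contains all values of the arcsine. In sin a - sin b = 2 cos p sin q, both |p|
    and |q| are at most 5/4 < pi/2, so |cos p| >= 7/32 and |sin q| >= (7/10) |q|, with product of
    the constants above 1/10. *)
Lemma sin_dist_ge (a b : R) : `|a| <= 2 -> `|b| <= 1 / 2 ->
  `|a - b| <= 10 * `|sin a - sin b|.
Proof.
move=> a2 b1; pose p := (a + b) / 2; pose q := (a - b) / 2.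
have p5 : `|p| <= 5 / 4.
  rewrite normrM (ger0_norm (x := 2^-1))//; have := ler_normD a b; lra.
have q5 : `|q| <= 5 / 4.
  rewrite normrM (ger0_norm (x := 2^-1))//; have := ler_normB a b; lra.
have -> : sin a - sin b = 2 * (cos p * sin q).
  have {1}-> : a = p + q by rewrite /p /q; field.
  have {1}-> : b = p - q by rewrite /p /q; field.
  by rewrite sinD sinB; ring.
have -> : a - b = 2 * q by rewrite /q; field.
rewrite (normrM 2 q) (normrM 2 (_ * _)) (normrM (cos p)) (ger0_norm (x := 2))//.
have p2 : p ^+ 2 <= 25 / 16.
  rewrite -[p ^+ 2]real_normK ?num_real//; have := normr_ge0 p; nra.
have cp : 7 / 32 <= `|cos p| by have := cos_abs_ge p; lra.
have sq : 7 / 10 * `|q| <= `|sin q|.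
  have := sin_abs_ge q; have := normr_ge0 q; have : `|q| ^+ 2 <= 25 / 16.
    by have := normr_ge0 q; nra.
  rewrite exprS; nra.
have := ler_pM (_ : 0 <= 7 / 32) (_ : 0 <= 7 / 10 * `|q|) cp sq.
have q0 := normr_ge0 q; have q1 : 0 <= 7 / 10 * `|q| by rewrite mulr_ge0.
by move=> /(_ _ q1); have -> : 0 <= 7 / 32 :> R by []; move=> /(_ isT); lra.
Qed.

End SinDistance.

Section Bernstein.
Context (R : realType).

(** Binomial probabilities with success probability [u], defined by conditioning on one trial. In
    this form they are built from [u] by sums and products, under which [trigonometric] is
    closed. *)
Fixpoint bernstein (n : nat) (u : R) (i : nat) : R :=
  if n is m.+1 then
    (1 - u) * bernstein m u i + (if i is j.+1 then u * bernstein m u j else 0)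
  else (i == 0%N)%:R.

Lemma bernstein_ge0 n u i : 0 <= u -> u <= 1 -> 0 <= bernstein n u i.
Proof.
move=> u0 u1; elim: n i => [|n IH] [|i] //=; last first.
  by rewrite addr_ge0// mulr_ge0// subr_ge0.
by rewrite addr0 mulr_ge0// subr_ge0.
Qed.

Lemma bernstein_big n u i : (n < i)%N -> bernstein n u i = 0.
Proof.
elim: n i => [|n IH] [|i] //= ni.
by rewrite !IH ?mulr0 ?addr0//; exact: ltnW.
Qed.

Definition bernstein_sum n u (phi : nat -> R) := \sum_(i < n.+1) bernstein n u i * phi i.

Lemma bernstein_sumS n u phi : bernstein_sum n.+1 u phi =
  (1 - u) * bernstein_sum n u phi + u * bernstein_sum n u (fun i => phi i.+1).
Proof.
rewrite /bernstein_sum !mulr_sumr.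
under eq_bigr => i _ do rewrite /= mulrDl.
rewrite big_split/=; congr (_ + _).
  rewrite big_ord_recr/= bernstein_big// mulr0 mul0r addr0.
  by apply: eq_bigr => i _; rewrite mulrA.
rewrite big_ord_recl/= mul0r add0r; apply: eq_bigr => i _.
by rewrite mulrA.
Qed.

Lemma bernstein_sum1 n u : bernstein_sum n u (fun=> 1) = 1.
Proof.
elim: n => [|n IH]; first by rewrite /bernstein_sum big_ord1 /= mulr1.
by rewrite bernstein_sumS IH; ring.
Qed.

(** Squared bias plus binomial variance. The centre [c] is arbitrary because the index shift in the
    recursion turns it into c - 1. *)
Lemma bernstein_sum_sqr n u c : bernstein_sum n u (fun i => (i%:R - c) ^+ 2) =
  (n%:R * u - c) ^+ 2 + n%:R * (u * (1 - u)).
Proof.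
elim: n c => [|n IH] c.
  by rewrite /bernstein_sum big_ord1 /= !mul0r addr0 mul1r.
rewrite bernstein_sumS IH.
have -> : bernstein_sum n u (fun i => (i.+1%:R - c) ^+ 2) =
    bernstein_sum n u (fun i => (i%:R - (c - 1)) ^+ 2).
  by apply: eq_bigr => i _; rewrite -natr1; congr (_ * _ ^+ 2); ring.
by rewrite IH -natr1; ring.
Qed.

End Bernstein.

Section Trig.
Context (R : realType) (K : nat).
Implicit Types (f g : 'rV[R]_K -> R) (x t : 'rV[R]_K).

Inductive trigonometric : ('rV[R]_K -> R) -> Prop :=
| trigonometric_cos t th : trigonometric (fun x => cos (\sum_k t 0 k * x 0 k + th))
| trigonometricD f g : trigonometric f -> trigonometric g ->
    trigonometric (fun x => f x + g x)
| trigonometricZ c f : trigonometric f -> trigonometric (fun x => c * f x).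

Lemma trigonometric_cst c : trigonometric (fun=> c).
Proof.
have := trigonometricZ c (trigonometric_cos 0 0); congr trigonometric.
apply/funext => x; rewrite big1 => [|k _]; first by rewrite addr0 cos0 mulr1.
by rewrite mxE mul0r.
Qed.

(** Bilinearity reduces this to two cosines, and the product-to-sum formula settles these. *)
Lemma trigonometricM f g : trigonometric f -> trigonometric g ->
  trigonometric (fun x => f x * g x).
Proof.
move=> tf tg; elim: tf => {f} [t th|f1 f2 _ IH1 _ IH2|c f _ IH]; last 2 first.
- have := trigonometricD IH1 IH2; congr trigonometric; apply/funext => x; ring.
- have := trigonometricZ c IH; congr trigonometric; apply/funext => x; ring.
elim: tg => {g} [t' th'|f1 f2 _ IH1 _ IH2|c f _ IH]; last 2 first.
- have := trigonometricD IH1 IH2; congr trigonometric; apply/funext => x; ring.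
- have := trigonometricZ c IH; congr trigonometric; apply/funext => x; ring.
have := trigonometricZ 2^-1 (trigonometricD (trigonometric_cos (t + t') (th + th'))
  (trigonometric_cos (t - t') (th - th'))).
congr trigonometric; apply/funext => x.
have -> : \sum_k (t + t') 0 k * x 0 k + (th + th') =
    (\sum_k t 0 k * x 0 k + th) + (\sum_k t' 0 k * x 0 k + th').
  rewrite addrACA -big_split/=; congr (_ + _).
  by apply: eq_bigr => k _; rewrite mxE mulrDl.
have -> : \sum_k (t - t') 0 k * x 0 k + (th - th') =
    (\sum_k t 0 k * x 0 k + th) - (\sum_k t' 0 k * x 0 k + th').
  rewrite opprD addrACA -sumrB; congr (_ + _).
  by apply: eq_bigr => k _; rewrite !mxE mulrBl.
by rewrite cosD cosB; field.
Qed.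

Lemma trigonometric_sum (I : Type) (s : seq I) (f : I -> 'rV[R]_K -> R) :
  (forall i, trigonometric (f i)) -> trigonometric (fun x => \sum_(i <- s) f i x).
Proof.
move=> tf; elim: s => [|i s IH].
  by under eq_fun do rewrite big_nil; exact: trigonometric_cst.
by under eq_fun do rewrite big_cons; exact: trigonometricD.
Qed.

Lemma trigonometric_prod (I : Type) (s : seq I) (f : I -> 'rV[R]_K -> R) :
  (forall i, trigonometric (f i)) -> trigonometric (fun x => \prod_(i <- s) f i x).
Proof.
move=> tf; elim: s => [|i s IH].
  by under eq_fun do rewrite big_nil; exact: trigonometric_cst.
by under eq_fun do rewrite big_cons; exact: trigonometricM.
Qed.

Lemma trigonometric_sin om k : trigonometric (fun x => sin (om * x 0 k)).
Proof.
have := trigonometric_cos (om *: delta_mx 0 k) (- (pi / 2)); congr trigonometric.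
apply/funext => x; rewrite cosB cos_pihalf sin_pihalf mulr0 mulr1 add0r; congr sin.
rewrite (bigD1 k)//= big1 => [|j jk]; rewrite !mxE ?eqxx ?mulr1 ?addr0//.
by rewrite (negbTE jk) andbF mulr0 mul0r.
Qed.

Lemma trigonometric_bernstein n (u : 'rV[R]_K -> R) i : trigonometric u ->
  trigonometric (fun x => bernstein n (u x) i).
Proof.
move=> tu; elim: n i => [|n IH] [|i] /=; try exact: trigonometric_cst.
  under eq_fun do rewrite addr0.
  apply: trigonometricM => //; apply: trigonometricD; first exact: trigonometric_cst.
  by under eq_fun do rewrite -mulN1r; exact: trigonometricZ.
apply: trigonometricD; apply: trigonometricM => //.
apply: trigonometricD; first exact: trigonometric_cst.
by under eq_fun do rewrite -mulN1r; exact: trigonometricZ.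
Qed.

(** Only [x] is confined to the box: Bernstein nodes close to [x] may lie outside it. *)
Lemma uniformly_continuous_box (f : 'rV[R]_K -> R) (M e : R) : continuous f -> 0 < e ->
  exists2 h : R, 0 < h & forall x y : 'rV[R]_K, (forall k, `|x 0 k| <= M) ->
    (forall k, `|x 0 k - y 0 k| < h) -> `|f x - f y| <= e.
Proof.
move=> cf e0.
have cB : compact [set v : 'rV[R]_K | forall k, (`[- M, M]%classic : set R) (v ord0 k)].
  by apply: (@rV_compact R K (fun=> `[- M, M]%classic)) => i; exact: segment_compact.
have := (compact_near_coveringP _).1 cB nat \oo
  (fun n (x : 'rV[R]_K) => forall y : 'rV[R]_K, (forall k, `|x 0 k - y 0 k| < n.+1%:R^-1) -> `|f x - f y| <= e) _.
case=> [x _|N _ /(_ N (leqnn N)) H]; last first.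
  exists (N.+1%:R^-1); first by rewrite invr_gt0.
  by move=> x y xM; apply: H => k; rewrite /= in_itv/= -ler_norml.
have e2 : 0 < e / 2 by rewrite divr_gt0.
have /cvgr_dist_lt/(_ _ e2)/nbhs_ballP[d /= d0 xd] := cf x.
have d2 : 0 < d / 2 by rewrite divr_gt0.
exists (ball x (d / 2), [set n | n.+1%:R^-1 < d / 2]) => /=.
  split; first exact: nbhsx_ballx.
  exact: (near_infty_natSinv_lt (PosNum d2)).
move=> [x' n] /= [[_ xx'] nd] y x'y.
have k1 : `|f x - f x'| < e / 2.
  apply: xd; split => // i j; have := xx' i j; rewrite /ball/= => h.
  by apply: (lt_trans h); lra.
have k2 : `|f x - f y| < e / 2.
  apply: xd; split => // i j; have := xx' i j; rewrite /ball/= (ord1 i) => h.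
  apply: (le_lt_trans (ler_distD (x' 0 j) _ _)).
  rewrite (_ : d = d / 2 + d / 2); last by field.
  by apply: ltrD; [exact: h|exact: lt_trans (x'y j) nd].
apply: (le_trans (ler_distD (f x) _ _)); rewrite (distrC (f x')); lra.
Qed.

(** Bernstein approximation in the variables u_k = (1 + sin(om x_k)) / 2, with product binomial
    weights [W j] and nodes [a j] at which u_k = j_k / n. Inside the box, nodes close to [x] are
    handled by uniform continuity and the others by Chebyshev's inequality. Outside it the sum of
    the (x_k / M)^2 is at least 1, which pays for the trivial bound 2 B. *)
Lemma trigonometric_approx (f : 'rV[R]_K -> R) (B M e : R) : continuous f ->
  (forall x, `|f x| <= B) -> 0 < M -> 0 < e ->
  exists2 q, trigonometric q & forall x,
    `|f x - q x| <= e + 2 * B * \sum_k (x 0 k / M) ^+ 2.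
Proof.
move=> cf fB M0 e0.
have B0 : 0 <= B by apply: le_trans (fB 0).
have e2 : 0 < e / 2 by rewrite divr_gt0.
have [h h0 Hh] := uniformly_continuous_box M cf e2.
(* On the box, om x_k stays in [-1/2, 1/2], where the sine can be inverted. By [sin_dist_ge], |j_k /
   n - u_k| < d forces the distance of x_k from its node below 2 M times 20 d, which is h. *)
pose om := (2 * M)^-1; pose d := h / (40 * M).
have om0 : 0 < om by rewrite invr_gt0 mulr_gt0.
have d0 : 0 < d by rewrite divr_gt0// mulr_gt0.
(* Chebyshev's inequality costs 2 B K / (n d^2), at most e / 2 for this [n]. *)
pose n := (Num.truncn (4 * (B * K%:R) / (d ^+ 2 * e))).+1.
have n0 : 0 < n%:R :> R by rewrite ltr0n.
have nB : 4 * (B * K%:R) <= n%:R * (d ^+ 2 * e).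
  rewrite -ler_pdivrMr; first exact/ltW/truncnS_gt.
  by rewrite mulr_gt0// exprn_gt0.
pose u k (x : 'rV[R]_K) := 2^-1 * (1 + sin (om * x 0 k)).
have u01 k x : 0 <= u k x /\ u k x <= 1.
  by have := sin_geN1 (om * x 0 k); have := sin_le1 (om * x 0 k); rewrite /u; lra.
pose s (i : 'I_n.+1) : R := 2 * (i%:R / n%:R) - 1.
have s1 i : -1 <= s i <= 1.
  have h1 : 0 <= i%:R / n%:R :> R by rewrite divr_ge0.
  have h2 : i%:R / n%:R <= 1 :> R by rewrite ler_pdivrMr// mul1r ler_nat -ltnS.
  by rewrite /s; apply/andP; split; lra.
pose a (j : {ffun 'I_K -> 'I_n.+1}) : 'rV[R]_K := \row_k (asin (s (j k)) / om).
pose W (j : {ffun 'I_K -> 'I_n.+1}) x := \prod_k bernstein n (u k x) (j k).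
have W0 j x : 0 <= W j x.
  by apply: prodr_ge0 => k _; apply: bernstein_ge0; have [] := u01 k x.
have W1 x : \sum_j W j x = 1.
  rewrite -(bigA_distr_bigA (fun k (i : 'I_n.+1) => bernstein n (u k x) i)) big1// => k _.
  have := bernstein_sum1 n (u k x); rewrite /bernstein_sum.
  by move=> <-; apply: eq_bigr => i _; rewrite mulr1.
(* The weights factor over the coordinates, so only the binomial variance n u (1 - u) in coordinate
   [k] remains. *)
have W2 k x : \sum_j W j x * ((j k)%:R - n%:R * u k x) ^+ 2 <= n%:R.
  pose F k' (i : 'I_n.+1) : R := bernstein n (u k' x) i *
    (if k' == k then (i%:R - n%:R * u k x) ^+ 2 else 1).
  have -> : \sum_j W j x * ((j k)%:R - n%:R * u k x) ^+ 2 =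
      \sum_(j : {ffun 'I_K -> 'I_n.+1}) \prod_k' F k' (j k').
    apply: eq_bigr => j _; rewrite /F big_split/=; congr (_ * _).
    by rewrite -big_mkcond/= big_pred1_eq.
  rewrite -(bigA_distr_bigA F) (bigD1 k)//= [X in _ * X]big1 => [|k' kk']; last first.
    have := bernstein_sum1 n (u k' x); rewrite /bernstein_sum => <-.
    by apply: eq_bigr => i _; rewrite /F (negbTE kk').
  have := bernstein_sum_sqr n (u k x) (n%:R * u k x); rewrite /bernstein_sum /F eqxx mulr1 => ->.
  rewrite subrr expr0n add0r ler_piMr//; have [] := u01 k x; nra.
exists (fun x => \sum_j f (a j) * W j x).
  apply: trigonometric_sum => j; apply: trigonometricZ; apply: trigonometric_prod => k.
  apply: trigonometric_bernstein; apply: trigonometricZ; apply: trigonometricD.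
    exact: trigonometric_cst.
  exact: trigonometric_sin.
move=> x.
have -> : f x - \sum_j f (a j) * W j x = \sum_j (f x - f (a j)) * W j x.
  by under [RHS]eq_bigr do rewrite mulrBl; rewrite sumrB -mulr_sumr W1 mulr1.
apply: (le_trans (ler_norm_sum _ _ _)).
have near2 j : `|f x - f (a j)| <= 2 * B.
  by apply: (le_trans (ler_normB _ _)); have := fB x; have := fB (a j); lra.
have sum0 : 0 <= \sum_k (x 0 k / M) ^+ 2 by apply: sumr_ge0 => k _; exact: sqr_ge0.
have [/forallP xM|/forallPn[k xk]] := boolP [forall k, `|x 0 k| <= M]; last first.
  apply: (@le_trans _ _ (\sum_j 2 * B * W j x)).
    by apply: ler_sum => j _; rewrite normrM (ger0_norm (W0 j x)) ler_wpM2r.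
  rewrite -mulr_sumr W1.
  have k1 : 1 <= \sum_k (x 0 k / M) ^+ 2.
    rewrite (bigD1 k)//=; apply: (@le_trans _ _ ((x 0 k / M) ^+ 2)).
      rewrite -[leRHS]real_normK ?num_real// exprn_ege1// normrM (gtr0_norm (x := M^-1)) ?invr_gt0//.
      by rewrite ler_pdivlMr// mul1r ltW// ltNge.
    by rewrite lerDl sumr_ge0// => j _; exact: sqr_ge0.
  have : 2 * B * 1 <= 2 * B * \sum_k (x 0 k / M) ^+ 2.
    by apply: ler_wpM2l => //; rewrite mulr_ge0.
  lra.
(* [D j] is at least 1 as soon as one coordinate j_k / n differs from u_k by [d] or more. *)
pose D (j : {ffun 'I_K -> 'I_n.+1}) : R :=
  \sum_k ((j k)%:R - n%:R * u k x) ^+ 2 / (n%:R * d) ^+ 2.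
have D0 (j : {ffun 'I_K -> 'I_n.+1}) : 0 <= D j.
  by apply: sumr_ge0 => k _; rewrite divr_ge0// sqr_ge0.
have bound j : `|f x - f (a j)| <= e / 2 + 2 * B * D j.
  have [/forallP jd|/forallPn[k jk]] :=
      boolP [forall k, `|(j k)%:R / n%:R - u k x| < d].
    apply: (@le_trans _ _ (e / 2)); last by rewrite lerDl mulr_ge0// mulr_ge0.
    apply: Hh => // k; rewrite mxE; set al := asin _.
    have al2 : `|al| <= 2.
      rewrite ler_norml; apply/andP; split.
        by apply: le_trans (asin_geNpi2 (s1 _)); rewrite lerN2 ltW// pihalf_lt2.
      by apply: (le_trans (asin_lepi2 (s1 _))); rewrite ltW// pihalf_lt2.
    have be1 : `|om * x 0 k| <= 1 / 2.
      rewrite normrM (gtr0_norm om0) /om invfM mul1r -mulrA ler_piMr//.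
      by rewrite mulrC ler_pdivrMr// mul1r; exact: xM.
    have := sin_dist_ge al2 be1; rewrite asinK; last by rewrite in_itv/= s1.
    have -> : s (j k) - sin (om * x 0 k) = 2 * ((j k)%:R / n%:R - u k x) by rewrite /s /u; field; rewrite gt_eqF.
    rewrite normrM (ger0_norm (x := 2))// => dist.
    have -> : x 0 k - al / om = - ((2 * M) * (al - om * x 0 k)).
      by rewrite /om invrK; field; rewrite gt_eqF.
    rewrite normrN normrM (gtr0_norm (x := 2 * M)) ?mulr_gt0//.
    have := jd k; rewrite /d ltr_pdivlMr ?mulr_gt0// => jdk.
    have : 2 * M * `|al - om * x 0 k| <= 2 * M * (10 * (2 * `|(j k)%:R / n%:R - u k x|)).
      by apply: ler_wpM2l => //; rewrite mulr_ge0// ltW.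
    lra.
  apply: (le_trans (near2 j)).
  have : 2 * B * 1 <= 2 * B * D j.
    apply: ler_wpM2l; first by rewrite mulr_ge0.
    rewrite /D (bigD1 k)//=.
    apply: (@le_trans _ _ (((j k)%:R - n%:R * u k x) ^+ 2 / (n%:R * d) ^+ 2)).
      rewrite ler_pdivlMr; last by rewrite exprn_gt0// mulr_gt0.
      have nd0 : 0 <= n%:R * d by apply: mulr_ge0 => //; exact: ltW.
      rewrite mul1r -[leRHS]real_normK ?num_real// lerXn2r ?nnegrE//.
      have -> : (j k)%:R - n%:R * u k x = n%:R * ((j k)%:R / n%:R - u k x).
        by field; rewrite gt_eqF.
      by rewrite normrM (gtr0_norm n0) ler_pM2l// leNgt.
    by rewrite lerDl sumr_ge0// => k' _; rewrite divr_ge0// sqr_ge0.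
  lra.
apply: (@le_trans _ _ (\sum_j (e / 2 * W j x + 2 * B * (D j * W j x)))).
  apply: ler_sum => j _; rewrite normrM (ger0_norm (W0 j x)) mulrA -mulrDl.
  by rewrite ler_wpM2r.
rewrite big_split/= -!mulr_sumr W1 mulr1.
have -> : \sum_j D j * W j x =
    (n%:R * d) ^- 2 * \sum_k \sum_j W j x * ((j k)%:R - n%:R * u k x) ^+ 2.
  rewrite exchange_big mulr_sumr; apply: eq_bigr => j _.
  by rewrite /D mulr_suml mulr_sumr; apply: eq_bigr => k _; ring.
have DK : (n%:R * d) ^- 2 * \sum_k \sum_j W j x * ((j k)%:R - n%:R * u k x) ^+ 2 <=
    (n%:R * d) ^- 2 * (K%:R * n%:R).
  apply: ler_wpM2l; first by rewrite invr_ge0 sqr_ge0.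
  apply: (@le_trans _ _ (\sum_(k < K) n%:R)); first exact: ler_sum.
  by rewrite sumr_const card_ord mulr_natl.
have : 2 * B * ((n%:R * d) ^- 2 * (K%:R * n%:R)) <= e / 2.
  have -> : 2 * B * ((n%:R * d) ^- 2 * (K%:R * n%:R)) = 2 * (B * K%:R) / (n%:R * d ^+ 2).
    by field; rewrite !gt_eqF.
  rewrite ler_pdivrMr; last by rewrite mulr_gt0// exprn_gt0.
  lra.
have : 2 * B * ((n%:R * d) ^- 2 * \sum_k \sum_j W j x * ((j k)%:R - n%:R * u k x) ^+ 2) <=
    2 * B * ((n%:R * d) ^- 2 * (K%:R * n%:R)).
  by apply: ler_wpM2l => //; rewrite mulr_ge0.
have : 0 <= 2 * B * \sum_k (x 0 k / M) ^+ 2 by rewrite mulr_ge0// mulr_ge0.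
lra.
Qed.

End Trig.

(** * Continuity, norms and measurability for vectors *)

Section ContinuousVector.
Context (R : realType) (K : nat).
Implicit Types (f g : 'rV[R]_K -> R) (x : 'rV[R]_K).

Lemma continuous_sum (I : Type) (s : seq I) (f : I -> 'rV[R]_K -> R) :
  (forall i, continuous (f i)) -> continuous (fun x => \sum_(i <- s) f i x).
Proof.
move=> cf; elim: s => [|i s IH].
  have -> : (fun x => \sum_(i <- [::]) f i x) = (fun=> 0).
    by apply/funext => x; rewrite big_nil.
  by move=> x; exact: cst_continuous.
have -> : (fun x => \sum_(j <- i :: s) f j x) = (fun x => f i x + \sum_(j <- s) f j x).
  by apply/funext => x; rewrite big_cons.
by move=> x; apply: continuousD; [exact: cf|exact: IH].
Qed.

Lemma continuous_prod (I : Type) (s : seq I) (f : I -> 'rV[R]_K -> R) :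
  (forall i, continuous (f i)) -> continuous (fun x => \prod_(i <- s) f i x).
Proof.
move=> cf; elim: s => [|i s IH].
  have -> : (fun x => \prod_(i <- [::]) f i x) = (fun=> 1).
    by apply/funext => x; rewrite big_nil.
  by move=> x; exact: cst_continuous.
have -> : (fun x => \prod_(j <- i :: s) f j x) = (fun x => f i x * \prod_(j <- s) f j x).
  by apply/funext => x; rewrite big_cons.
by move=> x; apply: continuousM; [exact: cf|exact: IH].
Qed.

Lemma continuous_expn f n : continuous f -> continuous (fun x => f x ^+ n).
Proof.
move=> cf; elim: n => [|n IH]; first by move=> x; exact: cst_continuous.
have -> : (fun x => f x ^+ n.+1) = (fun x => f x * f x ^+ n).
  by apply/funext => x; rewrite exprS.
by move=> x; exact: (continuousM (cf x) (IH x)).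
Qed.

Lemma trigonometric_continuous f : trigonometric f -> continuous f.
Proof.
elim => {f} [t th|f g _ cf _ cg|c f _ cf] x.
- apply: (@continuous_comp _ _ _ (fun y : 'rV[R]_K => \sum_k t 0 k * y 0 k + th) (@cos R)).
    apply: continuousD; last exact: cst_continuous.
    apply: continuous_sum => k y.
    by apply: continuousM; [exact: cst_continuous|exact: coord_continuous].
  exact: continuous_cos.
- by apply: continuousD; [exact: cf|exact: cg].
- by apply: continuousM; [exact: cst_continuous|exact: cf].
Qed.

Lemma trigonometric_bounded f : trigonometric f -> exists B, forall x, `|f x| <= B.
Proof.
elim => {f} [t th|f g _ [B fB] _ [D gD]|c f _ [B fB]].
- by exists 1 => x; rewrite ler_norml cos_geN1 cos_le1.
- by exists (B + D) => x; apply: (le_trans (ler_normD _ _)); exact: lerD.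
- by exists (`|c| * B) => x; rewrite normrM ler_wpM2l.
Qed.

Lemma continuous_powR_norm (s : R) : 0 < s -> continuous (fun y : R => `|y| `^ s).
Proof.
move=> s0 y; have [->|y0] := eqVneq y 0.
  apply/cvgrPdist_lt => e e0; rewrite normr0 powR0 ?gt_eqF//.
  near=> z; rewrite sub0r normrN (ger0_norm (powR_ge0 _ _)).
  have -> : e = (e `^ s^-1) `^ s by rewrite -powRrM mulVf ?gt_eqF// powRr1// ltW.
  apply: gt0_ltr_powR => //; rewrite ?nnegrE ?powR_ge0//.
  rewrite -[z]opprK normrN -[- z]add0r; near: z; apply: cvgr_dist_lt; last exact: powR_gt0.
  exact: cvg_id.
have ny : 0 < `|y| by rewrite normr_gt0.
have cE : {for y, continuous (fun z : R => expR (s * ln `|z|))}.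
  apply: (@continuous_comp _ _ _ (fun z : R => s * ln `|z|) (@expR R)); last exact: continuous_expR.
  apply: cvgMr; apply: (@continuous_comp _ _ _ (@Num.norm R R) (@ln R)); first exact: norm_continuous.
  exact: continuous_ln.
have E (z : R) : z != 0 -> `|z| `^ s = expR (s * ln `|z|).
  by move=> z0; rewrite /powR normr_eq0 (negbTE z0).
rewrite /continuous_at E//; apply: cvg_trans cE; apply: near_eq_cvg.
near=> z; rewrite E//; near: z.
exists `|y| => //= z yz; apply: contraTneq yz => ->; rewrite /= subr0 ltxx.
Unshelve. all: by end_near. Qed.

Lemma continuous_euclidean_norm_powR (s : R) : 0 < s ->
  continuous (fun x : 'rV[R]_K => euclidean_norm x `^ s).
Proof.
move=> s0 x.
have -> : (fun x : 'rV[R]_K => euclidean_norm x `^ s) =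
    (fun x : 'rV[R]_K => `|euclidean_norm x| `^ s).
  by apply/funext => y; rewrite ger0_norm// sqrtr_ge0.
apply: (@continuous_comp _ _ _ (@euclidean_norm R K) (fun y : R => `|y| `^ s)); last exact: continuous_powR_norm.
apply: (@continuous_comp _ _ _ (fun y : 'rV[R]_K => \sum_k y 0 k ^+ 2) (@Num.sqrt R)); last exact: sqrt_continuous.
by apply: continuous_sum => k; apply: continuous_expn => y; exact: coord_continuous.
Qed.

Lemma continuous_monomial m : continuous (@monomial R K m).
Proof.
by apply: continuous_prod => k; apply: continuous_expn => y; exact: coord_continuous.
Qed.

Lemma coord_le_norm x k : `|x 0 k| <= euclidean_norm x.
Proof.
rewrite -sqrtr_sqr ler_wsqrtr// (bigD1 k)//= lerDl.
by apply: sumr_ge0 => j _; exact: sqr_ge0.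
Qed.

Lemma monomial_le_norm m x :
  `|monomial m x| <= euclidean_norm x ^+ (\sum_k m k)%N.
Proof.
rewrite /monomial normr_prod -prodrXr; apply: ler_prod => k _.
by rewrite normr_ge0/= normrX lerXn2r ?nnegrE ?sqrtr_ge0// coord_le_norm.
Qed.

Lemma norm_powR_le (r : R) x : 0 < r ->
  euclidean_norm x `^ r <= K%:R `^ r * \sum_k `|x 0 k| `^ r.
Proof.
move=> r0; set s := \sum_k _; have s0 : 0 <= s by apply: sumr_ge0 => k _; exact: powR_ge0.
(* Every coordinate is at most [m] in absolute value, so the norm is at most sqrt K m <= K m. *)
pose m := s `^ r^-1; have m0 : 0 <= m by exact: powR_ge0.
have sE : s = m `^ r by rewrite /m -powRrM mulVf ?gt_eqF// powRr1.
rewrite sE -powRM//; apply: powR_homo; [exact: ltW|exact: sqrtr_ge0|].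
have xm k : `|x 0 k| <= m.
  have -> : `|x 0 k| = (`|x 0 k| `^ r) `^ r^-1.
    by rewrite -powRrM mulfV ?gt_eqF// powRr1.
  apply: powR_homo; rewrite ?invr_ge0 ?(ltW r0) ?powR_ge0//.
  by rewrite /s (bigD1 k)//= lerDl sumr_ge0// => j _; exact: powR_ge0.
have Km0 : 0 <= K%:R * m by rewrite mulr_ge0.
rewrite /euclidean_norm -[leRHS](ger0_norm Km0) -sqrtr_sqr ler_wsqrtr// exprMn.
apply: (@le_trans _ _ (\sum_(k < K) m ^+ 2)).
  apply: ler_sum => k _; rewrite -[leLHS]real_normK ?num_real//.
  by rewrite lerXn2r ?nnegrE.
rewrite sumr_const card_ord -[_ *+ K]mulr_natl; apply: ler_wpM2r; first exact: sqr_ge0.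
by rewrite -natrX ler_nat; case: (K) => // n; rewrite expnS leq_pmulr// expn_gt0.
Qed.

End ContinuousVector.

Section VectorMeasurability.
Context d (Om : measurableType d) (R : realType) (K : nat).

Definition measurable_coords (Y : Om -> 'rV[R]_K) :=
  forall k, measurable_fun setT (fun w => Y w 0 k).

(* [Y] is the pointwise limit of vectors with countably many values. *)
Lemma measurable_continuous_vector Y (f : 'rV[R]_K -> R) : measurable_coords Y ->
  continuous f -> measurable_fun setT (fun w => f (Y w)).
Proof.
move=> mY cf.
pose a n w : 'rV[R]_K := \row_k ((Num.floor (n.+1%:R * Y w 0 k))%:~R / n.+1%:R).
apply: (@measurable_fun_cvg _ _ _ _ (fun n w => f (a n w))) => [n|w _].
  have dF : discrete (fun w => [ffun k => Num.floor (n.+1%:R * Y w 0 k)]).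
    apply: discrete_ffun => k z.
    have mk : measurable_fun setT (fun w => n.+1%:R * Y w 0 k) by exact: measurable_funM.
    rewrite (_ : _ @^-1` _ = setT `&`
        (fun w => n.+1%:R * Y w 0 k) @^-1` `[z%:~R, (z + 1)%:~R[%classic).
      exact: mk.
    apply/seteqP; split => w /=; rewrite in_itv/=.
      by move=> <-; split => //; exact: floor_itv.
    by move=> [_]; exact: floor_def.
  have := discrete_measurableR
    (fun c : {ffun 'I_K -> int} => f (\row_k ((c k)%:~R / n.+1%:R))) dF.
  congr measurable_fun; apply/funext => w; congr f.
  by apply/rowP => k; rewrite !mxE ffunE.
apply: (@cvg_comp _ _ _ (fun n => a n w) f); last exact: cf.
apply/cvg_ballP => e e0.
have := near_infty_natSinv_lt (PosNum e0); apply: filterS => n ne.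
split => // i k; rewrite /ball/= mxE (ord1 i).
have n0 : 0 < n.+1%:R :> R by rewrite ltr0n.
have /andP[f1 f2] := floor_itv (n.+1%:R * Y w 0 k).
apply: le_lt_trans ne; rewrite -[X in X - _](mulKf (lt0r_neq0 n0)) [_ / _]mulrC -mulrBr.
rewrite normrM (gtr0_norm (x := _^-1)) ?invr_gt0// ler_piMr ?invr_ge0 ?(ltW n0)//.
by rewrite ger0_norm ?subr_ge0// lerBlDl; move: f2; rewrite intrD; exact: ltW.
Qed.

End VectorMeasurability.

Section VectorIntegral.
Context d (Om : measurableType d) (R : realType) (P : probability Om R) (K : nat).
Implicit Types (f q : 'rV[R]_K -> R) (X : Om -> 'rV[R]_K).

Lemma L1_vector f X B : measurable_coords X -> continuous f ->
  (forall x, `|f x| <= B) -> L1 P (fun w => f (X w)).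
Proof.
move=> mX cf fB; apply: (@L1_bounded _ _ _ _ _ B) => //.
exact: measurable_continuous_vector.
Qed.

Lemma L1_powR (g : Om -> R) (q : R) : measurable_fun setT g -> 1 <= q ->
  L1 P (fun w => `|g w| `^ q) -> L1 P g.
Proof.
move=> mg q1 ig; apply: L1_le mg (L1D (L1_cst P 1) ig) _ => w.
have := powR_interpolation (normr_ge0 (g w)) ltr01 ler01 q1.
by rewrite !powR1 powRr1// mul1r.
Qed.

(** (|g + B| - |g - B|) / 2 is [g] clamped to [-B, B]. Where |g| > B the error is at most |g| <=
    |g|^q / B^(q-1), and B^(q-1) = t. *)
Lemma truncation_error (g : Om -> R) (q C t B : R) : measurable_fun setT g -> 1 < q -> 0 < t ->
  L1 P (fun w => `|g w| `^ q) -> \int[P]_w (`|g w| `^ q) <= C ->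
  B = t `^ (q - 1)^-1 ->
  `|\int[P]_w g w - \int[P]_w ((`|g w + B| - `|g w - B|) / 2)| <= C / t.
Proof.
move=> mg q1 t0 ig gC Bdef.
have q0 : 0 < q - 1 by rewrite subr_gt0.
have B0 : 0 < B by rewrite Bdef powR_gt0.
have BE : B `^ (q - 1) = t by rewrite Bdef -powRrM mulVf ?gt_eqF// powRr1// ltW.
have i1 := L1_powR mg (ltW q1) ig.
have i2 : L1 P (fun w => (`|g w + B| - `|g w - B|) / 2).
  have := L1Z 2^-1 (L1B (L1_abs (L1D i1 (L1_cst P B))) (L1_abs (L1B i1 (L1_cst P B)))).
  by congr L1; apply/funext => w; rewrite mulrC.
apply: (le_trans (Rintegral_close i1 i2)).
apply: (@le_trans _ _ (\int[P]_w (t^-1 * `|g w| `^ q))); last first.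
  by rewrite RintegralZl// mulrC ler_wpM2r// invr_ge0 ltW.
apply: le_Rintegral => //; [exact/L1_abs/L1B|exact: L1Z|move=> w _].
set y := g w; have [yB|By] := leP `|y| B.
  have -> : (`|y + B| - `|y - B|) / 2 = y.
    move: yB; rewrite ler_norml => /andP[y1 y2].
    by rewrite ger0_norm ?ler0_norm ?subr_le0//; [field|lra].
  by rewrite subrr normr0 mulr_ge0 ?powR_ge0// invr_ge0 ltW.
apply: (@le_trans _ _ `|y|).
  case: (ger0P y) By => y0 By.
    rewrite (ger0_norm (x := y + B)) ?(ger0_norm (x := y - B)) ?subr_ge0 ?(ltW By)//; last lra.
    by rewrite ger0_norm; lra.
  rewrite (ler0_norm (x := y + B)) ?(ler0_norm (x := y - B)); [|lra|lra].
  by rewrite ler0_norm; lra.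
rewrite mulrC ler_pdivlMr// -(mulr_powRB1 (normr_ge0 y)); last by lra.
by rewrite ler_wpM2l// -BE; apply: powR_homo; lra.
Qed.

End VectorIntegral.

(** * From characteristic functions to test functions and moments *)

Section Close.
Context (R : realType) (K : nat).
Context d (Om : measurableType d) (P : probability Om R).
Context d' (Om' : measurableType d') (Q : probability Om' R).
Variables (X : R -> Om -> 'rV[R]_K) (Y : R -> Om' -> 'rV[R]_K) (L0 : R).
Hypothesis mX : forall l, L0 <= l -> measurable_coords (X l).
Hypothesis mY : forall l, L0 <= l -> measurable_coords (Y l).
Implicit Types (f g q : 'rV[R]_K -> R).

Definition close f := forall e, 0 < e -> exists L, forall l, L <= l ->
  `|\int[P]_w f (X l w) - \int[Q]_w f (Y l w)| <= e.

Hypothesis hcos : forall (t : 'rV[R]_K) (th : R), close (fun x => cos (\sum_k t 0 k * x 0 k + th)).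

Lemma close_trigonometric f : trigonometric f -> close f.
Proof.
elim => {f} [//|f g tf cf tg cg|c f tf cf] e e0.
  have e2 : 0 < e / 2 by rewrite divr_gt0.
  have [L HL] := cf _ e2; have [L' HL'] := cg _ e2.
  have [B fB] := trigonometric_bounded tf; have [D gD] := trigonometric_bounded tg.
  exists (Num.max L0 (Num.max L L')) => l; rewrite !ge_max => /and3P[l0 l1 l2].
  have iX := L1_vector P (mX l0) (trigonometric_continuous tf) fB.
  have iX' := L1_vector P (mX l0) (trigonometric_continuous tg) gD.
  have iY := L1_vector Q (mY l0) (trigonometric_continuous tf) fB.
  have iY' := L1_vector Q (mY l0) (trigonometric_continuous tg) gD.
  rewrite !RintegralD// opprD addrACA; apply: (le_trans (ler_normD _ _)).
  have := HL l l1; have := HL' l l2; lra.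
have c1 : 0 < `|c| + 1 by rewrite ltr_wpDl.
have [L HL] := cf _ (divr_gt0 e0 c1).
have [B fB] := trigonometric_bounded tf.
exists (Num.max L0 L) => l; rewrite !ge_max => /andP[l0 l1].
have iX := L1_vector P (mX l0) (trigonometric_continuous tf) fB.
have iY := L1_vector Q (mY l0) (trigonometric_continuous tf) fB.
rewrite !RintegralZl// -mulrBr normrM.
apply: (@le_trans _ _ (`|c| * (e / (`|c| + 1)))); first by rewrite ler_wpM2l// HL.
by rewrite mulrCA ler_piMr ?ltW// ltr_pdivrMr// mul1r ltrDl.
Qed.

Variable V : R.
Hypothesis V0 : 0 <= V.
Hypothesis tightX : forall l, L0 <= l -> L1 P (fun w => \sum_k X l w 0 k ^+ 2) /\
  \int[P]_w (\sum_k X l w 0 k ^+ 2) <= V.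
Hypothesis tightY : forall l, L0 <= l -> L1 Q (fun w => \sum_k Y l w 0 k ^+ 2) /\
  \int[Q]_w (\sum_k Y l w 0 k ^+ 2) <= V.

Lemma approx_error dd (O : measurableType dd) (S : probability O R) (W : O -> 'rV[R]_K)
    f q a b : measurable_coords W -> L1 S (fun w => f (W w)) -> L1 S (fun w => q (W w)) ->
  0 <= b -> (forall x, `|f x - q x| <= a + b * \sum_k x 0 k ^+ 2) ->
  L1 S (fun w => \sum_k W w 0 k ^+ 2) -> \int[S]_w (\sum_k W w 0 k ^+ 2) <= V ->
  `|\int[S]_w f (W w) - \int[S]_w q (W w)| <= a + b * V.
Proof.
move=> mW i1 i2 b0 fq iW WV; apply: (le_trans (Rintegral_close i1 i2)).
apply: (@le_trans _ _ (\int[S]_w (a + b * \sum_k W w 0 k ^+ 2))).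
  apply: le_Rintegral => //; [exact/L1_abs/L1B|apply: L1D; [exact: L1_cst|exact: L1Z]].
rewrite RintegralD//; [|exact: L1_cst|exact: L1Z].
by rewrite Rintegral_prob RintegralZl// lerD2l ler_wpM2l.
Qed.

Lemma close_bounded f B : continuous f -> (forall x, `|f x| <= B) -> close f.
Proof.
move=> cf fB e e0.
have B0 : 0 <= B by apply: le_trans (fB 0).
(* [M] is at least 1 and at least 16 B V / e, so b V = 2 B V / M^2 <= e / 8. Each of the two laws
   then contributes e / 4, and the trigonometric polynomial e / 2. *)
pose M := 1 + 16 * B * V / e.
have M1 : 1 <= M by rewrite lerDl divr_ge0 ?(ltW e0)// mulr_ge0// mulr_ge0.
have M0 : 0 < M by exact: lt_le_trans M1.
have e8 : 0 < e / 8 by rewrite divr_gt0.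
have [q tq fq] := trigonometric_approx cf fB M0 e8.
have e2 : 0 < e / 2 by rewrite divr_gt0.
have [L HL] := close_trigonometric tq e2.
have [D qD] := trigonometric_bounded tq.
pose b := 2 * B / M ^+ 2.
have b0 : 0 <= b by rewrite divr_ge0 ?sqr_ge0// mulr_ge0.
have fq' x : `|f x - q x| <= e / 8 + b * \sum_k x 0 k ^+ 2.
  apply: (le_trans (fq x)); rewrite lerD2l /b -[leRHS]mulrA.
  apply: ler_wpM2l; first by apply: mulr_ge0.
  rewrite mulr_sumr; apply: ler_sum => k _.
  by rewrite expr_div_n mulrC.
have bV : b * V <= e / 8.
  rewrite /b mulrAC ler_pdivrMr ?exprn_gt0//.
  have h1 : M <= M ^+ 2 by rewrite expr2 ler_peMr// ltW.
  have h2 : 16 * B * V <= e * M.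
    have -> : e * M = e + 16 * B * V by rewrite /M; field; rewrite gt_eqF.
    by rewrite lerDr ltW.
  have h3 : e * M <= e * M ^+ 2 by rewrite ler_pM2l.
  lra.
exists (Num.max L0 L) => l; rewrite !ge_max => /andP[l0 l1].
have [tX1 tX2] := tightX l0; have [tY1 tY2] := tightY l0.
have hX := approx_error (mX l0) (L1_vector P (mX l0) cf fB)
  (L1_vector P (mX l0) (trigonometric_continuous tq) qD) b0 fq' tX1 tX2.
have hY := approx_error (mY l0) (L1_vector Q (mY l0) cf fB)
  (L1_vector Q (mY l0) (trigonometric_continuous tq) qD) b0 fq' tY1 tY2.
have hq := HL l l1.
move: hX hY hq; rewrite !ler_norml => /andP[? ?] /andP[? ?] /andP[? ?].
by apply/andP; split; lra.
Qed.

(** A bounded moment of order p > 1 makes the clamping error small uniformly in [l], and the clamped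
    function is bounded and continuous. *)
Lemma close_moment f (p C : R) : continuous f -> 1 < p ->
  (forall l, L0 <= l -> L1 P (fun w => `|f (X l w)| `^ p) /\
    \int[P]_w (`|f (X l w)| `^ p) <= C) ->
  (forall l, L0 <= l -> L1 Q (fun w => `|f (Y l w)| `^ p) /\
    \int[Q]_w (`|f (Y l w)| `^ p) <= C) ->
  asymp_eq (fun l => 'E_P[(fun w => f (X l w))%R])%E (fun l => 'E_Q[(fun w => f (Y l w))%R])%E.
Proof.
move=> cf p1 bX bY.
have mfX l : L0 <= l -> measurable_fun setT (fun w => f (X l w)).
  by move=> l0; exact: measurable_continuous_vector (mX l0) cf.
have mfY l : L0 <= l -> measurable_fun setT (fun w => f (Y l w)).
  by move=> l0; exact: measurable_continuous_vector (mY l0) cf.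
have iX l (l0 : L0 <= l) := L1_powR (mfX l l0) (ltW p1) (bX l l0).1.
have iY l (l0 : L0 <= l) := L1_powR (mfY l l0) (ltW p1) (bY l l0).1.
have key : close f.
  move=> e e0; have C1 : 0 < `|C| + 1 by rewrite ltr_wpDl.
  pose t := 4 * (`|C| + 1) / e; have t0 : 0 < t by rewrite divr_gt0// mulr_gt0.
  have Ct : C / t <= e / 4.
    rewrite ler_pdivrMr// /t (_ : e / 4 * _ = `|C| + 1); last by field; rewrite gt_eqF.
    by have := ler_norm C; lra.
  pose B := t `^ (p - 1)^-1.
  pose g (x : 'rV[R]_K) : R := (`|f x + B| - `|f x - B|) / 2.
  have cg : continuous g.
    have cn : continuous (@Num.norm R R) by exact: norm_continuous.
    have cf1 (b : R) : continuous (fun x : 'rV[R]_K => `|f x + b|).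
      move=> x; apply: (@continuous_comp _ _ _ (fun x => f x + b) (@Num.norm R R)); last exact: cn.
      by apply: continuousD; [exact: cf|exact: cst_continuous].
    have c2 : continuous (fun _ : 'rV[R]_K => 2^-1 : R) by move=> x; exact: cst_continuous.
    by move=> x; exact: (continuousM (continuousB (cf1 B x) (cf1 (- B) x)) (c2 x)).
  have gB x : `|g x| <= `|B|.
    rewrite /g normrM (ger0_norm (x := 2^-1))// ler_pdivrMr//.
    apply: (le_trans (ler_dist_dist _ _)).
    by rewrite (_ : f x + B - (f x - B) = B * 2) ?normrM ?(ger0_norm (x := 2))//; ring.
  have e2 : 0 < e / 2 by rewrite divr_gt0.
  have [L HL] := close_bounded cg gB e2.
  exists (Num.max L0 L) => l; rewrite !ge_max => /andP[l0 l1].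
  have hX := truncation_error (mfX l l0) p1 t0 (bX l l0).1 (bX l l0).2 (erefl B).
  have hY := truncation_error (mfY l l0) p1 t0 (bY l l0).1 (bY l l0).2 (erefl B).
  have := HL l l1; move: hX hY; rewrite /g !ler_norml.
  move=> /andP[? ?] /andP[? ?] /andP[? ?]; apply/andP; split; lra.
split.
  exists L0; split; first exact: num_real.
  move=> l /ltW l0; rewrite !unlock; split; apply: integrable_fin_num => //.
  - exact: iX l l0.
  - exact: iY l l0.
apply/cvgrPdist_le => e e0; have [L HL] := key e e0.
exists L; split; first exact: num_real.
by move=> l /ltW Ll; rewrite sub0r normrN !fine_expectation; exact: HL.
Qed.

End Close.

Section Convergence.
Context (R : realType) (K : nat).
Context d (Om : measurableType d) (P : probability Om R).
Context d' (Om' : measurableType d') (Q : probability Om' R).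
Variables (X : R -> Om -> 'rV[R]_K) (Y : R -> Om' -> 'rV[R]_K) (L0 r C : R).
Hypothesis r2 : 2 < r.
Hypothesis mX : forall l, L0 <= l -> measurable_coords (X l).
Hypothesis mY : forall l, L0 <= l -> measurable_coords (Y l).
Hypothesis hcos : forall (t : 'rV[R]_K) (th : R), close P Q X Y (fun x => cos (\sum_k t 0 k * x 0 k + th)).
Hypothesis momX : forall k l, L0 <= l -> L1 P (fun w => `|X l w 0 k| `^ r) /\
  \int[P]_w (`|X l w 0 k| `^ r) <= C.
Hypothesis momY : forall k l, L0 <= l -> L1 Q (fun w => `|Y l w 0 k| `^ r) /\
  \int[Q]_w (`|Y l w 0 k| `^ r) <= C.

Let r0 : 0 < r. Proof. by move: r2; lra. Qed.

Let D := K%:R `^ r * (K%:R * C).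

Lemma norm_moment dd (O : measurableType dd) (S : probability O R) (W : O -> 'rV[R]_K) :
  measurable_coords W ->
  (forall k, L1 S (fun w => `|W w 0 k| `^ r) /\ \int[S]_w (`|W w 0 k| `^ r) <= C) ->
  L1 S (fun w => euclidean_norm (W w) `^ r) /\ \int[S]_w (euclidean_norm (W w) `^ r) <= D.
Proof.
move=> mW mom.
have [iS SE] := Rintegral_sum (index_enum 'I_K) (fun k => (mom k).1).
have i : L1 S (fun w => euclidean_norm (W w) `^ r).
  apply: L1_le (L1Z (K%:R `^ r) iS) _ => [|w].
    exact: (measurable_continuous_vector mW (continuous_euclidean_norm_powR r0)).
  by rewrite ger0_norm ?powR_ge0// norm_powR_le.
split => //; apply: (@le_trans _ _ (\int[S]_w (K%:R `^ r * \sum_k `|W w 0 k| `^ r))).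
  apply: le_Rintegral => //; first exact: L1Z.
  by move=> w _; exact: norm_powR_le.
rewrite RintegralZl// SE ler_wpM2l ?powR_ge0//.
apply: (@le_trans _ _ (\sum_(k < K) C)); first by apply: ler_sum => k _; exact: (mom k).2.
by rewrite sumr_const card_ord mulr_natl.
Qed.

Lemma tight_moment dd (O : measurableType dd) (S : probability O R) (W : O -> 'rV[R]_K) :
  measurable_coords W ->
  (forall k, L1 S (fun w => `|W w 0 k| `^ r) /\ \int[S]_w (`|W w 0 k| `^ r) <= C) ->
  L1 S (fun w => \sum_k W w 0 k ^+ 2) /\ \int[S]_w (\sum_k W w 0 k ^+ 2) <= 1 + `|D|.
Proof.
move=> mW mom; have [i iD] := norm_moment mW mom.
have le w : \sum_k W w 0 k ^+ 2 <= 1 + euclidean_norm (W w) `^ r.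
  have n0 : 0 <= euclidean_norm (W w) by exact: sqrtr_ge0.
  have := powR_interpolation n0 ltr01 (ler0n R 2) (ltW r2).
  rewrite !powR1 mul1r powR_mulrn// /euclidean_norm sqr_sqrtr//.
  by apply: sumr_ge0 => k _; exact: sqr_ge0.
have i1 := L1D (L1_cst S 1) i.
have i2 : L1 S (fun w => \sum_k W w 0 k ^+ 2).
  apply: L1_le i1 _ => [|w].
    apply: (measurable_continuous_vector (f := fun x => \sum_k x 0 k ^+ 2)) => //.
    by apply: continuous_sum => k; apply: continuous_expn => y; exact: coord_continuous.
  by rewrite ger0_norm// sumr_ge0// => k _; exact: sqr_ge0.
split => //; apply: (@le_trans _ _ (\int[S]_w (1 + euclidean_norm (W w) `^ r))).
  by apply: le_Rintegral => // w _; exact: le.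
rewrite RintegralD//; last exact: L1_cst.
by rewrite Rintegral_prob lerD2l (le_trans iD)// ler_norm.
Qed.

(** For s < r the exponent r / s exceeds 1, and this is the uniform integrability that
    [close_moment] asks for. *)
Lemma growth_moment dd (O : measurableType dd) (S : probability O R) (W : O -> 'rV[R]_K)
    (f : 'rV[R]_K -> R) s : 0 < s -> continuous f ->
  (forall x, `|f x| <= euclidean_norm x `^ s) -> measurable_coords W ->
  (forall k, L1 S (fun w => `|W w 0 k| `^ r) /\ \int[S]_w (`|W w 0 k| `^ r) <= C) ->
  L1 S (fun w => `|f (W w)| `^ (r / s)) /\ \int[S]_w (`|f (W w)| `^ (r / s)) <= D.
Proof.
move=> s0 cf fs mW mom; have [i iD] := norm_moment mW mom.
have rs : 0 < r / s by rewrite divr_gt0.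
have le w : `|f (W w)| `^ (r / s) <= euclidean_norm (W w) `^ r.
  have -> : euclidean_norm (W w) `^ r = (euclidean_norm (W w) `^ s) `^ (r / s).
    by rewrite -powRrM mulrC divfK// gt_eqF.
  by apply: powR_homo => //; exact: ltW.
have i2 : L1 S (fun w => `|f (W w)| `^ (r / s)).
  apply: L1_le i _ => [|w]; last by rewrite ger0_norm ?powR_ge0.
  apply: (measurableT_comp (f := fun y : R => y `^ (r / s))) => //.
  apply: measurableT_comp => //; exact: measurable_continuous_vector.
by split => //; apply: le_trans iD; apply: le_Rintegral.
Qed.

Lemma asymp_eq_growth (f : 'rV[R]_K -> R) s : 0 < s -> s < r -> continuous f ->
  (forall x, `|f x| <= euclidean_norm x `^ s) ->
  asymp_eq (fun l => 'E_P[(fun w => f (X l w))%R])%E (fun l => 'E_Q[(fun w => f (Y l w))%R])%E.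
Proof.
move=> s0 sr cf fs; apply: (close_moment mX mY hcos (V := 1 + `|D|) _ _ _ (p := r / s) (C := D)) => //.
- by move=> l l0; apply: tight_moment; [exact: mX|move=> k; exact: momX].
- by move=> l l0; apply: tight_moment; [exact: mY|move=> k; exact: momY].
- by rewrite ltr_pdivlMr// mul1r.
- by move=> l l0; apply: growth_moment => //; [exact: mX|move=> k; exact: momX].
- by move=> l l0; apply: growth_moment => //; [exact: mY|move=> k; exact: momY].
Qed.

Lemma approximation :
  [/\ approx_in_distribution P Q X Y,
      forall s : R, 0 < s < r -> approx_abs_moments P Q X Y s &
      forall s : nat, (1 <= s)%N -> s%:R < r -> approx_moments P Q X Y s].
Proof.
split.
- move=> f cf [B fB].
  have bb dd (O : measurableType dd) (S : probability O R) (W : O -> 'rV[R]_K) :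
      measurable_coords W -> L1 S (fun w => `|f (W w)| `^ 2) /\
      \int[S]_w (`|f (W w)| `^ 2) <= `|B| `^ 2.
    move=> mW; have le w : `|f (W w)| `^ 2 <= `|B| `^ 2.
      by apply: powR_homo => //; rewrite (le_trans (fB _))// ler_norm.
    have i : L1 S (fun w => `|f (W w)| `^ 2).
      apply: (@L1_bounded _ _ _ _ _ (`|B| `^ 2)) => [|w]; last by rewrite ger0_norm ?powR_ge0.
      apply: (measurableT_comp (f := fun y : R => y `^ 2)) => //.
      apply: measurableT_comp => //; exact: measurable_continuous_vector.
    split => //; rewrite -[leRHS](@Rintegral_prob _ _ _ S); apply: le_Rintegral => //.
    exact: L1_cst.
  apply: (close_moment mX mY hcos (V := 1 + `|D|) _ _ _ (p := 2) (C := `|B| `^ 2)) => //.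
  + by move=> l l0; apply: tight_moment; [exact: mX|move=> k; exact: momX].
  + by move=> l l0; apply: tight_moment; [exact: mY|move=> k; exact: momY].
  + by rewrite ltr1n.
  + by move=> l l0; apply: bb; exact: mX.
  + by move=> l l0; apply: bb; exact: mY.
- move=> s /andP[s0 sr]; apply: (asymp_eq_growth (f := fun x => euclidean_norm x `^ s) s0 sr).
    exact: continuous_euclidean_norm_powR.
  by move=> x; rewrite ger0_norm ?powR_ge0.
- move=> s s1 sr m ms; apply: (asymp_eq_growth (f := monomial m) (s := s%:R)) => //.
  + by rewrite ltr0n.
  + exact: continuous_monomial.
  + by move=> x; rewrite powR_mulrn ?sqrtr_ge0// -ms; exact: monomial_le_norm.
Qed.

End Convergence.

(** * Vectors of additive functionals *)

Section Admissible.
Context d (Om : measurableType d) (R : realType) (P : probability Om R).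
Context (A : finType) (p : A -> R).
Variables (T : R -> Om -> {fset (seq A)}) (U : R -> A -> Om -> {fset (seq A)}).
Variable (Z : set Om).
Hypothesis M : trie_recursion P p T U Z.
Hypotheses (hA : (2 <= #|A|)%N) (p_gt0 : forall a, 0 < p a).
Hypothesis (p_sum1 : \sum_a p a = 1).
Variable r : R.
Hypothesis r2 : 2 < r.
Local Notation centered := (trie_centered P T).
Implicit Types (f h : {fset (seq A)} -> R).

Definition small (X : R -> Om -> R) := forall e : R, 0 < e -> exists L : R,
  forall l, L <= l -> (\int[P]_w ((X l w) ^+ 2)%:E <= (e * l)%:E)%E.

(** The scalar hypotheses in a form closed under linear combinations, as the Cramer-Wold argument
    requires. *)
Definition admissible f := [/\ f fset0 = 0,
  power_bound P 2 (centered (additive_functional f)), small (centered f) &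
  power_bound P r (centered f)].

Let mc g l : measurable_fun setT (centered g l).
Proof. exact: (measurable_TR M l (fun t => g t - trie_mean P T g l)). Qed.

Let mcZ k g l : measurable_fun setT (fun w => k * centered g l w).
Proof. by apply: measurable_funM. Qed.

Let r0 : 0 <= r. Proof. by move: r2; lra. Qed.

Lemma small_power_bound X : small X -> power_bound P 2 X.
Proof. by move=> sX; apply/power_bound2; exists 1; exact: sX. Qed.

Lemma smallD c (X Y : R -> Om -> R) : (forall l, measurable_fun setT (X l)) ->
  (forall l, measurable_fun setT (Y l)) -> small X -> small Y ->
  small (fun l w => X l w + c * Y l w).
Proof.
move=> mX mY sX sY e e0.
have c1 : 0 < c ^+ 2 + 1 by rewrite ltr_wpDl ?sqr_ge0.
have [L HX] := sX (e / 4) (divr_gt0 e0 (ltr0n R 4)).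
have e1 : 0 < e / (4 * (c ^+ 2 + 1)) by rewrite divr_gt0// mulr_gt0.
have [L' HY] := sY _ e1.
exists (Num.max 1 (Num.max L L')) => l; rewrite !ge_max => /and3P[l1 /HX hX /HY hY].
have l0 : 0 < l by exact: lt_le_trans l1.
have mX2 : measurable_fun setT (fun w => X l w ^+ 2) by exact: measurable_funX.
have mY2 : measurable_fun setT (fun w => Y l w ^+ 2) by exact: measurable_funX.
have iX : L1 P (fun w => X l w ^+ 2).
  by apply: L1_ge0 => // [w|]; [exact: sqr_ge0|apply: (le_lt_trans hX); rewrite ltry].
have iY : L1 P (fun w => Y l w ^+ 2).
  by apply: L1_ge0 => // [w|]; [exact: sqr_ge0|apply: (le_lt_trans hY); rewrite ltry].
have le w : (X l w + c * Y l w) ^+ 2 <= 2 * X l w ^+ 2 + 2 * c ^+ 2 * Y l w ^+ 2.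
  by have := sqr_ge0 (X l w - c * Y l w); rewrite -mulrA -exprMn; nra.
have iB : L1 P (fun w => 2 * X l w ^+ 2 + 2 * c ^+ 2 * Y l w ^+ 2).
  by apply: L1D; exact: L1Z.
have mXY : measurable_fun setT (fun w => (X l w + c * Y l w) ^+ 2).
  by apply: measurable_funX; apply: measurable_funD => //; exact: measurable_funM.
have iXY : L1 P (fun w => (X l w + c * Y l w) ^+ 2).
  by apply: L1_le iB _ => // w; rewrite ger0_norm ?sqr_ge0.
rewrite -EFin_Rintegral// lee_fin; rewrite -EFin_Rintegral// lee_fin in hX.
rewrite -EFin_Rintegral// lee_fin in hY.
apply: (@le_trans _ _ (\int[P]_w (2 * X l w ^+ 2 + 2 * c ^+ 2 * Y l w ^+ 2))).
  by apply: le_Rintegral => // w _; exact: le.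
rewrite RintegralD//; try exact: L1Z.
rewrite !RintegralZl//.
have h2 : 2 * c ^+ 2 * \int[P]_w (Y l w ^+ 2) <= e / 2 * l.
  apply: (@le_trans _ _ (2 * (c ^+ 2 + 1) * (e / (4 * (c ^+ 2 + 1)) * l))).
    apply: ler_pM => //.
    - by rewrite mulr_ge0// sqr_ge0.
    - by apply: Rintegral_ge0 => w _; exact: sqr_ge0.
    - by rewrite ler_pM2l// lerDl.
  rewrite le_eqVlt; apply/orP; left; apply/eqP.
  by move: (c ^+ 2 + 1) c1 => b b0; field; rewrite gt_eqF.
lra.
Qed.

Lemma additive_functionalD f h c t : additive_functional (fun u => f u + c * h u) t =
  additive_functional f t + c * additive_functional h t.
Proof. by rewrite /additive_functional big_split/= mulr_sumr. Qed.

Lemma power_bound_centeredD s f h c : 0 <= s ->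
  (forall l, 0 < l -> square_integrable P (fun w => f (T l w))) ->
  (forall l, 0 < l -> square_integrable P (fun w => h (T l w))) ->
  power_bound P s (centered f) -> power_bound P s (centered h) ->
  power_bound P s (centered (fun t => f t + c * h t)).
Proof.
move=> s0 sf sh bf bh.
apply: (@power_bound_eq_gt0 _ _ _ _ _ (fun l w => centered f l w + c * centered h l w)).
  by move=> l w l0; rewrite centeredD//; [exact: sf|exact: sh].
exact: (power_boundD s0 (mc f) (mcZ c h) bf (power_boundZ c s0 (mc h) bh)).
Qed.

Lemma admissible0 : admissible (fun=> 0).
Proof.
have c0 : centered (fun=> 0) = fun _ _ => 0.
  by apply/funext => l; apply/funext => w; rewrite /trie_centered /trie_mean Rintegral_prob subrr.
have b0 s : 0 <= s -> power_bound P s (fun _ _ : _ => 0).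
  by move=> s0; apply: (@power_bound_bounded _ _ _ P s 0) => // l w; rewrite normr0.
split => //.
- have -> : additive_functional (fun=> 0) = (fun=> 0) :> ({fset (seq A)} -> R).
    by apply/funext => t; rewrite /additive_functional big1.
  by rewrite c0; exact: b0.
- rewrite c0 => e e0; exists 0 => l l0; under eq_integral do rewrite expr0n/=.
  by rewrite integral0 lee_fin mulr_ge0// ltW.
- by rewrite c0; exact: b0.
Qed.

Lemma admissibleD f h c : admissible f -> admissible h ->
  admissible (fun t => f t + c * h t).
Proof.
move=> [f0 vf sf pf] [h0 vh sh ph].
have h2 : 0 <= 2 :> R by [].
have sqf := square_integrable_of_bound M (small_power_bound sf).
have sqh := square_integrable_of_bound M (small_power_bound sh).
split.
- by rewrite f0 h0 mulr0 addr0.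
- have -> : additive_functional (fun t => f t + c * h t) =
      (fun t => additive_functional f t + c * additive_functional h t).
    by apply/funext => t; exact: additive_functionalD.
  exact: (power_bound_centeredD c h2 (square_integrable_of_bound M vf)
    (square_integrable_of_bound M vh) vf vh).
- move=> e e0; have [L HL] := smallD c (mc f) (mc h) sf sh e0.
  exists (Num.max 1 L) => l; rewrite ge_max => /andP[l1 /HL]; apply: le_trans.
  have l0 : 0 < l by exact: lt_le_trans l1.
  rewrite le_eqVlt; apply/orP; left; apply/eqP; apply: eq_integral => w _.
  by congr ((_ ^+ 2)%:E); apply: centeredD; [|exact: sqf|exact: sqh].
- exact: (power_bound_centeredD c r0 sqf sqh pf ph).
Qed.

Lemma admissible_sum (I : Type) (s : seq I) (c : I -> R) (f : I -> {fset (seq A)} -> R) :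
  (forall i, admissible (f i)) -> admissible (fun t => \sum_(i <- s) c i * f i t).
Proof.
move=> af; elim: s => [|i s IH].
  have := admissible0; congr admissible; apply/funext => t; by rewrite big_nil.
have := admissibleD (c i) IH (af i); congr admissible.
by apply/funext => t; rewrite big_cons addrC.
Qed.

Lemma ebigO_bound (I : R -> \bar R) (g : R -> R) : ebigO I g ->
  exists C L : R, forall l, L <= l -> (I l <= (C * g l)%:E)%E.
Proof.
(* The filter at +oo provides the bound for l > L strictly, hence the shift by 1. *)
move=> [C [L [_ H]]]; exists C, (L + 1) => l Ll.
by apply: (le_trans (lee_abs _)); apply: H; lra.
Qed.

Lemma admissible_of_moments f : f fset0 = 0 ->
  ebigO (fun l => 'V_P[fun w => additive_functional f (T l w)])%E (fun l => l) ->
  elittleo (fun l => 'V_P[fun w => f (T l w)])%E (fun l => l) ->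
  ebigO (fun l => 'E_P[(fun w => `|f (T l w) - fine 'E_P[fun w => f (T l w)]| `^ r)%R])%E
    (fun l => l `^ (r / 2)) -> admissible f.
Proof.
move=> f0 /ebigO_bound[C [L H]] lf /ebigO_bound[C' [L' H']]; split => //.
- by apply/power_bound2; exists C, L => l /H; rewrite varianceRE.
- move=> e e0; have [L1 [_ H1]] := lf e e0; exists (L1 + 1) => l Ll.
  have := H1 l; rewrite varianceRE => h; apply: (le_trans (lee_abs _)).
  by apply: h; lra.
- by exists C', L' => l /H'; rewrite fine_expectation unlock => h; exact: h.
Qed.

Section Vector.
Variables (K : nat) (phi : 'I_K -> {fset (seq A)} -> R).
Hypothesis adm : forall k, admissible (phi k).
Let F k := additive_functional (phi k).
Let c k l w := centered (F k) l w.

Let sqF k l : 0 < l -> square_integrable P (fun w => F k (T l w)).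
Proof. by have [_ v _ _] := adm k; exact: (square_integrable_of_bound M v). Qed.

Let sqc k l : 0 < l -> square_integrable P (c k l).
Proof.
by move=> l0; apply: square_integrableB; [exact: sqF|exact: square_integrable_cst].
Qed.

Lemma centered_sum (t : 'I_K -> R) l w : 0 < l ->
  centered (additive_functional (fun u => \sum_k t k * phi k u)) l w =
  \sum_k t k * c k l w.
Proof.
move=> l0.
have E u : additive_functional (fun u => \sum_k t k * phi k u) u = \sum_k t k * F k u.
  rewrite /additive_functional exchange_big/=.
  by apply: eq_bigr => k _; rewrite mulr_sumr.
have [_ sE] := Rintegral_sum (index_enum 'I_K)
  (fun k => L1Z (t k) (square_integrable_L1 (sqF k l0))).
rewrite /trie_centered /trie_mean; under eq_Rintegral do rewrite E.
rewrite E sE -sumrB; apply: eq_bigr => k _.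
by rewrite RintegralZl ?mulrBr//; exact/square_integrable_L1/sqF.
Qed.

Definition covariance_matrix l : 'M[R]_K :=
  \matrix_(k, j) (fine (covariance P (fun w => F k (T l w)) (fun w => F j (T l w))) / l).

Lemma covariance_matrixE l k j :
  covariance_matrix l k j = \int[P]_w (c k l w * c j l w) / l.
Proof.
rewrite mxE; congr (_ / _); rewrite unlock.
rewrite (fine_expectation P (fun w => (F k (T l w) - fine 'E_P[fun w => F k (T l w)]) *
  (F j (T l w) - fine 'E_P[fun w => F j (T l w)]))).
by apply: eq_Rintegral => w _; rewrite !fine_expectation.
Qed.

(** The variance of the combination with coefficients [t] is the quadratic form that
    [gaussian_vector] prescribes in that direction. *)
Lemma covariance_form (t : 'rV[R]_K) l : 0 < l ->
  \int[P]_w ((\sum_k t 0 k * c k l w) ^+ 2) / l =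
  (t *m covariance_matrix l *m t^T) 0 0.
Proof.
move=> l0.
have iM k j := square_integrableM (sqc k l0) (sqc j l0).
have iJ k := Rintegral_sum (index_enum 'I_K) (fun j => L1Z (t 0 k * t 0 j) (iM k j)).
have [_ iK] := Rintegral_sum (index_enum 'I_K) (fun k => (iJ k).1).
transitivity ((\sum_k \sum_j t 0 k * t 0 j * \int[P]_w (c k l w * c j l w)) / l).
  congr (_ / _); transitivity (\int[P]_w (\sum_k \sum_j t 0 k * t 0 j * (c k l w * c j l w))).
    apply: eq_Rintegral => w _; rewrite expr2 mulr_suml; apply: eq_bigr => k _.
    by rewrite mulr_sumr; apply: eq_bigr => j _; ring.
  rewrite iK; apply: eq_bigr => k _; rewrite (iJ k).2; apply: eq_bigr => j _.
  by rewrite RintegralZl//; exact: iM.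
rewrite mxE exchange_big/= mulr_suml; apply: eq_bigr => j _.
rewrite !mxE mulr_suml mulr_suml; apply: eq_bigr => k _.
by rewrite covariance_matrixE; ring.
Qed.

Let X l w : 'rV[R]_K := \row_k (c k l w / Num.sqrt l).

Lemma measurable_normalized l : measurable_coords (X l).
Proof.
move=> k; have := measurable_funM (measurable_cst (Num.sqrt l)^-1) (mc (F k) l).
by congr measurable_fun; apply/funext => w; rewrite mxE mulrC.
Qed.

(** Cramer-Wold: the combination of the functionals is the additive functional of the combined toll,
    to which the scalar limit applies. The threshold is uniform in the phase [th]. *)
Lemma normalized_cf (t : 'rV[R]_K) (e : R) : 0 < e -> exists l0, forall l, l0 <= l -> forall th,
  `|\int[P]_w cos (\sum_k t 0 k * X l w 0 k + th) -
    expR (- ((t *m covariance_matrix l *m t^T) 0 0 / 2)) * cos th| <= e.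
Proof.
move=> e0; have [g0 vg sg pg] := admissible_sum (index_enum 'I_K) (t 0) adm.
have [l0 H] := functional_cf_limit M hA p_gt0 p_sum1 g0 r2 vg sg pg e0.
exists (Num.max 1 l0) => l; rewrite ge_max => /andP[l1 /H hl] th.
have l_gt0 : 0 < l by exact: lt_le_trans l1.
have := hl th; rewrite -covariance_form//.
have -> : \int[P]_w (centered (additive_functional (fun u => \sum_k t 0 k * phi k u)) l w ^+ 2) =
    \int[P]_w ((\sum_k t 0 k * c k l w) ^+ 2).
  by apply: eq_Rintegral => w _; rewrite centered_sum.
congr (`|_ - _| <= _); apply: eq_Rintegral => w _; congr (cos (_ + _)).
rewrite centered_sum// mulr_suml; apply: eq_bigr => k _.
by rewrite mxE mulrA.
Qed.

Lemma normalized_moment k : exists C L : R, forall l, L <= l ->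
  L1 P (fun w => `|X l w 0 k| `^ r) /\ \int[P]_w (`|X l w 0 k| `^ r) <= C.
Proof.
have [f0 v s q] := adm k.
have [C [L H]] := power_bound_L1 (mc (F k)) (functional_moment M hA p_gt0 p_sum1 f0 r2 v s q).
exists C, (Num.max 1 L) => l; rewrite ge_max => /andP[l1 /H[i h]].
have l0 : 0 < l by exact: lt_le_trans l1.
have E w : `|X l w 0 k| `^ r = l `^ (- (r / 2)) * `|c k l w| `^ r.
  rewrite mxE normrM powRM// mulrC; congr (_ * _).
  rewrite normfV (ger0_norm (sqrtr_ge0 _)) -powR12_sqrt ?ltW//.
  by rewrite -powRN -powRrM; congr (_ `^ _); field.
have -> : (fun w => `|X l w 0 k| `^ r) = (fun w => l `^ (- (r / 2)) * `|c k l w| `^ r).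
  by apply/funext => w; exact: E.
split; first exact: L1Z.
rewrite RintegralZl//; apply: (@le_trans _ _ (l `^ (- (r / 2)) * (C * l `^ (r / 2)))).
  by rewrite ler_wpM2l// powR_ge0.
rewrite mulrCA -powRD; last by rewrite (gt_eqF l0) implybT.
by rewrite addNr powRr0 mulr1.
Qed.

Lemma covariance_diag_bound k : exists V L : R, forall l, L <= l ->
  covariance_matrix l k k <= V.
Proof.
have [_ /power_bound2[V [L H]] _ _] := adm k.
exists V, (Num.max 1 L) => l; rewrite ge_max => /andP[l1 /H h].
have l0 : 0 < l by exact: lt_le_trans l1.
rewrite covariance_matrixE ler_pdivrMr// -lee_fin EFin_Rintegral.
  by apply: le_trans h; under eq_integral do rewrite -expr2; exact: lexx.
exact: square_integrableM (sqc k l0) (sqc k l0).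
Qed.

(** Two exponential moments dominate the coordinate's moment of order [r], uniformly over variances
    at most [V]. Uniformity matters because the covariance matrix moves with [l]. *)
Lemma gaussian_moment dd (O : measurableType dd) (Q : probability O R) (W : O -> 'rV[R]_K) S V k :
  gaussian_vector Q W S -> S k k <= V ->
  forall C, (forall x : R, 0 <= x -> x `^ r <= C * expR x) -> 0 <= C ->
  L1 Q (fun w => `|W w 0 k| `^ r) /\
  \int[Q]_w (`|W w 0 k| `^ r) <= C * (2 * expR (V / 2)).
Proof.
move=> gW SV C HC C0; have [mW _ _] := gW.
have E u : (\int[Q]_w (expR (u * W w 0%R k))%:E = (expR (u ^+ 2 * S k k / 2))%:E)%E.
  exact: gaussian_vector_expR.
have i u : L1 Q (fun w => expR (u * W w 0 k)).
  apply: L1_ge0 => [|w|]; [|exact: expR_ge0|by rewrite E ltry].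
  by apply: measurableT_comp => //; exact: measurable_funM.
have Er u : \int[Q]_w expR (u * W w 0 k) = expR (u ^+ 2 * S k k / 2) by rewrite /Rintegral E.
have iB := L1Z C (L1D (i 1) (i (-1))).
have le w : `|W w 0 k| `^ r <= C * (expR (1 * W w 0 k) + expR (-1 * W w 0 k)).
  apply: (le_trans (HC _ (normr_ge0 _))); rewrite ler_wpM2l// mul1r mulN1r.
  by case: (ger0P (W w 0 k)) => _; rewrite ?lerDl ?lerDr expR_ge0.
have i2 : L1 Q (fun w => `|W w 0 k| `^ r).
  apply: L1_le iB _ => [|w]; first exact: measurable_powR_norm.
  by rewrite ger0_norm ?powR_ge0.
split => //.
apply: (@le_trans _ _ (\int[Q]_w (C * (expR (1 * W w 0 k) + expR (-1 * W w 0 k))))).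
  by apply: le_Rintegral => // w _; exact: le.
rewrite RintegralZl//; last exact: L1D.
have -> : \int[Q]_x (expR (1 * W x 0 k) + expR (-1 * W x 0 k)) =
    expR (1 ^+ 2 * S k k / 2) + expR ((-1) ^+ 2 * S k k / 2).
  by rewrite (RintegralD measurableT (i 1) (i (-1))); congr (_ + _); exact: Er.
rewrite sqrrN expr1n mul1r ler_wpM2l//.
have : expR (S k k / 2) <= expR (V / 2) by rewrite ler_expR ler_pM2r.
lra.
Qed.

(** There are finitely many coordinates, and sums of absolute values serve as common constants and
    thresholds. *)
Lemma uniform_bound (p0 : 'I_K -> R -> R -> Prop) :
  (forall k C D l, C <= D -> p0 k C l -> p0 k D l) ->
  (forall k, exists C L : R, forall l, L <= l -> p0 k C l) ->
  exists C L : R, forall k l, L <= l -> p0 k C l.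
Proof.
move=> mono H.
have H' k : exists CL : R * R, forall l, CL.2 <= l -> p0 k CL.1 l.
  by have [C [L h]] := H k; exists (C, L).
have [CL HCL] := choice H'.
have le (g : 'I_K -> R) k : g k <= \sum_j `|g j|.
  by rewrite (le_trans (ler_norm _))// (bigD1 k)//= lerDl sumr_ge0.
exists (\sum_k `|(CL k).1|), (\sum_k `|(CL k).2|) => k l Ll.
apply: mono (HCL k l _); first exact: (le (fun k => (CL k).1)).
exact: le_trans (le (fun k => (CL k).2) k) Ll.
Qed.

Lemma normalized_approximation dd (O : measurableType dd) (Q : probability O R)
    (Y : R -> O -> 'rV[R]_K) :
  (\forall l \near +oo, gaussian_vector Q (Y l) (covariance_matrix l)) ->
  [/\ approx_in_distribution P Q X Y,
      forall s : R, 0 < s < r -> approx_abs_moments P Q X Y s &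
      forall s : nat, (1 <= s)%N -> s%:R < r -> approx_moments P Q X Y s].
Proof.
move=> [L1_ [_ gY']].
have gY l : L1_ + 1 <= l -> gaussian_vector Q (Y l) (covariance_matrix l).
  by move=> h; apply: gY'; lra.
have [C1 [L2 HX]] : exists C L : R, forall k l, L <= l ->
    L1 P (fun w => `|X l w 0 k| `^ r) /\ \int[P]_w (`|X l w 0 k| `^ r) <= C.
  apply: (@uniform_bound (fun k C l => L1 P (fun w => `|X l w 0 k| `^ r) /\
    \int[P]_w (`|X l w 0 k| `^ r) <= C)); last exact: normalized_moment.
  by move=> k C D l CD [i h]; split => //; exact: le_trans CD.
have [V [L3 HV]] : exists C L : R, forall k l, L <= l -> covariance_matrix l k k <= C.
  apply: (@uniform_bound (fun k C l => covariance_matrix l k k <= C)).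
    by move=> k C D l CD h; exact: le_trans CD.
  exact: covariance_diag_bound.
have [C C0 HC] := @powR_le_expR R r r0.
pose L := Num.max (Num.max (L1_ + 1) L2) L3.
have LL l : L <= l -> [/\ L1_ + 1 <= l, L2 <= l & L3 <= l].
  by rewrite !ge_max => /andP[/andP[-> ->] ->].
(* One constant for both the functionals and the Gaussian vectors, since [approximation] takes a
   common moment bound. *)
pose D := Num.max C1 (C * (2 * expR (V / 2))).
apply: (@approximation R K _ _ P _ _ Q X Y L r D r2).
- by move=> l _; exact: measurable_normalized.
- by move=> l /LL[/gY[]].
- move=> t th e e0; have e2 : 0 < e / 2 by rewrite divr_gt0.
  have [l0 H] := normalized_cf t e2; exists (Num.max L l0) => l.
  rewrite ge_max => /andP[/LL[/gY g _ _] /H/(_ th) h].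
  by rewrite (gaussian_vector_cos g); apply: (le_trans h); lra.
- move=> k l /LL[_ l2 _]; have [i h] := HX k l l2.
  by split => //; apply: (le_trans h); rewrite le_max lexx.
- move=> k l /LL[/gY g _ /(HV k) h]; have [i h'] := gaussian_moment g h HC C0.
  by split => //; apply: (le_trans h'); rewrite le_max lexx orbT.
Qed.

End Vector.
End Admissible.

Lemma random_trie_recursion d (Om : measurableType d) (R : realType)
    (P : probability Om R) (A : finType) (p : A -> R)
    (Xi : nat -> Om -> nat -> A) (N : R -> {RV P >-> nat}) :
  (2 <= #|A|)%N -> (forall a, 0 < p a) -> \sum_a p a = 1 -> trie_model Xi p N ->
  trie_recursion P p (random_trie Xi N) (subtrie Xi N) (collision Xi).
Proof.
move=> hA p_gt0 p_sum1 model; split.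
- exact: random_trie_discrete model.
- exact: subtrie_discrete model.
- move=> l B; exact: subtrie_split.
- exact: measurable_collision model.
- exact: collision0 hA p_gt0 p_sum1 model.
- move=> l w; exact: random_trie_joined.
- move=> l l' t; exact: (random_trie_dom model t).
- move=> l u; exact: leaves_expR.
Qed.

Theorem theorem5p6 (R : realType) (A : finType) (hA : (2 <= #|A|)%N)
  (p : A -> R) (p_gt0 : forall a, 0 < p a) (p_sum1 : \sum_a p a = 1)
  (d : measure_display) (Omega : measurableType d) (P : probability Omega R)
  (Xi : nat -> Omega -> nat -> A) (N : R -> {RV P >-> nat})
  (model : trie_model Xi p N)
  (K : nat) (K_gt0 : (1 <= K)%N)
  (phi : 'I_K -> {fset (seq A)} -> R)
  (phi_toll : forall k, toll_function (phi k))
  (r : R) (r_gt2 : 2 < r) :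
  let T : R -> Omega -> {fset (seq A)} := random_trie Xi N in
  let toll k l : Omega -> R := fun w => phi k (T l w) in
  let Phi k l : Omega -> R := fun w => additive_functional (phi k) (T l w) in
  (forall k,
    [/\ ebigO (fun l => 'V_P[Phi k l]) (fun l => l),
        elittleo (fun l => 'V_P[toll k l]) (fun l => l) &
        ebigO (fun l =>
                 'E_P[(fun w => `|toll k l w - fine 'E_P[toll k l]| `^ r)%R])%E
              (fun l => l `^ (r / 2))]) ->
  let X l w : 'rV[R]_K :=
    \row_k ((Phi k l w - fine 'E_P[Phi k l]) / Num.sqrt l) in
  let Sigma l : 'M[R]_K :=
    \matrix_(k, j) (fine (covariance P (Phi k l) (Phi j l)) / l) in
  forall (d' : measure_display) (Omega' : measurableType d')
    (Q : probability Omega' R) (Y : R -> Omega' -> 'rV[R]_K),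
  (\forall l \near +oo, gaussian_vector Q (Y l) (Sigma l)) ->
  [/\ approx_in_distribution P Q X Y,
      forall s : R, 0 < s < r -> approx_abs_moments P Q X Y s &
      forall s : nat, (1 <= s)%N -> s%:R < r -> approx_moments P Q X Y s].
Proof.
move=> T toll Phi hyp X Sigma d' Omega' Q Y gY.
have M := random_trie_recursion hA p_gt0 p_sum1 model.
have adm k : admissible P T r (phi k).
  by have [h1 h2 h3] := hyp k; exact: admissible_of_moments (phi_toll k) h1 h2 h3.
have XE : X = fun l w => \row_k (trie_centered P T (additive_functional (phi k)) l w / Num.sqrt l).
  by apply/funext => l; apply/funext => w; apply/rowP => k; rewrite !mxE fine_expectation.
rewrite XE.
exact: (normalized_approximation M hA p_gt0 p_sum1 r_gt2 adm gY).
Qed.
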